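(* Let $q$ be any large integer and let $\log N = \tau \sqrt{\log q \log\log q}$ with $\tau = (\log\log q)^{O(1)}$. Define $A$ and $\tau'$ by \[\tau = \int_{A}^\infty e^{-x}\frac{dx}{x}, \qquad \tau' = \int_{A}^\infty e^{-x} \frac{dx}{x^2}.\] Then \[\Delta(N,q) \geq \sqrt{N} \exp\left((1 + o(1))A(\tau + \tau')\sqrt{\frac{\log q}{\log\log q}}\right).\] If $q$ is prime, define instead $A$ and $\tau'$ by \[\sqrt{2}\,\tau = \int_A^\infty e^{-x}\frac{dx}{x}, \qquad \tau' = \int_{A}^\infty e^{-x}\frac{dx}{x^2};\] with this definition, \[\Delta\!\left(\frac{q}{N}, q\right) \geq \sqrt{\frac{q}{N}} \exp\left((1 + o(1))A\left(\tau + \frac{\tau'}{\sqrt{2}}\right)\sqrt{\frac{\log q}{\log\log q}}\right).\] Here $o(1)$ denotes quantities tending to $0$ as $q\to\infty$.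
   Context: For a positive integer $q$ and real $N\ge 1$, $\Delta(N,q) = \sup_{\chi \neq \chi_0 \bmod q} \left| \sum_{n \leq N}\chi(n)\right|$, the supremum over non-principal Dirichlet characters $\chi$ modulo $q$. *)

(* Defs.v *)
From Stdlib Require Import Reals Lra Lia Znumtheory.
From Coquelicot Require Import Coquelicot.
Open Scope R_scope.

Definition dirichlet_character (q : nat) (chi : nat -> C) : Prop :=
  chi 1%nat = 1%C /\
  (forall m n : nat, chi (m * n)%nat = Cmult (chi m) (chi n)) /\
  (forall n : nat, chi (n + q)%nat = chi n) /\
  (forall n : nat, chi n <> 0%C <-> Nat.gcd n q = 1%nat).

Definition principal_character (q : nat) (n : nat) : C :=
  if Nat.eqb (Nat.gcd n q) 1 then 1%C else 0%C.

Definition nonprincipal (q : nat) (chi : nat -> C) : Prop :=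
  exists n : nat, chi n <> principal_character q n.

Definition char_sum (chi : nat -> C) (N : R) : C :=
  sum_n_m chi 1 (Z.to_nat (Int_part N)).

Definition Delta_chi (N : R) (q : nat) : Rbar :=
  Lub_Rbar (fun x : R => exists chi : nat -> C,
    dirichlet_character q chi /\ nonprincipal q chi /\ x = Cmod (char_sum chi N)).

(* Main.v *)
(** The resonance method. For non-negative weights [rho] on integers [m <= M], orthogonality of the
    characters mod [q] turns the average of [(sum_(n <= N) chi n) * |sum_m rho m * chi m| ^ 2] over [chi]
    into a sum over [n * m1 = m2 mod q], which is at least the diagonal sum over [n * m1 = m2]; the
    trivial character contributes little when [N * M] is below [totient q]. Hence some non-trivial
    character sum is at least [sum rho m * rho (n * m) / sum rho m ^ 2]. With [rho] multiplicative,
    carried by squarefree products of primes [p > lam ^ 2] where [lam ^ 2] is about [ln M * ln (ln M)],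
    and [rho p = lam / (sqrt p * ln p)], the numerator is a sum over disjoint pairs of sets of primes.
    Tilting by [n ^ (- 1 / 2 - alpha)] makes it a probability measure; [alpha] is chosen so that the
    mean of [ln n] is [ln N], and then Chebyshev (for [n <= N]) and Markov (for [n * m <= M]) lose only a
    constant. By Mertens' theorem and Abel summation one has [alpha <= A / ln (lam ^ 2)], and the gain over
    [sqrt N] is [exp (exp (- A) * lam / ln (lam ^ 2))]. Integrating by parts,
    [A * (tau + tau') = exp (- A)], which is the exponent in the statement.

    For prime [q] and length [q / N] one uses in addition the cosine transform of the resonator, which
    turns the sum over [n <= q / N] into a kernel that is non-negative at integers [m2 / m1 <= N / 4] and at
    most [4 * M] in absolute value at the non-integral residues [m2 / m1]. The latter terms are negligible
    only for [M] slightly below [sqrt q], which is where the factor [sqrt 2] comes from. *)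
Require Import Defs.
From Stdlib Require Import Reals Lra Lia Znumtheory.
From Coquelicot Require Import Coquelicot.
From HB Require structures.
From mathcomp Require all_boot all_algebra all_fingroup all_solvable all_field all_character zify.
Open Scope R_scope.

(** The size of [lam] is forced by the mean of [ln (n * m)]: the squared weights contribute about
    [lam ^ 2 / ln (lam ^ 2)], which must fit under [ln M]. Then [ln N] is about [tau * lam], and [A]
    is the value of [alpha * ln (lam ^ 2)] at which the mean of [ln n] reaches [tau * lam]. An upper
    bound for [alpha] suffices, because the lower bound for the gain decreases in [alpha]. The
    obstacle is large [tau]. To control the variance of [ln n] the primes are cut off at
    [Y ^ (2 * b)], with [Y] about [lam ^ 2] and [b] about a power of [ln (ln q)]. A non-negative
    tilt then reaches only a mean of order [lam * ln b], while [tau] may itself be a power of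
    [ln (ln q)]. So [alpha] may go down to a tiny [- kap], at a cost [kap * ln N] that is negligible
    against [lam / ln Y]. All estimates are written in [x = ln (ln q)]: the parameters are
    essentially exponentials of linear combinations of [x] and [ln x], and the asymptotic claims
    reduce to [c + m * ln x <= a * x] for large [x]. *)

Module Sums.
Import HB.structures all_boot.
Set Implicit Arguments. Unset Strict Implicit. Unset Printing Implicit Defensive.
Open Scope R_scope.

(** * Finite sums over the standard reals and Coquelicot's complex numbers, through the [bigop]
    library *)

Fact RplusA : associative Rplus. Proof. by move=> x y z; rewrite Rplus_assoc. Qed.
Fact Rplus0l : left_id 0 Rplus. Proof. exact: Rplus_0_l. Qed.
HB.instance Definition _ := Monoid.isComLaw.Build R 0 Rplus RplusA Rplus_comm Rplus0l.
Fact RmultA : associative Rmult. Proof. by move=> x y z; rewrite Rmult_assoc. Qed.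
Fact Rmult1l : left_id 1 Rmult. Proof. exact: Rmult_1_l. Qed.
HB.instance Definition _ := Monoid.isComLaw.Build R 1 Rmult RmultA Rmult_comm Rmult1l.
Fact Rmult0l : left_zero 0 Rmult. Proof. exact: Rmult_0_l. Qed.
Fact Rmult0r : right_zero 0 Rmult. Proof. exact: Rmult_0_r. Qed.
HB.instance Definition _ := Monoid.isMulLaw.Build R 0 Rmult Rmult0l Rmult0r.
Fact RmultDl : left_distributive Rmult Rplus. Proof. by move=> x y z; ring. Qed.
Fact RmultDr : right_distributive Rmult Rplus. Proof. by move=> x y z; ring. Qed.
HB.instance Definition _ := Monoid.isAddLaw.Build R Rmult Rplus RmultDl RmultDr.

Fact CplusA : associative Cplus. Proof. by move=> x y z; rewrite Cplus_assoc. Qed.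
Fact Cplus0l : left_id (RtoC 0) Cplus. Proof. exact: Cplus_0_l. Qed.
HB.instance Definition _ := Monoid.isComLaw.Build C (RtoC 0) Cplus CplusA Cplus_comm Cplus0l.
Fact Cmult0l : left_zero (RtoC 0) Cmult. Proof. exact: Cmult_0_l. Qed.
Fact Cmult0r : right_zero (RtoC 0) Cmult. Proof. exact: Cmult_0_r. Qed.
HB.instance Definition _ := Monoid.isMulLaw.Build C (RtoC 0) Cmult Cmult0l Cmult0r.
Fact CmultDl : left_distributive Cmult Cplus. Proof. by move=> x y z; ring. Qed.
Fact CmultDr : right_distributive Cmult Cplus. Proof. by move=> x y z; ring. Qed.
HB.instance Definition _ := Monoid.isAddLaw.Build C Cmult Cplus CmultDl CmultDr.

Notation "\sum_ ( i <- r | P ) F" := (\big[Rplus/IZR 0]_(i <- r | P%B) F) : R_scope.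
Notation "\sum_ ( i <- r ) F" := (\big[Rplus/IZR 0]_(i <- r) F) : R_scope.
Notation "\sum_ ( m <= i < n | P ) F" := (\big[Rplus/IZR 0]_(m <= i < n | P%B) F) : R_scope.
Notation "\sum_ ( m <= i < n ) F" := (\big[Rplus/IZR 0]_(m <= i < n) F) : R_scope.
Notation "\sum_ ( i : t ) F" := (\big[Rplus/IZR 0]_(i : t) F) (only parsing) : R_scope.
Notation "\sum_ ( i 'in' A | P ) F" := (\big[Rplus/IZR 0]_(i in A | P%B) F) : R_scope.
Notation "\sum_ ( i 'in' A ) F" := (\big[Rplus/IZR 0]_(i in A) F) : R_scope.
Notation "\prod_ ( i <- r ) F" := (\big[Rmult/IZR 1]_(i <- r) F) : R_scope.
Notation "\csum_ ( i <- r | P ) F" := (\big[Cplus/RtoC 0]_(i <- r | P%B) F%C)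
  (at level 41, F at level 41, i, r at level 60, format "\csum_ ( i  <-  r  |  P )  F") : R_scope.
Notation "\csum_ ( i : t ) F" := (\big[Cplus/RtoC 0]_(i : t) F%C)
  (at level 41, F at level 41, i at level 60, only parsing) : R_scope.
Notation "\csum_ ( i 'in' A ) F" := (\big[Cplus/RtoC 0]_(i in A) F%C)
  (at level 41, F at level 41, i, A at level 60) : R_scope.

Section RealSums.
Variables (I : Type) (r : seq I).
Implicit Types (P : pred I) (F G : I -> R).

Lemma sum_le P F G : (forall i, P i -> F i <= G i) ->
  \sum_(i <- r | P i) F i <= \sum_(i <- r | P i) G i.
Proof.
by move=> H; elim/big_ind2: _ => // [|x1 x2 y1 y2 H1 H2]; [exact: Rle_refl|exact: Rplus_le_compat].
Qed.

Lemma sum_ge0 P F : (forall i, P i -> 0 <= F i) -> 0 <= \sum_(i <- r | P i) F i.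
Proof.
by move=> H; elim/big_ind: _ => // [|x y H1 H2]; [exact: Rle_refl|exact: Rplus_le_le_0_compat].
Qed.

Lemma sum_opp P F : \sum_(i <- r | P i) - F i = - \sum_(i <- r | P i) F i.
Proof. by elim/big_rec2: _ => [|i y1 y2 _ ->]; ring. Qed.

Lemma sum_const P c : \sum_(i <- r | P i) c = INR (count P r) * c.
Proof.
elim: r => [|x s IH]; first by rewrite big_nil /=; ring.
by rewrite big_cons /=; case: (P x); rewrite IH plus_INR /=; ring.
Qed.

Lemma sum_filter_le P (Q : pred I) F : (forall i, 0 <= F i) ->
  \sum_(i <- r | P i && Q i) F i <= \sum_(i <- r | P i) F i.
Proof.
move=> H; rewrite big_mkcondr; apply: sum_le => i _.
by case: (Q i); [exact: Rle_refl|].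
Qed.

Lemma sum_lincomb P F G c t u :
  \sum_(i <- r | P i) c * (t * F i + G i * u)
  = c * (t * (\sum_(i <- r | P i) F i) + (\sum_(i <- r | P i) G i) * u).
Proof. by elim/big_rec3: _ => [|i x y z _ ->]; ring. Qed.

Lemma Re_sum P (F : I -> C) :
  Re (\csum_(i <- r | P i) F i) = \sum_(i <- r | P i) Re (F i).
Proof. by elim/big_rec2: _ => // i y1 y2 _ <-. Qed.

Lemma RtoC_sum P F : RtoC (\sum_(i <- r | P i) F i) = \csum_(i <- r | P i) RtoC (F i).
Proof. by elim/big_rec2: _ => // i y1 y2 _ <-; rewrite RtoC_plus. Qed.

Lemma Cmod_sum P (F : I -> C) :
  Cmod (\csum_(i <- r | P i) F i) <= \sum_(i <- r | P i) Cmod (F i).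
Proof.
elim/big_rec2: _ => [|i y1 y2 _ H]; first by rewrite Cmod_0; exact: Rle_refl.
by apply: Rle_trans (Cmod_triangle _ _) _; apply: Rplus_le_compat_l.
Qed.

Lemma Cconj_sum P (F : I -> C) :
  Cconj (\csum_(i <- r | P i) F i) = \csum_(i <- r | P i) Cconj (F i).
Proof.
elim/big_rec2: _ => [|i y1 y2 _ <-]; first by rewrite /Cconj /= Ropp_0.
by rewrite /Cconj /Cplus /=; congr pair; ring.
Qed.

End RealSums.

Lemma sum_cons (I : Type) (i : I) (r : seq I) F :
  \sum_(j <- i :: r) F j = F i + \sum_(j <- r) F j.
Proof. exact: big_cons. Qed.

Lemma prod_cons (I : Type) (i : I) (r : seq I) F :
  \prod_(j <- i :: r) F j = F i * \prod_(j <- r) F j.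
Proof. exact: big_cons. Qed.

Lemma sum_constI (I : finType) (A : {pred I}) c : \sum_(i in A) c = INR #|A| * c.
Proof.
rewrite big_const; elim: #|A| => [|m IH] /=; first by ring.
by rewrite IH -/(INR m.+1) S_INR; ring.
Qed.

End Sums.

(** * Characters of a finite abelian group, Parseval's identity and a bilinear inequality *)

Module Characters.
Import all_boot all_algebra all_fingroup all_solvable all_field all_character Sums.
Set Implicit Arguments. Unset Strict Implicit. Unset Printing Implicit Defensive.
Open Scope R_scope.

(** The root of unity with angle [2 * PI * k / n]; a natural index lets residues in ['Z_n] serve as
    exponents. *)
Definition expC (n k : nat) : C := (cos (2 * PI * INR k / INR n), sin (2 * PI * INR k / INR n)).

Lemma expC0 n : expC n 0 = RtoC 1.
Proof. by rewrite /expC /= Rmult_0_r /Rdiv Rmult_0_l cos_0 sin_0. Qed.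

Lemma expCD n k l : expC n (k + l) = Cmult (expC n k) (expC n l).
Proof.
rewrite /expC /Cmult /= plus_INR.
rewrite (_ : 2 * PI * _ / _ = 2 * PI * INR k / INR n + 2 * PI * INR l / INR n); last first.
  by rewrite /Rdiv; ring.
by rewrite cos_plus sin_plus; congr pair; ring.
Qed.

Lemma expC_period n m : (0 < n)%N -> expC n (m * n) = RtoC 1.
Proof.
move=> n0; have n0R : INR n <> 0 by apply: not_0_INR => E; rewrite E in n0.
rewrite /expC mult_INR (_ : 2 * PI * (INR m * INR n) / INR n = 0 + 2 * INR m * PI).
  by rewrite cos_period sin_period cos_0 sin_0.
by field.
Qed.

Lemma expC_mod n k : (0 < n)%N -> expC n (k %% n) = expC n k.
Proof. by move=> n0; rewrite {2}(divn_eq k n) expCD expC_period // Cmult_1_l. Qed.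

Lemma Cmod_expC n k : Cmod (expC n k) = 1.
Proof.
rewrite /Cmod /expC /= !Rmult_1_r Rplus_comm -!/(Rsqr _) sin2_cos2; exact: sqrt_1.
Qed.

Lemma expC_neq0 n k : expC n k <> RtoC 0.
Proof. by move=> E; have := Cmod_expC n k; rewrite E Cmod_0 => /esym; exact: R1_neq_R0. Qed.

Lemma expC_conj n k : Cmult (expC n k) (Cconj (expC n k)) = RtoC 1.
Proof.
have := sin2_cos2 (2 * PI * INR k / INR n); rewrite /Rsqr.
by rewrite /expC /Cconj /Cmult /= => <-; congr pair; ring.
Qed.

Lemma expC_eq1 n k : (k < n)%N -> expC n k = RtoC 1 -> k = 0%N.
Proof.
move=> kn [H _]; case: k kn H => // k kn H; exfalso.
have nR : 0 < INR n by apply: lt_0_INR; apply/ltP; apply: leq_ltn_trans kn.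
have kR : 0 < INR k.+1 by apply: lt_0_INR; apply/ltP.
have knR : INR k.+1 < INR n by apply: lt_INR; apply/ltP.
have pi0 := PI_RGT_0.
set t := PI * INR k.+1 / INR n.
have t0 : 0 < t by rewrite /t /Rdiv; apply: Rmult_lt_0_compat; [nra|exact: Rinv_0_lt_compat].
have t1 : t < PI.
  by apply: (Rmult_lt_reg_r (INR n)) => //; rewrite /t /Rdiv Rmult_assoc Rinv_l; nra.
have := sin_gt_0 _ t0 t1.
move: H; rewrite (_ : 2 * PI * INR k.+1 / INR n = 2 * t) ?cos_2a_sin; last by rewrite /t; field; lra.
by nra.
Qed.

Section Dual.
Variable gT : finGroupType.
Hypothesis abG : abelian [set: gT].

(** A multiple of the exponent of the group; the factor 2 keeps it above 1 even for the trivial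
    group, so that ['Z_n] really has [n] elements. *)
Definition ordE := (2 * #|gT|)%N.
Notation n := ordE.

Lemma ordE_gt1 : (1 < n)%N.
Proof. by rewrite /n mul2n -addnn -addn1 leq_add // -cardsT cardG_gt0. Qed.
Lemma ordE_gt0 : (0 < n)%N. Proof. exact: ltnW ordE_gt1. Qed.

(** Characters are stored as their exponents: an additive [f] stands for [x |-> expC n (f x)]. This
    carries characters with algebraic values over to Coquelicot's [C] and makes the product of
    characters a pointwise sum. *)
Definition dual : {set {ffun gT -> 'Z_n}} :=
  [set f : {ffun gT -> 'Z_n} | [forall x, forall y, f (x * y)%g == (f x + f y)%R]].

Lemma dualP (f : {ffun gT -> 'Z_n}) : reflect (forall x y, f (x * y)%g = (f x + f y)%R) (f \in dual).
Proof.
rewrite inE; apply: (iffP forallP) => [H x y|H x]; first by move/forallP: (H x) => /(_ y)/eqP.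
by apply/forallP => y; rewrite H.
Qed.

(** The kernels of the irreducible characters intersect trivially, and in an abelian group these
    characters are linear. Their values are [n]-th roots of unity, so the exponent relative to a
    fixed primitive root is the required additive map. *)
Lemma dual_separates (x : gT) : x != 1%g -> exists2 f : {ffun gT -> 'Z_n}, f \in dual & f x != 0%R.
Proof.
move=> x1.
have [i Hi] : exists i, x \notin cfker ('chi[ [set: gT] ]_i)%R.
  apply/existsP; rewrite -negb_forall; apply: contra x1 => /forallP H.
  by rewrite -in_set1 -[[set 1%g]](TI_cfker_irr [set: gT]); apply/bigcapP => i _.
have lin : ('chi[ [set: gT] ]_i)%R \is a linear_char by apply/char_abelianP.
have [z zp] := C_prim_root_exists ordE_gt0.
have rt y : ('chi[ [set: gT] ]_i y ^+ n = 1)%R.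
  rewrite -lin_charX ?inE // (_ : (y ^+ n)%g = 1%g) ?lin_char1 //.
  by rewrite /n mulnC expgM -cardsT expg_cardG ?inE // expg1n.
have K y : {k : 'I_n | ('chi[ [set: gT] ]_i)%R y = (z ^+ k)%R} := prim_rootP zp (rt y).
exists [ffun y => (val (sval (K y)))%:R%R].
  apply/dualP => y w; rewrite !ffunE.
  case: (K (y * w)%g) => a Ha; case: (K y) => b Hb; case: (K w) => c Hc /=.
  rewrite -GRing.natrD; apply: ord_inj; rewrite !val_Zp_nat ?ordE_gt1 //; apply/eqP.
  by rewrite -(eq_prim_root_expr zp) GRing.exprD -Ha -Hb -Hc lin_charM ?inE.
rewrite ffunE; apply: contra Hi => /eqP H.
rewrite cfkerEchar ?irr_char // !inE lin_char1 //=.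
case: (K x) H => a Ha /= /(congr1 (@nat_of_ord _)); rewrite val_Zp_nat ?ordE_gt1 // modn_small // => a0.
by rewrite Ha a0.
Qed.

Definition ev (f : {ffun gT -> 'Z_n}) (x : gT) : C := expC n (f x).

Lemma val_ZD (a b : 'Z_n) : val (a + b)%R = ((val a + val b) %% n)%N.
Proof. by congr (_ %% _)%N; apply: Zp_cast; exact: ordE_gt1. Qed.

Lemma evM (f : {ffun gT -> 'Z_n}) x y : f \in dual -> ev f (x * y)%g = Cmult (ev f x) (ev f y).
Proof. by move=> /dualP H; rewrite /ev H val_ZD expC_mod ?ordE_gt0 // expCD. Qed.

Lemma evD (f g : {ffun gT -> 'Z_n}) x : ev (f + g)%R x = Cmult (ev f x) (ev g x).
Proof. by rewrite /ev ffunE val_ZD expC_mod ?ordE_gt0 // expCD. Qed.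

Lemma ev1 (f : {ffun gT -> 'Z_n}) : f \in dual -> ev f 1%g = RtoC 1.
Proof.
move=> /dualP H; have := H 1%g 1%g; rewrite mulg1 => E.
have {}E : f 1%g = 0%R by apply: (GRing.addrI (f 1%g)); rewrite GRing.addr0.
by rewrite /ev E expC0.
Qed.

Lemma ev_eq1 f x : ev f x = RtoC 1 -> f x = 0%R.
Proof. by move=> H; apply: ord_inj; apply: (expC_eq1 _ H); rewrite -[X in (_ < X)%N]Zp_cast ?ordE_gt1. Qed.

Lemma ev0 x : ev 0%R x = RtoC 1. Proof. by rewrite /ev ffunE expC0. Qed.

Lemma dual0 : 0%R \in dual.
Proof. by apply/dualP => x y; rewrite !ffunE GRing.addr0. Qed.

Lemma dualD (f g : {ffun gT -> 'Z_n}) : f \in dual -> g \in dual -> (f + g)%R \in dual.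
Proof.
move=> /dualP Hf /dualP Hg; apply/dualP => x y.
by rewrite !ffunE Hf Hg GRing.addrACA.
Qed.

Lemma dualDr (f g : {ffun gT -> 'Z_n}) : f \in dual -> ((g + f)%R \in dual) = (g \in dual).
Proof.
move=> Hf; apply/idP/idP => [|Hg]; last exact: dualD.
move: Hf => /dualP Hf /dualP Hg; apply/dualP => x y.
apply: (GRing.addIr (f (x * y)%g)); have := Hg x y; rewrite !ffunE => ->.
by rewrite Hf GRing.addrACA.
Qed.

(** The closing argument of every orthogonality relation: a translation multiplies the full sum by a
    value different from 1. *)
Lemma Cmult_fix (a s : C) : Cmult s a = s -> a <> RtoC 1 -> s = RtoC 0.
Proof.
move=> H a1.
have {}H : Cmult s (Cminus a (RtoC 1)) = RtoC 0.
  by rewrite /Cminus Cmult_plus_distr_l H; ring.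
have [//|s0] := Ceq_dec s (RtoC 0); case: (Cmult_neq_0 s (Cminus a (RtoC 1)) s0 _ H).
by move=> E; apply: a1; rewrite -(Cplus_0_l (RtoC 1)) -E /Cminus; ring.
Qed.

Lemma sum_dual x : \csum_(f in dual) ev f x = if x == 1%g then RtoC (INR #|dual|) else RtoC 0.
Proof.
case: eqP => [->|/eqP x1].
  rewrite (eq_bigr (fun=> RtoC 1)) => [|f]; last exact: ev1.
  by rewrite -RtoC_sum sum_constI Rmult_1_r.
have [f fd fx] := dual_separates x1.
apply: (@Cmult_fix (ev f x)); last by move=> /ev_eq1 E; rewrite E eqxx in fx.
rewrite big_distrl /= [RHS](reindex_inj (GRing.addIr f)) /=.
apply: eq_big => [g|g _]; by rewrite ?dualDr ?evD.
Qed.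

Lemma sum_group (f : {ffun gT -> 'Z_n}) : f \in dual ->
  \csum_(x : gT) ev f x = if f == 0%R then RtoC (INR #|gT|) else RtoC 0.
Proof.
move=> fd; case: eqP => [->|/eqP f0].
  rewrite (eq_bigr (fun=> RtoC 1)) => [|x _]; last exact: ev0.
  by rewrite -RtoC_sum (sum_constI predT) Rmult_1_r.
have [x fx] : exists x, f x != 0%R.
  apply/existsP; apply: contraR f0; rewrite negb_exists => /forallP H.
  by apply/eqP/ffunP => x; move: (H x); rewrite negbK ffunE => /eqP.
apply: (@Cmult_fix (ev f x)); last by move=> /ev_eq1 E; rewrite E eqxx in fx.
rewrite big_distrl /= [RHS](reindex_inj (mulIg x)) /=.
by apply: eq_bigr => y _; rewrite evM.
Qed.

(** Double counting: the sum of [ev f x] over all pairs is the order of the dual by one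
    orthogonality relation and the order of the group by the other. *)
Lemma card_dual : #|dual| = #|gT|.
Proof.
have E : \csum_(f in dual) (\big[Cplus/RtoC 0]_(x : gT) ev f x) = RtoC (INR #|dual|).
  rewrite exchange_big (bigD1 (1%g : gT)) //= sum_dual eqxx big1 ?Cplus_0_r // => x x1.
  by rewrite sum_dual (negbTE x1).
apply: INR_eq; apply: RtoC_inj; rewrite -E (bigD1 (0%R : {ffun gT -> 'Z_n})) ?dual0 //= sum_group ?dual0 // eqxx.
by rewrite big1 ?Cplus_0_r // => f /andP[fd f0]; rewrite sum_group // (negbTE f0).
Qed.

Definition hat (a : gT -> R) (f : {ffun gT -> 'Z_n}) : C := \csum_(x : gT) (RtoC (a x) * ev f x)%C.

Lemma ev_conj (f : {ffun gT -> 'Z_n}) k l : f \in dual ->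
  Cmult (ev f k) (Cconj (ev f l)) = ev f (k * l^-1)%g.
Proof.
move=> fd; rewrite -[in LHS](mulgKV l k) [in LHS]evM //.
by rewrite -Cmult_assoc expC_conj Cmult_1_r.
Qed.

Lemma parseval a b :
  \csum_(f in dual) (hat a f * Cconj (hat b f))%C = RtoC (INR #|gT| * \sum_(x : gT) a x * b x).
Proof.
transitivity (\csum_(f in dual) (\csum_(k : gT) (\csum_(l : gT)
    (RtoC (a k * b l) * ev f (k * l^-1)%g)%C))).
  apply: eq_bigr => f fd; rewrite /hat Cconj_sum big_distrl /=; apply: eq_bigr => k _.
  rewrite big_distrr /=; apply: eq_bigr => l _; rewrite -ev_conj // Cmult_conj RtoC_mult.
  by rewrite (_ : Cconj (RtoC (b l)) = RtoC (b l)) ?/Cconj /= ?Ropp_0 //; ring.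
rewrite exchange_big /= big_distrr /= RtoC_sum; apply: eq_bigr => k _.
rewrite exchange_big /= (bigD1 k) //= [X in Cplus _ X]big1 => [|l lk].
    rewrite Cplus_0_r -big_distrr /= mulgV sum_dual eqxx card_dual -RtoC_mult.
  by congr RtoC; exact: Rmult_comm.
rewrite -big_distrr /= sum_dual; case: eqP => [E|_]; last by rewrite Cmult_0_r.
by case/eqP: lk; rewrite -(mulgKV l k) E mul1g.
Qed.

Lemma sum_hat_sqr a :
  \sum_(f in dual) (Cmod (hat a f)) ^ 2 = INR #|gT| * \sum_(x : gT) (a x) ^ 2.
Proof.
have H := parseval a a.
rewrite (eq_bigr (fun f => RtoC (Cmod (hat a f) ^ 2))) -?RtoC_sum in H; last first.
  by move=> f _; rewrite Cmod2_conj.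
by rewrite (RtoC_inj _ _ H); congr (_ * _); apply: eq_bigr => x _; ring.
Qed.

(* By Parseval the left-hand sum is an average over the dual of the product of the three transforms;
   the trivial character gives the subtracted mean and every other one is at most [B] times an
   arithmetic-geometric mean. *)
Lemma bilinear_bound (I : Type) (r : seq I) (u : I -> gT) (a b : gT -> R) (B t : R) :
  0 <= B -> 0 < t ->
  (forall f : {ffun gT -> 'Z_n}, f \in dual -> f != 0%R ->
     Cmod (\big[Cplus/RtoC 0]_(i <- r) ev f (u i)) <= B) ->
  Rabs (\sum_(i <- r) (\sum_(h : gT) a h * b (u i * h)%g)
        - INR (size r) * (\sum_(h : gT) a h) * (\sum_(h : gT) b h) / INR #|gT|)
  <= B / 2 * (t * (\sum_(h : gT) a h ^ 2) + (\sum_(h : gT) b h ^ 2) / t).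
Proof.
move=> B0 t0 HB.
set T := \sum_(i <- r) _.
(* [c] is the convolution of [a] with the counting measure of the points [u i], so its transform is
   the product of the character sum with [hat a]. *)
pose c k := \sum_(i <- r) a ((u i)^-1 * k)%g.
have G0 : 0 < INR #|gT| by apply: lt_0_INR; apply/ltP; rewrite -cardsT cardG_gt0.
have hatc f : f \in dual -> hat c f = Cmult (\big[Cplus/RtoC 0]_(i <- r) ev f (u i)) (hat a f).
  move=> fd; rewrite /hat /c big_distrl /=.
  under eq_bigr do rewrite RtoC_sum big_distrl /=.
  rewrite exchange_big /=; apply: eq_bigr => i _.
  rewrite big_distrr /= (reindex_inj (mulgI (u i))) /=; apply: eq_bigr => k _.
  by rewrite mulKg evM //; ring.
have cb : \sum_(k : gT) c k * b k = T.
  rewrite /c /T /=; under eq_bigr do rewrite big_distrl /=.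
  rewrite exchange_big /=; apply: eq_bigr => i _.
  by rewrite (reindex_inj (mulgI (u i))) /=; apply: eq_bigr => k _; rewrite mulKg.
have hat0 x : hat x 0%R = RtoC (\sum_(h : gT) x h).
  by rewrite RtoC_sum; apply: eq_bigr => h _; rewrite ev0 Cmult_1_r.
have P := parseval c b; rewrite cb (bigD1 (0%R : {ffun gT -> 'Z_n})) ?dual0 //= in P.
rewrite hatc ?dual0 // !hat0 in P.
rewrite (_ : \big[Cplus/RtoC 0]_(i <- r) ev 0%R (u i) = RtoC (INR (size r))) in P; last first.
  under eq_bigr do rewrite ev0.
  by rewrite -RtoC_sum sum_const count_predT Rmult_1_r.
rewrite (_ : Cconj (RtoC (\sum_(h : gT) b h)) = RtoC (\sum_(h : gT) b h)) in P; last first.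
  by rewrite /Cconj /= Ropp_0.
rewrite -!RtoC_mult in P.
set A := \sum_(h : gT) a h in P *; set D := \sum_(h : gT) b h in P *.
set E := \big[_/_]_(_ | _) _ in P.
have HE : Cmod E <= B / 2 * (INR #|gT| * (t * (\sum_(h : gT) a h ^ 2) + (\sum_(h : gT) b h ^ 2) / t)).
  apply: Rle_trans (Cmod_sum _ _ _) _.
  apply: (Rle_trans _ (\sum_(f in dual) B / 2 * (t * Cmod (hat a f) ^ 2 + Cmod (hat b f) ^ 2 / t))).
    apply: (Rle_trans _ (\sum_(f in dual | f != 0%R)
        B / 2 * (t * Cmod (hat a f) ^ 2 + Cmod (hat b f) ^ 2 / t))).
      apply: sum_le => f /andP[fd f0]; rewrite hatc // !Cmod_mult Cmod_conj.
      have := HB f fd f0; have ha := Cmod_ge_0 (hat a f); have hb := Cmod_ge_0 (hat b f).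
      move=> H; apply: (Rle_trans _ (B * (Cmod (hat a f) * Cmod (hat b f)))).
        by rewrite Rmult_assoc; apply: Rmult_le_compat_r => //; nra.
      (* The weight [t] stays free, so that two weights of very different norms can be balanced
         later. *)
      have AG : Cmod (hat a f) * Cmod (hat b f) <= (t * Cmod (hat a f) ^ 2 + Cmod (hat b f) ^ 2 / t) / 2.
        have -> : (t * Cmod (hat a f) ^ 2 + Cmod (hat b f) ^ 2 / t) / 2 =
           Cmod (hat a f) * Cmod (hat b f) + (t * Cmod (hat a f) - Cmod (hat b f)) ^ 2 / t / 2.
          by field; lra.
        have : 0 <= (t * Cmod (hat a f) - Cmod (hat b f)) ^ 2 / t.
          by apply: Rdiv_le_0_compat => //; exact: pow2_ge_0.
        lra.
      nra.
    apply: sum_filter_le => f; apply: Rmult_le_pos; first lra.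
    apply: Rplus_le_le_0_compat; first by apply: Rmult_le_pos; [lra|exact: pow2_ge_0].
    by apply: Rdiv_le_0_compat => //; exact: pow2_ge_0.
  rewrite /Rdiv sum_lincomb !sum_hat_sqr; apply: Req_le; ring.
have H : Rabs (INR #|gT| * T - INR (size r) * A * D) <= Cmod E.
  rewrite -Cmod_R; apply: Req_le; congr Cmod.
  by rewrite RtoC_minus -P /Cminus; ring.
rewrite (_ : T - _ = (INR #|gT| * T - INR (size r) * A * D) / INR #|gT|); last by field; lra.
rewrite /Rdiv Rabs_mult (Rabs_right (/ _)); last by apply: Rle_ge; apply: Rlt_le; exact: Rinv_0_lt_compat.
apply: (Rmult_le_reg_r (INR #|gT|)) => //; rewrite Rmult_assoc Rinv_l; last lra.
by rewrite Rmult_1_r; move: H HE; rewrite /Rdiv; lra.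
Qed.

End Dual.
End Characters.

(** * Dirichlet characters from the dual of the unit group, and bilinear inequalities over
    residues *)

Module Dirichlet.
Import all_boot all_algebra all_fingroup Sums Characters.
Set Implicit Arguments. Unset Strict Implicit. Unset Printing Implicit Defensive.
Open Scope R_scope.

Lemma Nat_gcdE m n : Nat.gcd m n = gcdn m n.
Proof.
have dvdE d k : Nat.divide d k <-> (d %| k)%N.
  by split=> [[c ->]|/dvdnP[c ->]]; [exact: dvdn_mull|exists c].
apply: Nat.gcd_unique.
- by apply/dvdE; exact: dvdn_gcdl.
- by apply/dvdE; exact: dvdn_gcdr.
by move=> d /dvdE dm /dvdE dn; apply/dvdE; rewrite dvdn_gcd dm.
Qed.

Lemma Nat_coprimeE m n : Nat.gcd m n = 1%N <-> coprime m n.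
Proof. by rewrite Nat_gcdE; split=> [E|/eqP //]; apply/eqP. Qed.

Lemma sum_n_m_big (chi : nat -> C) x :
  sum_n_m chi 1 x = \big[Cplus/RtoC 0]_(1 <= n < x.+1) chi n.
Proof.
elim: x => [|x IH]; first by rewrite big_geq // sum_n_m_zero //; lia.
by rewrite big_nat_recr //= -IH sum_n_Sm //; lia.
Qed.

Section Modulus.
Variable q : nat.
Hypothesis q1 : (1 < q)%N.
Notation G := {unit 'Z_q}.

Lemma units_abelian : abelian [set: G].
Proof. by apply/centsP => x _ y _; apply: val_inj; rewrite /= GRing.mulrC. Qed.

(** Non-units get the default value 1, hence the coprimality hypotheses below and the separate value
    0 in [dchar]. *)
Definition residue (n : nat) : G := insubd (1%g : G) (n%:R : 'Z_q)%R.

Lemma val_residue n : coprime n q -> val (residue n) = (n%:R : 'Z_q)%R.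
Proof. by move=> cn; rewrite /residue insubdK // -topredE /= unitZpE // coprime_sym. Qed.

Definition rep (g : G) : nat := nat_of_ord (val g).

Lemma rep_residue n : coprime n q -> rep (residue n) = (n %% q)%N.
Proof. by move=> cn; rewrite /rep val_residue // val_Zp_nat. Qed.

Lemma rep_coprime g : coprime (rep g) q.
Proof.
have E : (rep g)%:R%R = val g := natr_Zp (val g).
by have := valP g; rewrite /= -[X in X \in _]E unitZpE // coprime_sym.
Qed.

Lemma repK g : residue (rep g) = g.
Proof. by apply: val_inj; rewrite val_residue ?rep_coprime // /rep natr_Zp. Qed.

Lemma repM g h : rep (g * h)%g = (rep g * rep h %% q)%N.
Proof. by rewrite /rep /=; congr (_ %% _)%N; exact: Zp_cast. Qed.

Lemma rep1 : rep 1%g = 1%N.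
Proof. by rewrite /rep /= modn_small // Zp_cast. Qed.

Lemma residueM m n : coprime m q -> coprime n q -> residue (m * n) = (residue m * residue n)%g.
Proof.
move=> cm cn; apply: val_inj; rewrite val_residue ?coprimeMl ?cm //.
by rewrite GRing.natrM /= !val_residue.
Qed.

Lemma sum_units (F : nat -> R) :
  \sum_(g : G) F (rep g) = \sum_(0 <= m < q | coprime m q) F m.
Proof.
rewrite -[X in index_iota 0 X](Zp_cast q1) big_mkord.
rewrite (reindex (val : G -> 'Z_q)).
  by apply: eq_big => // g; rewrite -/(rep g) rep_coprime.
exists (fun z : 'Z_q => insubd (1%g : G) z) => [g _|z]; first exact: valKd.
by rewrite -topredE /= => cz; rewrite insubdK // -topredE /= -[z]natr_Zp unitZpE // coprime_sym.
Qed.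

Lemma card_units : #|{: G}| = totient q.
Proof. by rewrite -card_units_Zp ?(ltnW q1) // -cardsT; apply: eq_card => x; rewrite !inE. Qed.

Notation dual := (@dual G).

Definition dchar (f : {ffun G -> 'Z_(ordE G)}) (n : nat) : C :=
  if coprime n q then ev f (residue n) else RtoC 0.

Lemma dchar_character f : f \in dual -> dirichlet_character q (dchar f).
Proof.
move=> fd; split; [|split; [|split]] => [|m n|n|n].
- rewrite /dchar coprime1n (_ : residue 1 = 1%g) ?ev1 //.
  by apply: val_inj; rewrite val_residue ?coprime1n.
- rewrite /dchar -[(m * n)%coq_nat]/(m * n)%N coprimeMl.
  case cm: (coprime m q); last by rewrite Cmult_0_l.
  by case cn: (coprime n q); rewrite /= ?Cmult_0_r // residueM // evM.
- rewrite /dchar -[(n + q)%coq_nat]/(n + q)%N -coprime_modl modnDr coprime_modl.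
  case cn: (coprime n q) => //; congr ev; apply: val_inj; rewrite !val_residue //.
    by rewrite GRing.natrD char_Zp // GRing.addr0.
  by rewrite -coprime_modl modnDr coprime_modl.
rewrite Nat_coprimeE /dchar; case: coprime; split=> // _; exact: expC_neq0.
Qed.

Lemma dchar_nonprincipal f : f \in dual -> f != 0%R -> nonprincipal q (dchar f).
Proof.
move=> fd f0.
have [g fg] : exists g, f g != 0%R.
  apply/existsP; apply: contraR f0; rewrite negb_exists => /forallP H.
  by apply/eqP/ffunP => g; move: (H g); rewrite negbK ffunE => /eqP.
exists (rep g); rewrite /dchar /principal_character rep_coprime repK => E.
have/Nat_coprimeE/Nat.eqb_eq cg := rep_coprime g; rewrite cg in E.
by move/ev_eq1: E => E; rewrite E eqxx in fg.
Qed.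

Definition zinv (m : nat) : nat := rep (residue m)^-1%g.

Lemma mul_zinv m : coprime m q -> (m * zinv m %% q = 1)%N.
Proof.
move=> cm; rewrite -modnMml -(rep_residue cm) /zinv -repM mulgV; exact: rep1.
Qed.

(** An upper bound for the supremum, without naming it. The lower bound for [Delta_chi] is proved by
    showing that every such [B] is large, so no extremal character has to be selected. *)
Definition charsum_bounded (x : nat) (B : R) := forall chi : nat -> C,
  dirichlet_character q chi -> nonprincipal q chi -> Cmod (sum_n_m chi 1 x) <= B.

Lemma group_bilinear (x : nat) (a b : G -> R) (B t : R) :
  0 <= B -> 0 < t -> charsum_bounded x B ->
  Rabs (\sum_(1 <= n < x.+1 | coprime n q) (\sum_(h : G) a h * b (residue n * h)%g)
        - INR (count (fun n => coprime n q) (index_iota 1 x.+1))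
          * (\sum_(h : G) a h) * (\sum_(h : G) b h) / INR (totient q))
  <= B / 2 * (t * (\sum_(h : G) a h ^ 2) + (\sum_(h : G) b h ^ 2) / t).
Proof.
move=> B0 t0 HB; rewrite -big_filter -size_filter -card_units.
apply: bilinear_bound => //; first exact: units_abelian.
move=> f fd f0; have := HB _ (dchar_character fd) (dchar_nonprincipal fd f0).
rewrite sum_n_m_big /dchar (eq_bigr (fun n => if coprime n q then ev f (residue n) else RtoC 0)) //.
by rewrite -big_mkcond -big_filter.
Qed.

Lemma direct_bilinear (x : nat) (a b : nat -> R) (B t : R) :
  0 <= B -> 0 < t -> charsum_bounded x B ->
  Rabs (\sum_(1 <= n < x.+1 | coprime n q) (\sum_(0 <= m < q | coprime m q) a m * b (n * m %% q)%N)
        - INR (count (fun n => coprime n q) (index_iota 1 x.+1))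
          * (\sum_(0 <= m < q | coprime m q) a m) * (\sum_(0 <= m < q | coprime m q) b m) / INR (totient q))
  <= B / 2 * (t * (\sum_(0 <= m < q | coprime m q) a m ^ 2) + (\sum_(0 <= m < q | coprime m q) b m ^ 2) / t).
Proof.
move=> B0 t0 HB; have := group_bilinear (a \o rep) (b \o rep) B0 t0 HB.
rewrite /= (sum_units a) (sum_units b) (sum_units (fun m => a m ^ 2)) (sum_units (fun m => b m ^ 2)).
rewrite (eq_bigr (fun n => \sum_(0 <= m < q | coprime m q) a m * b (n * m %% q)%N)) // => n cn.
rewrite -(sum_units (fun m => a m * b (n * m %% q)%N)).
by apply: eq_bigr => h _; rewrite repM rep_residue // modnMml.
Qed.

(** Composing [a] with inversion replaces the product [n * m] by the quotient [n / m], a residue at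
    which a cosine transform [b] can be evaluated. *)
Lemma inverse_bilinear (x : nat) (a b : nat -> R) (B t : R) :
  0 <= B -> 0 < t -> charsum_bounded x B ->
  Rabs (\sum_(1 <= n < x.+1 | coprime n q) (\sum_(0 <= m < q | coprime m q) a m * b (n * zinv m %% q)%N)
        - INR (count (fun n => coprime n q) (index_iota 1 x.+1))
          * (\sum_(0 <= m < q | coprime m q) a m) * (\sum_(0 <= m < q | coprime m q) b m) / INR (totient q))
  <= B / 2 * (t * (\sum_(0 <= m < q | coprime m q) a m ^ 2) + (\sum_(0 <= m < q | coprime m q) b m ^ 2) / t).
Proof.
move=> B0 t0 HB; have := group_bilinear (fun h => a (rep h^-1%g)) (b \o rep) B0 t0 HB.
have inv F : \sum_(h : G) F (rep h^-1%g) = \sum_(0 <= m < q | coprime m q) F m :> R.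
  by rewrite (reindex_inj invg_inj) /= -sum_units; apply: eq_bigr => h _; rewrite invgK.
rewrite /= (inv a) (sum_units b) (inv (fun m => a m ^ 2)) (sum_units (fun m => b m ^ 2)).
rewrite (eq_bigr (fun n => \sum_(0 <= m < q | coprime m q) a m * b (n * zinv m %% q)%N)) // => n cn.
rewrite -(inv (fun m => a m * b (n * zinv m %% q)%N)).
by apply: eq_bigr => h _; rewrite repM rep_residue // modnMml /zinv repK invgK.
Qed.

End Modulus.
End Dirichlet.

(** * Elementary prime number theory: Chebyshev's bound, Mertens' theorem, the totient *)

Module PrimeSums.
Import all_boot Sums.
Set Implicit Arguments. Unset Strict Implicit. Unset Printing Implicit Defensive.
Open Scope R_scope.

Lemma INR_gt0 n : (0 < n)%N -> 0 < INR n.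
Proof. by move=> n0; apply: lt_0_INR; apply/ltP. Qed.

Lemma INR_leq m n : (m <= n)%N -> INR m <= INR n.
Proof. by move=> H; apply: le_INR; apply/leP. Qed.

Lemma INR_expn m k : INR (m ^ k)%N = INR m ^ k.
Proof. by elim: k => [|k IH] //; rewrite expnS mult_INR IH. Qed.

Lemma ln_INR_ge0 n : 0 <= ln (INR n).
Proof.
case: n => [|n]; first by rewrite /ln; case: Rlt_dec => [H|_]; [case: (Rlt_irrefl 0)|lra].
rewrite -ln_1; apply: ln_le; first lra.
by rewrite S_INR; have := pos_INR n; lra.
Qed.

Lemma ln_mono x y : 0 < x -> x <= y -> ln x <= ln y.
Proof. exact: ln_le. Qed.

Lemma exp_mono x y : x <= y -> exp x <= exp y.
Proof.
by case/Rle_lt_or_eq_dec => [H|->]; [exact: Rlt_le (exp_increasing _ _ H)|exact: Rle_refl].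
Qed.

Lemma ln_le_sub1 x : 0 < x -> ln x <= x - 1.
Proof. by move=> x0; have := exp_ineq1_le (ln x); rewrite exp_ln //; lra. Qed.

Lemma INR_sum (I : Type) (r : seq I) (P : pred I) (F : I -> nat) :
  INR (\big[addn/0%N]_(i <- r | P i) F i) = \sum_(i <- r | P i) INR (F i).
Proof. by elim/big_rec2: _ => // i y1 y2 _ <-; rewrite plus_INR. Qed.

Lemma ln_prod (I : Type) (r : seq I) (P : pred I) (F : I -> nat) : (forall i, P i -> (0 < F i)%N) ->
  ln (INR (\big[muln/1%N]_(i <- r | P i) F i)) = \sum_(i <- r | P i) ln (INR (F i)).
Proof.
move=> F0; elim: r => [|i r IH]; first by rewrite !big_nil ln_1.
rewrite !big_cons; case Pi: (P i) => //; rewrite mult_INR ln_mult ?IH //; apply: INR_gt0; first exact: F0.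
by rewrite prodn_cond_gt0.
Qed.

Lemma ln_expn m k : (0 < m)%N -> ln (INR (m ^ k)%N) = INR k * ln (INR m).
Proof.
move=> m0; elim: k => [|k IH]; first by rewrite expn0 ln_1 /=; ring.
rewrite expnS mult_INR ln_mult ?IH ?S_INR; [ring|exact: INR_gt0|apply: INR_gt0].
by rewrite expn_gt0 m0.
Qed.

Lemma ln_logn k B : (0 < k <= B)%N ->
  ln (INR k) = \sum_(0 <= p < B.+1 | prime p) INR (logn p k) * ln (INR p).
Proof.
move=> /andP[k0 kB]; rewrite -{1}(partnT k0) (widen_partn _ kB) ln_prod => [|p _]; last first.
  by case: p => [|p]; rewrite ?logn0 // ?expn_gt0 // lognE.
rewrite [RHS]big_mkcond; apply: eq_bigr => p _ /=; case: ifP => [pp|np].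
  by rewrite ln_expn ?prime_gt0.
by rewrite lognE np /= ln_1.
Qed.

Lemma logn_fact_small p m : (m < p)%N -> logn p m`! = 0%N.
Proof.
move=> mp; case pp: (prime p); last by rewrite lognE pp.
rewrite logn_fact // big_nat big1 // => k /andP[k1 _]; apply: divn_small.
by apply: leq_trans mp _; rewrite -[X in (X <= _)%N](expn1 p); apply: leq_pexp2l => //; exact: prime_gt0.
Qed.

Definition theta n := \sum_(0 <= p < n.+1 | prime p) ln (INR p).

Lemma central_binomial_le m : ('C(m.*2, m) <= 2 ^ m.*2)%N.
Proof.
rewrite -[2%N]/(1 + 1)%N expnDn -leq_double (bigD1 (inord m)) //= inordK ?ltnS -?addnn ?leq_addr //.
by rewrite !exp1n !muln1; lia.
Qed.

(** Every prime between [m] and [2 * m] divides the central binomial coefficient, which is at most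
    [4 ^ m]; the constant 2 uses [ln 2 <= 1]. *)
Lemma theta_double m : theta m.*2 <= theta m + 2 * INR m.
Proof.
case: (posnP m) => [->|m0]; first by rewrite double0 Rmult_0_r; lra.
have C0 : (0 < 'C(m.*2, m))%N by rewrite bin_gt0 -addnn leq_addr.
have ln2 : ln 2 <= 1 by have := @ln_le_sub1 2; lra.
rewrite /theta (big_cat_nat _ (n := m.+1)) //=; last by rewrite -addnn; lia.
apply: Rplus_le_compat_l.
apply: (Rle_trans _ (ln (INR 'C(m.*2, m)))); last first.
  apply: Rle_trans (ln_mono (INR_gt0 C0) (INR_leq (central_binomial_le m))) _.
  by rewrite ln_expn // -addnn plus_INR (_ : INR 2 = 2) //; have := pos_INR m; nra.
(* [B] must reach the binomial coefficient for [ln_logn] and [2 * m] for the range of primes to be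
   kept. *)
pose B := maxn 'C(m.*2, m) m.*2.
rewrite (ln_logn (B := B)) ?C0 ?leq_maxl //.
have h1 : (m.+1 <= m.*2.+1)%N by rewrite ltnS -addnn leq_addr.
have h2 : (m.*2.+1 <= B.+1)%N by rewrite ltnS leq_maxr.
rewrite [X in _ <= X](big_cat_nat _ (n := m.+1)) //=; last exact: leq_trans h1 h2.
rewrite [X in _ <= _ + X](big_cat_nat _ (n := m.*2.+1)) //=.
have pos a b : 0 <= \sum_(a <= p < b | prime p) INR (logn p 'C(m.*2, m)) * ln (INR p).
  by apply: sum_ge0 => p _; apply: Rmult_le_pos; [exact: pos_INR|exact: ln_INR_ge0].
suff : \sum_(m.+1 <= p < m.*2.+1 | prime p) ln (INR p) <=
       \sum_(m.+1 <= p < m.*2.+1 | prime p) INR (logn p 'C(m.*2, m)) * ln (INR p).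
  have := pos 0%N m.+1; have := pos m.*2.+1 B.+1; lra.
rewrite big_nat_cond [X in _ <= X]big_nat_cond; apply: sum_le => p /andP[/andP[mp pm] pp].
have : (1 <= logn p 'C(m.*2, m))%N.
  have E : logn p m.*2`! = logn p 'C(m.*2, m).
    rewrite -(bin_fact (m := m)) -?addnn ?leq_addr // addnK.
    by rewrite !lognM ?muln_gt0 ?fact_gt0 ?addnn // logn_fact_small // addn0.
  by rewrite -E -pfactor_dvdn ?fact_gt0 // expn1 dvdn_fact // prime_gt0.
move/INR_leq; have := ln_INR_ge0 p; rewrite -[INR 1]/1; nra.
Qed.

(** Strong induction through [n / 2] with [theta_double]; an odd [n] adds one term, at most
    [n / 2 + 1], for which the constant 3 leaves room. *)
Lemma theta_le n : theta n <= 3 * INR n.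
Proof.
elim/ltn_ind: n => n IH.
case: (posnP n) => [->|n0].
  by rewrite /theta big_mkcond big_nat1 /=; lra.
pose m := n./2; have mn : (m < n)%N by rewrite /m; lia.
have H := theta_double m; have {}IH := IH _ mn.
have F0 : INR m.*2 = 2 * INR m by rewrite -addnn plus_INR; ring.
have := odd_double_half n; rewrite -/m; case: (odd n) => /= E; last first.
  by rewrite -E add0n F0; have := pos_INR m; lra.
rewrite -E add1n /theta big_mkcond big_nat_recr // -big_mkcond -/(theta m.*2).
have F : INR (m.*2.+1) = 2 * INR m + 1 by rewrite S_INR F0.
have : (if prime m.*2.+1 then ln (INR m.*2.+1) else 0) <= INR m + 1.
  have m0 := pos_INR m; case: prime; last lra.
  rewrite F (_ : 2 * INR m + 1 = 2 * (INR m + 1/2)); last field.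
  rewrite ln_mult; [|lra|lra].
  by have := @ln_le_sub1 2; have := @ln_le_sub1 (INR m + 1/2); lra.
by rewrite F /=; lra.
Qed.

Lemma ln_fact_bounds n : (0 < n)%N ->
  INR n * ln (INR n) - INR n <= ln (INR n`!) <= INR n * ln (INR n).
Proof.
elim: n => // n IH _; case: (posnP n) => [->|n0].
  by rewrite factS fact0 muln1 /= ln_1; lra.
have {}IH := IH n0; have n0R := INR_gt0 n0.
rewrite factS mult_INR ln_mult; [|exact: INR_gt0|exact/INR_gt0/fact_gt0].
have H : ln (INR n.+1) <= ln (INR n) + 1 / INR n.
  rewrite (_ : INR n.+1 = INR n * (1 + 1 / INR n)); last by rewrite S_INR; field; lra.
  have i0 : 0 < 1 / INR n by apply: Rdiv_lt_0_compat; lra.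
  by rewrite ln_mult; [|lra|lra]; have := @ln_le_sub1 (1 + 1 / INR n); lra.
have H2 : ln (INR n) <= ln (INR n.+1) by apply: ln_mono => //; rewrite S_INR; lra.
have H3 : INR n * (ln (INR n) + 1 / INR n) = INR n * ln (INR n) + 1 by field; lra.
by rewrite S_INR in H H2 *; split; nra.
Qed.

Lemma geometric_le (x : R) m : 0 <= x < 1 -> \sum_(1 <= k < m.+1) x ^ k <= x / (1 - x).
Proof.
move=> [x0 x1].
have E : \sum_(1 <= k < m.+1) x ^ k = x / (1 - x) - x ^ m.+1 / (1 - x).
  elim: m => [|m IH]; first by rewrite big_geq //=; field; lra.
  by rewrite big_nat_recr //= -/(pow x m.+1) IH /=; field; lra.
rewrite E; have : 0 <= x ^ m.+1 / (1 - x) by apply: Rdiv_le_0_compat; [exact: pow_le|lra].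
lra.
Qed.

Lemma INR_divn n d : (0 < d)%N -> INR (n %/ d) <= INR n / INR d < INR (n %/ d) + 1.
Proof.
move=> d0; have dR := INR_gt0 d0.
have E : INR n = INR (n %/ d) * INR d + INR (n %% d) by rewrite -mult_INR -plus_INR {1}(divn_eq n d).
have L : INR (n %% d) < INR d by apply: lt_INR; apply/ltP; rewrite ltn_mod.
have P := pos_INR (n %% d).
have F : INR n / INR d * INR d = INR n by field; lra.
split; nra.
Qed.

(** Legendre's formula: the first term alone gives the lower bound, the full geometric series the
    upper one. *)
Lemma logn_fact_bounds p n : prime p -> (0 < n)%N ->
  INR n / INR p - 1 <= INR (logn p n`!) <= INR n / (INR p - 1).
Proof.
move=> pp n0; have p1 := prime_gt1 pp; have p1R : 1 < INR p by apply: (lt_INR 1); apply/ltP.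
rewrite logn_fact //; split.
  rewrite big_ltn // expn1 plus_INR.
  have := INR_divn n (prime_gt0 pp); have := pos_INR (\big[addn/0%N]_(2 <= k < n.+1) (n %/ p ^ k)).
  by move=> ? ?; lra.
rewrite INR_sum.
apply: (Rle_trans _ (\sum_(1 <= k < n.+1) INR n * (/ INR p) ^ k)).
  apply: sum_le => k _; have [|+ _] := @INR_divn n (p ^ k)%N; first by rewrite expn_gt0 prime_gt0.
  by rewrite INR_expn pow_inv.
rewrite -big_distrr /=.
have i0 : 0 < / INR p by apply: Rinv_0_lt_compat; lra.
have i1 : / INR p < 1 by rewrite -Rinv_1; apply: Rinv_lt_contravar; lra.
have := @geometric_le (/ INR p) n; have := pos_INR n => nR.
rewrite (_ : / INR p / (1 - / INR p) = / (INR p - 1)); last by field; lra.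
by move=> H; rewrite /Rdiv; apply: Rmult_le_compat_l => //; apply: H; lra.
Qed.

(** The subtracted term makes the induction close. It imitates the primitive [- (ln x + 1) / x] of
    [ln x / x ^ 2], with some room for the denominator [k * (k - 1)]. *)
Lemma sum_ln_over_square n : (0 < n)%N ->
  \sum_(2 <= k < n.+1) ln (INR k) / (INR k * (INR k - 1)) <= 2 - (ln (INR n) + 2) / INR n.
Proof.
elim: n => // n IH _; case: (posnP n) => [->|n0].
  by rewrite big_geq //= ln_1; lra.
rewrite big_nat_recr //=; have {}IH := IH n0; have nR := INR_gt0 n0.
rewrite -/(INR n.+1) S_INR.
have H : ln (INR n + 1) <= ln (INR n) + 1 / INR n.
  rewrite (_ : INR n + 1 = INR n * (1 + 1 / INR n)); last by field; lra.
  have i0 : 0 < 1 / INR n by apply: Rdiv_lt_0_compat; lra.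
  by rewrite ln_mult; [|lra|lra]; have := @ln_le_sub1 (1 + 1 / INR n); lra.
have H1 : INR n * ln (INR n + 1) <= INR n * ln (INR n) + 1.
  have : INR n * (1 / INR n) = 1 by field; lra.
  nra.
have n1 : 1 <= INR n by apply: (INR_leq (m := 1)).
have H2 : 1 / INR n <= 1 by rewrite -[X in _ <= X](Rinv_1) /Rdiv Rmult_1_l; apply: Rinv_le_contravar; lra.
suff : ln (INR n + 1) / ((INR n + 1) * (INR n + 1 - 1)) <=
   (ln (INR n) + 2) / INR n - (ln (INR n + 1) + 2) / (INR n + 1) by lra.
rewrite (_ : (ln (INR n) + 2) / INR n - _ =
  ((INR n + 1) * (ln (INR n) + 2) - INR n * (ln (INR n + 1) + 2)) / ((INR n + 1) * (INR n + 1 - 1))).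
  apply: Rmult_le_compat_r; last lra.
  by apply: Rlt_le; apply: Rinv_0_lt_compat; nra.
by field; lra.
Qed.

(** [ln n!] is computed twice, by Stirling and by Legendre. With [S] the prime sum, it lies between
    [n * S - theta n] and [n * (S + 2)]; Chebyshev's [3 * n] and Stirling's error [n] both lead to
    the constant 3. *)
Lemma mertens n : (0 < n)%N ->
  Rabs (\sum_(0 <= p < n.+1 | prime p) ln (INR p) / INR p - ln (INR n)) <= 3.
Proof.
move=> n0; have nR := INR_gt0 n0.
have E : ln (INR n`!) = \sum_(0 <= p < n.+1 | prime p) INR (logn p n`!) * ln (INR p).
  rewrite (ln_logn (B := n`!)) ?fact_gt0 ?leqnn //.
  rewrite [LHS](big_cat_nat _ (n := n.+1)) //=; last by rewrite ltnS fact_geq.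
  rewrite [X in _ + X]big_nat_cond [X in _ + X]big1 ?Rplus_0_r // => p /andP[/andP[np _] _].
  by rewrite logn_fact_small // Rmult_0_l.
have [lo hi] := ln_fact_bounds n0.
set S := \sum_(0 <= p < n.+1 | prime p) ln (INR p) / INR p.
have p1 p : prime p -> 1 < INR p by move=> /prime_gt1 H; apply: (lt_INR 1); apply/ltP.
have up : INR n * S - theta n <= ln (INR n`!).
  have -> : INR n * S - theta n
      = \sum_(0 <= p < n.+1 | prime p) (INR n * (ln (INR p) / INR p) + - ln (INR p)).
    by rewrite big_split sum_opp -big_distrr.
  rewrite E; apply: sum_le => p pp; have [H _] := logn_fact_bounds pp n0.
  have := ln_INR_ge0 p; have := p1 p pp => ? ?.
  have -> : INR n * (ln (INR p) / INR p) + - ln (INR p) = (INR n / INR p - 1) * ln (INR p).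
    by field; lra.
  exact: Rmult_le_compat_r.
have low : ln (INR n`!) <= INR n * (S + 2).
  apply: (Rle_trans _ (INR n * (S + \sum_(2 <= k < n.+1) ln (INR k) / (INR k * (INR k - 1))))); last first.
    apply: Rmult_le_compat_l; first lra.
    have := sum_ln_over_square n0; have : 0 <= (ln (INR n) + 2) / INR n.
      by apply: Rdiv_le_0_compat => //; have := ln_INR_ge0 n; lra.
    lra.
  apply: (Rle_trans _ (INR n * (S + \sum_(0 <= p < n.+1 | prime p) ln (INR p) / (INR p * (INR p - 1))))).
    have -> : INR n * (S + \sum_(0 <= p < n.+1 | prime p) ln (INR p) / (INR p * (INR p - 1)))
        = \sum_(0 <= p < n.+1 | prime p) INR n * (ln (INR p) / INR p + ln (INR p) / (INR p * (INR p - 1))).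
      by rewrite -big_distrr big_split.
    rewrite E; apply: sum_le => p pp; have [_ H] := logn_fact_bounds pp n0.
    have := ln_INR_ge0 p; have := p1 p pp => ? ?.
    have -> : INR n * (ln (INR p) / INR p + ln (INR p) / (INR p * (INR p - 1)))
        = (INR n / (INR p - 1)) * ln (INR p) by field; lra.
    exact: Rmult_le_compat_r.
  apply: Rmult_le_compat_l; first lra.
  apply: Rplus_le_compat_l.
  rewrite (big_cat_nat _ (n := 2)) //= [X in X + _]big_mkcond big_nat_recr //= big_nat1 /= !Rplus_0_l.
  rewrite big_mkcond; rewrite big_nat_cond [X in _ <= X]big_nat_cond; apply: sum_le => k /andP[/andP[k2 _] _].
  have kR : 2 <= INR k by apply: (INR_leq (m := 2)).
  have H : 0 <= ln (INR k) / (INR k * (INR k - 1)).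
    by apply: Rdiv_le_0_compat; [exact: ln_INR_ge0|nra].
  by case: prime => //; exact: Rle_refl.
have th := theta_le n.
have {}up : INR n * S <= INR n * (ln (INR n) + 3) by lra.
have {}low : INR n * (ln (INR n) - 1) <= INR n * (S + 2) by lra.
apply: Rabs_le; split; first by have := Rmult_le_reg_l _ _ _ nR low; lra.
by have := Rmult_le_reg_l _ _ _ nR up; lra.
Qed.

(* The [i]-th smallest prime factor is at least [i + 1], so the product telescopes. *)
Lemma prod_pred_sorted k (s : seq nat) : path ltn k.+1 s ->
  (k.+1 * (\big[muln/1]_(p <- s) p) <= (k.+1 + size s) * (\big[muln/1]_(p <- s) p.-1))%N.
Proof.
elim: s k => [|p s IH] k; first by rewrite !big_nil /=; lia.
move=> /= /andP[kp ps]; rewrite !big_cons.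
case: p kp ps => // p kp ps; have {}IH := IH p ps; rewrite /=.
set A := \big[muln/1%N]_(p <- s) p in IH *; set B := \big[muln/1%N]_(p <- s) p.-1 in IH *.
have H : (k.+1 * (p.+1 * A) <= k.+1 * ((p.+1 + size s) * B))%N by rewrite leq_mul2l IH orbT.
apply: leq_trans H _; rewrite !mulnA leq_mul2r; apply/orP; right.
by rewrite mulnDr mulnDl; nia.
Qed.

Lemma prod_primes q : (0 < q)%N ->
  q = (\big[muln/1]_(p <- primes q) (p * p ^ (logn p q).-1))%N.
Proof.
move=> q0; rewrite {1}(prod_prime_decomp q0) prime_decompE big_map /= big_seq [RHS]big_seq.
apply: eq_bigr => p; rewrite -expnS => pq.
by rewrite prednK // logn_gt0.
Qed.

(** Crude but sufficient: the number of prime divisors is [O(ln q)], a loss that is later absorbed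
    by a small power of [q]. *)
Lemma totient_lower q : (0 < q)%N -> (q <= totient q * (size (primes q)).+1)%N.
Proof.
move=> q0; rewrite totientE // {1}(prod_primes q0) !big_split /= mulnAC leq_mul2r.
apply/orP; right.
have : path ltn 1%N (primes q).
  by rewrite path_min_sorted ?sorted_primes //; apply/allP => p; rewrite mem_primes => /andP[/prime_gt1].
by move/(prod_pred_sorted (k := 0)); rewrite mul1n mulnC add1n.
Qed.

Lemma size_primes q : (0 < q)%N -> INR (size (primes q)) * ln 2 <= ln (INR q).
Proof.
move=> q0; rewrite {2}(prod_primes q0) big_seq ln_prod => [|p]; last first.
  by rewrite mem_primes => /andP[pp _]; rewrite muln_gt0 expn_gt0 prime_gt0.
rewrite -(count_predT (primes q)) -sum_const big_seq; apply: sum_le => p.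
rewrite mem_primes => /andP[pp _]; apply: ln_mono; first lra.
rewrite -[2]/(INR 2); apply: INR_leq.
by rewrite -[2%N]muln1 leq_mul ?prime_gt1 // expn_gt0 prime_gt0.
Qed.

(** Used to discard the primes dividing [q]: beyond [ln q] their total weight [ln p / p] is at most
    1. *)
Lemma sum_ln_prime_divisors q B : (0 < q)%N ->
  \sum_(0 <= p < B | prime p && (p %| q)%N) ln (INR p) <= ln (INR q).
Proof.
move=> q0; rewrite (ln_logn (B := maxn q B)) ?q0 ?leq_maxl //.
have pos p : 0 <= INR (logn p q) * ln (INR p).
  by apply: Rmult_le_pos; [exact: pos_INR|exact: ln_INR_ge0].
rewrite [X in _ <= X](big_cat_nat _ (n := B)) //=; last by rewrite leqW // leq_maxr.
rewrite -[X in X <= _]Rplus_0_r; apply: Rplus_le_compat; last by apply: sum_ge0 => p _; exact: pos.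
rewrite big_mkcondr; apply: sum_le => p pp; case: ifP => // pq.
have : (1 <= logn p q)%N by rewrite logn_gt0 mem_primes pp q0.
by move/INR_leq; have := ln_INR_ge0 p; rewrite -[INR 1]/1; nra.
Qed.

End PrimeSums.

(** * The resonator weights and the tilted measure on pairs of disjoint sets of primes *)

Module Resonator.
Import all_boot Sums PrimeSums.
Set Implicit Arguments. Unset Strict Implicit. Unset Printing Implicit Defensive.
Open Scope R_scope.

Lemma sum_multiples (p B : nat) (F : nat -> R) : (0 < p)%N ->
  \sum_(0 <= m < p * B | (p %| m)%N) F m = \sum_(0 <= k < B) F (p * k)%N.
Proof.
move=> p0; elim: B => [|B IH]; first by rewrite muln0 !big_geq.
rewrite (big_cat_nat _ (n := (p * B)%N)) //=; last by rewrite leq_mul2l leqnSn orbT.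
rewrite IH big_nat_recr //=; congr (_ + _).
rewrite mulnS big_ltn_cond; last by lia.
rewrite dvdn_mulr // big_nat_cond big1 ?Rplus_0_r // => m /andP[/andP[m1 m2]] /dvdnP[k E].
move: m1 m2; rewrite E -mulnS ![(p * _)%N]mulnC !ltn_pmul2r // ltnS => Bk.
by rewrite leqNgt Bk.
Qed.

Lemma sum_widen_le (A B : nat) (P : pred nat) (F : nat -> R) : (A <= B)%N -> (forall m, 0 <= F m) ->
  \sum_(0 <= m < A | P m) F m <= \sum_(0 <= m < B | P m) F m.
Proof.
move=> AB F0; rewrite [X in _ <= X](big_cat_nat _ (n := A)) //=.
by rewrite -[X in X <= _]Rplus_0_r; apply: Rplus_le_compat_l; apply: sum_ge0.
Qed.

Section Weights.
Variable r : nat -> R.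
Hypothesis r_ge0 : forall p, 0 <= r p.

(* [rho l] is the multiplicative function carried by the squarefree products of primes in [l],
   with value [r p] at [p]. *)
Fixpoint rho (l : seq nat) (m : nat) : R :=
  if l is p :: l' then (if (p %| m)%N then r p * rho l' (m %/ p) else rho l' m)
  else (if m == 1%N then 1 else 0).

Lemma rho_ge0 l m : 0 <= rho l m.
Proof.
elim: l m => [|p l IH] m /=; first by case: eqP => _; lra.
by case: ifP => _ //; apply: Rmult_le_pos.
Qed.

Lemma rho0 l : rho l 0 = 0.
Proof. by elim: l => [|p l IH] //=; rewrite dvdn0 div0n IH Rmult_0_r. Qed.

Lemma rho_notin l p m : all prime l -> prime p -> p \notin l -> (p %| m)%N -> rho l m = 0.
Proof.
move=> lp pp; elim: l lp m => [|a l IH] /= => [_ m _ pm|/andP[ap lp] m].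
  by case: eqP pm => // ->; rewrite dvdn1 => /eqP p1; rewrite p1 in pp.
rewrite inE negb_or => /andP[pa pl] pm; case: ifP => am; last exact: IH.
rewrite IH ?Rmult_0_r //.
have cpa : coprime p a by rewrite prime_coprime // dvdn_prime2.
by rewrite -(Gauss_dvdr _ cpa) mulnC divnK.
Qed.

Lemma rho_coprime l q m : all (fun p => coprime p q) l -> rho l m <> 0 -> coprime m q.
Proof.
elim: l m => [|p l IH] m /=; first by case: eqP => // ->; rewrite coprime1n.
move=> /andP[pq lq]; case: ifP => pm H; last exact: IH.
rewrite -(divnK pm) coprimeMl pq andbT; apply: IH => // E; apply: H.
by rewrite E Rmult_0_r.
Qed.

Lemma sum_rho_sqr l B : all prime l -> \sum_(0 <= m < B) rho l m ^ 2 <= \prod_(p <- l) (1 + r p ^ 2).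
Proof.
move=> lp; elim: l lp B => [|p l IH] => [_ B|lpl B].
  rewrite big_nil; apply: Rle_trans (sum_widen_le _ (leq_addl 2 B) _) _ => [m|].
    exact: pow2_ge_0.
  rewrite 2?big_ltn //= big_nat_cond big1 => [|m /andP[/andP[m2 _] _]]; first lra.
  by case: eqP m2 => [->|_] //= _; ring.
have /andP[pp lp] : prime p && all prime l := lpl.
have p0 := prime_gt0 pp.
rewrite prod_cons.
have -> : \sum_(0 <= m < B) rho (p :: l) m ^ 2 = \sum_(0 <= m < B | (p %| m)%N) rho (p :: l) m ^ 2
    + \sum_(0 <= m < B | ~~ (p %| m)%N) rho (p :: l) m ^ 2.
  by rewrite (bigID (fun m => p %| m)%N).
have H1 : \sum_(0 <= m < B | ~~ (p %| m)%N) rho (p :: l) m ^ 2 <= \prod_(p <- l) (1 + r p ^ 2).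
  apply: Rle_trans (IH lp B); rewrite big_mkcond; apply: sum_le => m _ /=.
  by case: (p %| m)%N => /=; [exact: (pow2_ge_0 (rho l m))|exact: Rle_refl].
have H2 : \sum_(0 <= m < B | (p %| m)%N) rho (p :: l) m ^ 2 <= r p ^ 2 * \prod_(p <- l) (1 + r p ^ 2).
  apply: Rle_trans (sum_widen_le _ (leq_pmull B p0) _) _ => [m|]; first exact: pow2_ge_0.
  rewrite sum_multiples // (eq_bigr (fun k => r p ^ 2 * rho l k ^ 2)) => [|k _].
    by rewrite -big_distrr; apply: Rmult_le_compat_l (IH lp B); exact: pow2_ge_0.
  by rewrite /= dvdn_mulr // mulKn //; ring.
apply: Rle_trans (Rplus_le_compat _ _ _ _ H2 H1) _; apply: Req_le. ring.
Qed.

(* The sum of [\prod_(p in S) r p ^ 2 * \prod_(p in U) r p * g (\prod S) (\prod U)]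
   over disjoint subsets [S], [U] of [l]. *)
Fixpoint conf (l : seq nat) (g : nat -> nat -> R) : R :=
  if l is p :: l' then
    conf l' g + r p ^ 2 * conf l' (fun s u => g (p * s)%N u) + r p * conf l' (fun s u => g s (p * u)%N)
  else g 1%N 1%N.

Lemma conf_le l g h : all prime l ->
  (forall s u, (0 < s)%N -> (0 < u)%N -> g s u <= h s u) -> conf l g <= conf l h.
Proof.
elim: l g h => [|p l IH] g h /= => [_|/andP[pp lp]] H; first exact: H.
have p0 := prime_gt0 pp.
apply: Rplus_le_compat; first apply: Rplus_le_compat; first exact: IH.
  by apply: Rmult_le_compat_l; [exact: pow2_ge_0|apply: IH => // s u s0 u0; apply: H => //; rewrite muln_gt0 p0].
by apply: Rmult_le_compat_l => //; apply: IH => // s u s0 u0; apply: H => //; rewrite muln_gt0 p0.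
Qed.

Lemma conf_ext l g h : all prime l ->
  (forall s u, (0 < s)%N -> (0 < u)%N -> g s u = h s u) -> conf l g = conf l h.
Proof. by move=> lp H; apply: Rle_antisym; apply: conf_le => // s u s0 u0; rewrite H //; exact: Rle_refl. Qed.

Lemma conf_lin l a b g h : conf l (fun s u => a * g s u + b * h s u) = a * conf l g + b * conf l h.
Proof.
elim: l g h => [|p l IH] g h //=.
by rewrite IH (IH (fun s u => g (p * s)%N u)) (IH (fun s u => g s (p * u)%N)); ring.
Qed.

Lemma conf_scal l a g : conf l (fun s u => a * g s u) = a * conf l g.
Proof. by elim: l g => [|p l IH] g //=; rewrite 3!IH; ring. Qed.

Lemma conf_scal_ext l a g h : all prime l ->
  (forall s u, (0 < s)%N -> (0 < u)%N -> g s u = a * h s u) -> conf l g = a * conf l h.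
Proof. by move=> lp H; rewrite -conf_scal; exact: conf_ext. Qed.

(** A strict upper bound for the product of any subset of [l]: the 2 makes the range for the empty
    list contain 1. *)
Definition lbound (l : seq nat) : nat := foldr muln 2%N l.

(** A pair of disjoint sets is encoded by [m = \prod S] and [u = \prod U], where
    [rho m * rho (m * u)] is the weight used in [conf]. The induction sorts pairs by whether [p]
    divides [m], divides only [u], or divides neither. *)
Lemma conf_rho l g : all prime l -> uniq l -> (forall s u, 0 <= g s u) ->
  conf l g <= \sum_(0 <= m < lbound l) \sum_(0 <= u < lbound l) rho l m * rho l (m * u)%N * g m u.
Proof.
elim: l g => [|p l IH] g => [_ _ g0|/= /andP[pp lp] /andP[pl lu] g0].
  have sum2 (F : nat -> R) : \sum_(0 <= m < 2) F m = F 0%N + F 1%N.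
    by rewrite big_ltn // big_nat1.
  by rewrite /lbound [foldr _ _ _]/= !sum2 /=; lra.
have p0 := prime_gt0 pp.
set B := lbound l.
have BB : (B <= p * B)%N by rewrite leq_pmull.
pose F m u := rho (p :: l) m * rho (p :: l) (m * u)%N * g m u.
have F0 m u : 0 <= F m u.
  by apply: Rmult_le_pos => //; apply: Rmult_le_pos; exact: rho_ge0.
have S0 (A : nat) (P : pred nat) m : 0 <= \sum_(0 <= u < A | P u) F m u by apply: sum_ge0.
rewrite -[X in _ <= X]/(\sum_(0 <= m < p * B) \sum_(0 <= u < p * B) F m u).
have H1 : r p ^ 2 * conf l (fun s u => g (p * s)%N u)
    <= \sum_(0 <= m < p * B | (p %| m)%N) \sum_(0 <= u < p * B) F m u.
  rewrite sum_multiples //.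
  apply: (Rle_trans _ (\sum_(0 <= k < B) \sum_(0 <= u < B) r p ^ 2 * (rho l k * rho l (k * u)%N * g (p * k)%N u))).
    rewrite -conf_scal; apply: Rle_trans (IH _ lp lu _) _ => [s u|].
      by apply: Rmult_le_pos; [exact: pow2_ge_0|].
    by apply: sum_le => k _; apply: sum_le => u _; apply: Req_le; ring.
  apply: sum_le => k _; apply: Rle_trans (sum_widen_le _ BB _) => [|u]; last exact: F0.
  apply: sum_le => u _; rewrite /F /= -mulnA !dvdn_mulr // !mulKn //.
  by apply: Req_le; ring.
have H2 : r p * conf l (fun s u => g s (p * u)%N)
    <= \sum_(0 <= m < p * B | ~~ (p %| m)%N) \sum_(0 <= u < p * B | (p %| u)%N) F m u.
  apply: Rle_trans (sum_widen_le _ BB _) => [|m]; last exact: S0.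
  rewrite -conf_scal; apply: Rle_trans (IH _ lp lu _) _ => [s u|]; first exact: Rmult_le_pos.
  rewrite [X in _ <= X]big_mkcond; apply: sum_le => m _; case: ifP => [pm|/negbFE pm].
    rewrite sum_multiples //; apply: sum_le => u _.
    by rewrite /F /= (negbTE pm) mulnCA dvdn_mulr // mulKn //; apply: Req_le; ring.
  by apply: Req_le; rewrite big1 // => u _; rewrite (rho_notin lp pp pl pm); ring.
have H3 : conf l g <= \sum_(0 <= m < p * B | ~~ (p %| m)%N) \sum_(0 <= u < p * B | ~~ (p %| u)%N) F m u.
  apply: Rle_trans (sum_widen_le _ BB _) => [|m]; last exact: S0.
  apply: Rle_trans (IH _ lp lu g0) _.
  rewrite [X in _ <= X]big_mkcond; apply: sum_le => m _; case: ifP => [pm|/negbFE pm].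
    apply: Rle_trans (sum_widen_le _ BB _) => [|u]; last exact: F0.
    rewrite [X in _ <= X]big_mkcond; apply: sum_le => u _; case: ifP => [pu|/negbFE pu].
      by rewrite /F /= Euclid_dvdM // (negbTE pm) (negbTE pu) /=; exact: Rle_refl.
    by rewrite (rho_notin lp pp pl (m := (m * u)%N)) ?dvdn_mull //; lra.
  by apply: Req_le; rewrite big1 // => u _; rewrite (rho_notin lp pp pl pm); ring.
rewrite [X in _ <= X](bigID (fun m => p %| m)%N) /=.
have -> : \sum_(0 <= m < p * B | ~~ (p %| m)%N) \sum_(0 <= u < p * B) F m u =
   \sum_(0 <= m < p * B | ~~ (p %| m)%N) \sum_(0 <= u < p * B | (p %| u)%N) F m u +
   \sum_(0 <= m < p * B | ~~ (p %| m)%N) \sum_(0 <= u < p * B | ~~ (p %| u)%N) F m u.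
  by rewrite -big_split; apply: eq_bigr => m _; rewrite (bigID (fun u => p %| u)%N).
by move: H1 H2 H3 => /=; lra.
Qed.

Lemma ln_mulN m n : (0 < m)%N -> (0 < n)%N -> ln (INR (m * n)%N) = ln (INR m) + ln (INR n).
Proof. by move=> m0 n0; rewrite mult_INR ln_mult //; exact: INR_gt0. Qed.

Section Tilt.
Variable sigma : R.

(* [prob p] is the probability that [p] belongs to [U] under the measure on pairs [(S, U)]
   given by [conf], tilted by [u ^ (- sigma)]. *)
Definition tilt p := r p * exp (- sigma * ln (INR p)).
Definition den p := 1 + r p ^ 2 + tilt p.
Definition prob p := tilt p / den p.
Definition ztot l := \prod_(p <- l) den p.
Definition mean l := \sum_(p <- l) prob p * ln (INR p).
Definition var l := \sum_(p <- l) prob p * (1 - prob p) * ln (INR p) ^ 2.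
(** The mean of [ln (s * u)]: the quotient is the probability that [p] lies in [S] or in [U]. *)
Definition mean_size l := \sum_(p <- l) (r p ^ 2 + tilt p) / den p * ln (INR p).

Lemma exp_ln_mulN m n : (0 < m)%N -> (0 < n)%N ->
  exp (- sigma * ln (INR (m * n)%N)) = exp (- sigma * ln (INR m)) * exp (- sigma * ln (INR n)).
Proof. by move=> m0 n0; rewrite ln_mulN // -exp_plus; congr exp; ring. Qed.

Lemma tilt_ge0 p : 0 <= tilt p.
Proof. by apply: Rmult_le_pos => //; exact: Rlt_le (exp_pos _). Qed.

Lemma den_ge1 p : 1 <= den p.
Proof. by have := tilt_ge0 p; have := pow2_ge_0 (r p); rewrite /den; lra. Qed.

Lemma ztot_gt0 l : 0 < ztot l.
Proof.
rewrite /ztot; elim/big_ind: _ => [|x y|p _]; [lra|exact: Rmult_lt_0_compat|].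
by have := den_ge1 p; lra.
Qed.

Lemma prob_ge0 p : 0 <= prob p.
Proof. by apply: Rdiv_le_0_compat; [exact: tilt_ge0|have := den_ge1 p; lra]. Qed.

Lemma conf_tilt l : all prime l -> conf l (fun s u => exp (- sigma * ln (INR u))) = ztot l.
Proof.
elim: l => [|p l IH] /= => [_|/andP[pp lp]].
  by rewrite ln_1 Rmult_0_r exp_0 /ztot big_nil.
rewrite /ztot prod_cons -/(ztot l) IH //.
rewrite (conf_scal_ext (a := exp (- sigma * ln (INR p))) (h := fun s u => exp (- sigma * ln (INR u)))) //; last first.
  by move=> s u _ u0; rewrite exp_ln_mulN ?(prime_gt0 pp).
by rewrite IH // /den /tilt; ring.
Qed.

(** Membership of different primes is independent, so variances add. The centre [x] is a parameter
    because putting [p] into [U] moves it to [x - ln p]; the shift in [conf_size] has the same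
    purpose. *)
Lemma conf_var l x : all prime l ->
  conf l (fun s u => exp (- sigma * ln (INR u)) * (ln (INR u) - x) ^ 2) = ztot l * (var l + (mean l - x) ^ 2).
Proof.
elim: l x => [|p l IH] x /= => [_|/andP[pp lp]].
  by rewrite ln_1 Rmult_0_r exp_0 /ztot /var /mean !big_nil; ring.
rewrite /ztot /var /mean ?prod_cons ?sum_cons -/(ztot l) -/(var l) -/(mean l) IH //.
rewrite (conf_scal_ext (a := exp (- sigma * ln (INR p)))
   (h := fun s u => exp (- sigma * ln (INR u)) * (ln (INR u) - (x - ln (INR p))) ^ 2)) //; last first.
  by move=> s u _ u0; rewrite exp_ln_mulN ?(prime_gt0 pp) // ln_mulN ?(prime_gt0 pp) //; ring.
rewrite IH // /prob.
have := den_ge1 p; rewrite /den /tilt => D1; field; lra.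
Qed.

Lemma conf_size l x : all prime l ->
  conf l (fun s u => exp (- sigma * ln (INR u)) * (ln (INR s) + ln (INR u) + x)) = ztot l * (mean_size l + x).
Proof.
elim: l x => [|p l IH] x /= => [_|/andP[pp lp]].
  by rewrite ln_1 Rmult_0_r exp_0 /ztot /mean_size !big_nil; ring.
rewrite /ztot /mean_size ?prod_cons ?sum_cons -/(ztot l) -/(mean_size l) IH //.
have -> : conf l (fun s u => exp (- sigma * ln (INR u)) * (ln (INR (p * s)%N) + ln (INR u) + x))
    = ztot l * (mean_size l + (x + ln (INR p))).
  rewrite -IH //; apply: conf_ext => // s u s0 _.
  by rewrite ln_mulN ?(prime_gt0 pp) //; ring.
have -> : conf l (fun s u => exp (- sigma * ln (INR (p * u)%N)) * (ln (INR s) + ln (INR (p * u)%N) + x))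
    = exp (- sigma * ln (INR p)) * (ztot l * (mean_size l + (x + ln (INR p)))).
  rewrite -IH //; apply: conf_scal_ext => // s u _ u0.
  by rewrite exp_ln_mulN ?(prime_gt0 pp) // ln_mulN ?(prime_gt0 pp) //; ring.
have := den_ge1 p; rewrite /den /tilt => D1; field; lra.
Qed.

Definition window (a b : R) (s u : nat) : R :=
  if Rle_dec (ln (INR u)) a then (if Rle_dec (ln (INR s) + ln (INR u)) b then 1 else 0) else 0.

(* Chebyshev's inequality for [ln u] and Markov's inequality for [ln (s * u)]. *)
Lemma conf_window l h b : all prime l -> 0 <= sigma -> 0 < h -> 0 < b ->
  exp (sigma * (mean l - h)) * ztot l * (1 - var l / h ^ 2 - mean_size l / b)
  <= conf l (window (mean l + h) b).
Proof.
move=> lp s0 h0 b0.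
have -> : exp (sigma * (mean l - h)) * ztot l * (1 - var l / h ^ 2 - mean_size l / b) =
  exp (sigma * (mean l - h)) * conf l (fun s u => 1 * (1 * exp (- sigma * ln (INR u)) +
     (- / b) * (exp (- sigma * ln (INR u)) * (ln (INR s) + ln (INR u) + 0))) +
     (- / h ^ 2) * (exp (- sigma * ln (INR u)) * (ln (INR u) - mean l) ^ 2)).
  by rewrite !conf_lin conf_tilt // conf_size // conf_var //; field; lra.
rewrite -conf_scal; apply: conf_le => // s u sp up.
have ls := ln_INR_ge0 s; have lu := ln_INR_ge0 u.
set X := ln (INR u) in lu *; set Y := ln (INR s) in ls *.
set e := exp (- sigma * X); have e0 : 0 < e := exp_pos _.
have -> : exp (sigma * (mean l - h)) * (1 * (1 * e + - / b * (e * (Y + X + 0))) + - / h ^ 2 * (e * (X - mean l) ^ 2))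
  = exp (sigma * (mean l - h - X)) * (1 - (Y + X) / b - ((X - mean l) / h) ^ 2).
  have -> : exp (sigma * (mean l - h - X)) = exp (sigma * (mean l - h)) * e.
    by rewrite /e -exp_plus; congr exp; ring.
  by field; lra.
have E0 := exp_pos (sigma * (mean l - h - X)).
have q0 := pow2_ge_0 ((X - mean l) / h).
have y0 : 0 <= (Y + X) / b by apply: Rdiv_le_0_compat; lra.
have Fb : (Y + X) / b * b = Y + X by field; lra.
have Fh : (X - mean l) / h * h = X - mean l by field; lra.
rewrite /window -/X -/Y.
(* Outside the window one of the subtracted terms is at least 1, and a non-positive bracket makes
   the claim trivial. *)
have neg : 1 - (Y + X) / b - ((X - mean l) / h) ^ 2 <= 0 ->
  exp (sigma * (mean l - h - X)) * (1 - (Y + X) / b - ((X - mean l) / h) ^ 2) <= 0 by nra.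
case: Rle_dec => [H1|/Rnot_le_lt H1] /=; last first.
  apply: neg; have H : 1 <= (X - mean l) / h by nra.
  nra.
case: Rle_dec => [H2|/Rnot_le_lt H2] /=; last first.
  apply: neg; have H : 1 <= (Y + X) / b by nra.
  nra.
case: (Rle_lt_dec (1 - (Y + X) / b - ((X - mean l) / h) ^ 2) 0) => [/neg H|H]; first lra.
(* A positive bracket forces [X >= mean l - h], so the exponential factor is at most 1, as is the
   bracket. *)
have H3 : -1 <= (X - mean l) / h by nra.
have : exp (sigma * (mean l - h - X)) <= 1.
  rewrite -exp_0; apply: exp_mono; have H4 : mean l - h - X <= 0 by nra.
  nra.
nra.
Qed.

(** Each local factor equals [(1 + r p ^ 2) / (1 - prob p)], and [1 - prob p <= exp (- prob p)]. The
    product of the [1 + r p ^ 2] later cancels against the bound of [sum_rho_sqr]. *)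
Lemma ztot_lower l :
  (\prod_(p <- l) (1 + r p ^ 2)) * exp (\sum_(p <- l) prob p) <= ztot l.
Proof.
elim: l => [|p l IH]; first by rewrite /ztot !big_nil exp_0; lra.
rewrite /ztot ?prod_cons ?sum_cons -/(ztot l) exp_plus.
have r2 := pow2_ge_0 (r p); have t0 := tilt_ge0 p; have D := den_ge1 p.
have H : (1 + r p ^ 2) * exp (prob p) <= den p.
  have := exp_ineq1_le (- prob p); rewrite exp_Ropp => H.
  have E : 1 + - prob p = (1 + r p ^ 2) / den p by rewrite /prob /den in D *; field; lra.
  rewrite E in H; have e0 := exp_pos (prob p).
  have dx : 0 <= den p * exp (prob p) by nra.
  have := Rmult_le_compat_r _ _ _ dx H.
  have -> : (1 + r p ^ 2) / den p * (den p * exp (prob p)) = (1 + r p ^ 2) * exp (prob p) by field; lra.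
  by have -> : / exp (prob p) * (den p * exp (prob p)) = den p by field; lra.
have P0 : 0 <= (\prod_(j <- l) (1 + r j ^ 2)) * exp (\sum_(j <- l) prob j).
  apply: Rmult_le_pos; last exact: Rlt_le (exp_pos _).
  elim/big_ind: _ => [|x y|j _]; [lra|exact: Rmult_le_pos|].
  by have := pow2_ge_0 (r j); lra.
have e0 := exp_pos (prob p).
apply: (Rle_trans _ ((1 + r p ^ 2) * exp (prob p) * ((\prod_(j <- l) (1 + r j ^ 2)) * exp (\sum_(j <- l) prob j)))).
  by apply: Req_le; ring.
by apply: Rmult_le_compat => //; apply: Rmult_le_pos; lra.
Qed.

End Tilt.
End Weights.
End Resonator.

(** * The resonance inequality for a general modulus *)

Module Reduction.
Import all_boot Sums Dirichlet PrimeSums Resonator.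
Set Implicit Arguments. Unset Strict Implicit. Unset Printing Implicit Defensive.
Open Scope R_scope.

Lemma sum_support (L K : nat) (P : pred nat) (F : nat -> R) :
  (forall m, 0 <= F m) -> (forall m, F m <> 0 -> (m < K)%N && P m) ->
  \sum_(0 <= m < L) F m <= \sum_(0 <= m < K | P m) F m.
Proof.
move=> F0 FK; apply: (Rle_trans _ (\sum_(0 <= m < maxn L K) F m)).
  by apply: sum_widen_le => //; exact: leq_maxl.
rewrite (big_cat_nat _ (n := K)) //=; last exact: leq_maxr.
rewrite [X in _ + X]big_nat_cond [X in _ + X]big1 => [|m /andP[/andP[Km _] _]]; last first.
  by case: (Req_dec (F m) 0) => // /FK; rewrite ltnNge Km.
rewrite Rplus_0_r [X in _ <= X]big_mkcond; apply: sum_le => m _; case: ifP => [_|Pm]; first lra.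
by case: (Req_dec (F m) 0) => [->|/FK]; [lra|rewrite Pm andbF].
Qed.

Lemma sum_mul_le (I : Type) (s : seq I) (f g : I -> R) :
  (\sum_(i <- s) f i) * (\sum_(i <- s) g i)
  <= INR (size s) * ((\sum_(i <- s) f i ^ 2) + (\sum_(i <- s) g i ^ 2)) / 2.
Proof.
have -> : (\sum_(i <- s) f i) * (\sum_(i <- s) g i) = \sum_(i <- s) \sum_(j <- s) f i * g j.
  by rewrite big_distrl; apply: eq_bigr => i _; rewrite big_distrr.
apply: (Rle_trans _ (\sum_(i <- s) \sum_(j <- s) / 2 * (1 * f i ^ 2 + g j ^ 2 * 1))).
  by apply: sum_le => i _; apply: sum_le => j _; have := pow2_ge_0 (f i - g j); nra.
under eq_bigr do rewrite sum_lincomb sum_const.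
rewrite count_predT.
rewrite (eq_bigr (fun i => / 2 * (INR (size s) * (f i ^ 2) + (\sum_(j <- s) g j ^ 2) * 1))); last first.
  by move=> i _; ring.
by rewrite sum_lincomb sum_const count_predT; apply: Req_le; field.
Qed.

Section Support.
Variables (q M : nat) (l : seq nat) (r : nat -> R).
Hypotheses (r_ge0 : forall p, 0 <= r p) (Mq : (M < q)%N) (lp : all prime l) (lu : uniq l).
Hypothesis lq : all (fun p => coprime p q) l.
Notation rho := (rho r l).

Lemma window_ge0 a b s u : 0 <= window a b s u.
Proof. by rewrite /window; case: Rle_dec => _ /=; [case: Rle_dec => _ /=|]; lra. Qed.

Lemma sum_coprime_support (f : nat -> R) :
  (forall m, f m <> 0 -> (m <= M)%N /\ rho m <> 0) ->
  \sum_(0 <= m < q | coprime m q) f m = \sum_(0 <= m < M.+1) f m.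
Proof.
move=> H; rewrite (big_cat_nat _ (n := M.+1)) //=.
rewrite [X in _ + X]big_nat_cond [X in _ + X]big1 => [|m /andP[/andP[Mm _] _]]; last first.
  by case: (Req_dec (f m) 0) => // /H[]; rewrite leqNgt Mm.
rewrite Rplus_0_r big_mkcond; apply: eq_bigr => m _; case: ifP => // cm.
by case: (Req_dec (f m) 0) => // /H[_ /(rho_coprime lq)]; rewrite cm.
Qed.

(** The window bounds [u] by [K] and [m * u] by [M] on the support; coprimality to [q] is automatic
    there, since all primes of [l] are coprime to [q]. *)
Lemma conf_window_le a b K : (forall u, (0 < u)%N -> ln (INR u) <= a -> (u <= K)%N) ->
  (forall m, (0 < m)%N -> ln (INR m) <= b -> (m <= M)%N) ->
  conf r l (window a b) <= \sum_(0 <= m < M.+1) \sum_(0 <= u < K.+1 | [&& (0 < u)%N, coprime u q & (m * u <= M)%N])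
     rho m * rho (m * u)%N.
Proof.
move=> Ha Hb.
apply: Rle_trans (conf_rho r_ge0 lp lu (window_ge0 a b)) _.
have F0 m u : 0 <= rho m * rho (m * u)%N * window a b m u.
  by apply: Rmult_le_pos; [apply: Rmult_le_pos; exact: rho_ge0|exact: window_ge0].
have supp m u : rho m * rho (m * u)%N * window a b m u <> 0 ->
   [/\ (m <= M)%N, (u <= K)%N & [&& (0 < u)%N, coprime u q & (m * u <= M)%N]].
  move=> H.
  have m0 : (0 < m)%N by case: m H => // H; case: H; rewrite rho0; ring.
  have u0 : (0 < u)%N by case: u H => // H; case: H; rewrite muln0 rho0; ring.
  have cu : coprime (m * u) q.
    by apply: (rho_coprime (l := l) (r := r)) => // E; apply: H; rewrite E; ring.
  have w : window a b m u <> 0 by move=> E; apply: H; rewrite E; ring.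
  move: w; rewrite /window; case: Rle_dec => //= h1; case: Rle_dec => //= h2 _.
  have muM : (m * u <= M)%N by apply: Hb; rewrite ?muln_gt0 ?m0 // ln_mulN.
  split; [exact: leq_trans (leq_pmulr _ u0) muM|exact: Ha|].
  by rewrite u0 muM; move: cu; rewrite coprimeMl => /andP[_ ->].
apply: Rle_trans (sum_support (K := M.+1) (P := predT) _ _ _) _ => [m|m|].
- by apply: sum_ge0.
- move=> H; rewrite andbT ltnS; case: (leqP m M) => // mM; case: H; apply: big1 => u _.
  by case: (Req_dec (rho m * rho (m * u)%N * window a b m u) 0) => // /supp[]; rewrite leqNgt mM.
apply: sum_le => m _.
apply: Rle_trans (sum_support (K := K.+1)
   (P := fun u => [&& (0 < u)%N, coprime u q & (m * u <= M)%N]) _ _ _) _ => [u|u /supp[_ uK]|].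
- exact: F0.
- by rewrite ltnS uK.
apply: sum_le => u _; have h0 : 0 <= rho m * rho (m * u)%N by apply: Rmult_le_pos; exact: rho_ge0.
by rewrite /window; case: Rle_dec => _ /=; [case: Rle_dec => _ /=|]; nra.
Qed.

(** The summand beside [B] is the trivial character: at most [x] values of [n], and the square of
    the sum of the weights is at most [M.+1] times the sum of their squares. *)
Lemma resonance_general a b x B :
  (1 < q)%N -> 0 <= B -> charsum_bounded q x B ->
  (forall u, (0 < u)%N -> ln (INR u) <= a -> (u <= x)%N) ->
  (forall m, (0 < m)%N -> ln (INR m) <= b -> (m <= M)%N) ->
  conf r l (window a b) <=
  (B + INR x * INR M.+1 / INR (totient q)) * \prod_(p <- l) (1 + r p ^ 2).
Proof.
move=> q1 B0 HB Ha Hb.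
pose f m := if (m <= M)%N then rho m else 0.
have f0 m : 0 <= f m by rewrite /f; case: ifP => _; [exact: rho_ge0|lra].
have fsupp m : f m <> 0 -> (m <= M)%N /\ rho m <> 0 by rewrite /f; case: ifP.
have H := direct_bilinear q1 f f B0 Rlt_0_1 HB.
rewrite !(@sum_coprime_support f) // !(@sum_coprime_support (fun m => f m ^ 2)) in H; last first.
  by move=> m Hm; apply: fsupp => E; apply: Hm; rewrite E; ring.
set S := \sum_(0 <= m < M.+1) f m ^ 2 in H.
set A := \sum_(0 <= m < M.+1) f m in H.
set T := \sum_(1 <= n < x.+1 | coprime n q) _ in H.
have SP : S <= \prod_(p <- l) (1 + r p ^ 2).
  apply: Rle_trans (sum_rho_sqr r M.+1 lp); rewrite /S big_nat_cond [X in _ <= X]big_nat_cond.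
  by apply: sum_le => m /andP[/andP[_ mM] _]; rewrite /f -ltnS mM; exact: Rle_refl.
have phi0 : 0 < INR (totient q) by apply: INR_gt0; rewrite totient_gt0 ltnW.
have AS : A * A <= INR M.+1 * S.
  have := sum_mul_le (index_iota 0 M.+1) f f; rewrite size_iota subn0 -/A -/S; lra.
have A0 : 0 <= A by apply: sum_ge0.
set cnt := INR (count _ _) in H.
have cntx : 0 <= cnt <= INR x.
  split; first exact: pos_INR.
  by apply: INR_leq; apply: leq_trans (count_size _ _) _; rewrite size_iota subSS subn0.
have HT : T <= B * S + INR x * (INR M.+1 * S) / INR (totient q).
  have : T - cnt * A * A / INR (totient q) <= B / 2 * (1 * S + S / 1) := Rle_trans _ _ _ (Rle_abs _) H.
  have : cnt * A * A / INR (totient q) <= INR x * (INR M.+1 * S) / INR (totient q).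
    apply: Rmult_le_compat_r; first exact: Rlt_le (Rinv_0_lt_compat _ phi0).
    by rewrite Rmult_assoc; apply: Rmult_le_compat; nra.
  lra.
have S0 : 0 <= S by apply: sum_ge0 => m _; exact: pow2_ge_0.
have c0 : 0 <= B + INR x * INR M.+1 / INR (totient q).
  apply: Rplus_le_le_0_compat => //; apply: Rdiv_le_0_compat => //.
  by apply: Rmult_le_pos; exact: pos_INR.
apply: (Rle_trans _ T); last first.
  apply: Rle_trans HT _; apply: (Rle_trans _ ((B + INR x * INR M.+1 / INR (totient q)) * S)).
    by apply: Req_le; field; lra.
  exact: Rmult_le_compat_l.
apply: Rle_trans (conf_window_le Ha Hb) _.
rewrite /T.
(* Only pairs with [u * m <= M < q] are retained, where reduction modulo [q] does nothing; all other
   terms are non-negative. *)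
apply: (Rle_trans _ (\sum_(0 <= m < M.+1) \sum_(0 <= u < x.+1 | (0 < u)%N && coprime u q)
    f m * f (u * m %% q)%N)).
  rewrite big_nat_cond [X in _ <= X]big_nat_cond; apply: sum_le => m /andP[/andP[_ mM] _].
  rewrite big_mkcond [X in _ <= X]big_mkcond; apply: sum_le => u _.
  case: (boolP ((0 < u)%N && coprime u q)) => [/andP[-> ->] /=|]; last first.
    by rewrite andbA => /negbTE -> /=; exact: Rle_refl.
  case: ifP => [muM|_]; last exact: Rmult_le_pos.
  rewrite ltnS in mM; rewrite [(u * m)%N]mulnC modn_small ?(leq_ltn_trans muM Mq) //.
  by rewrite /f mM muM; exact: Rle_refl.
rewrite exchange_big /= big_ltn_cond //=.
rewrite big_nat_cond [X in _ <= X]big_nat_cond.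
rewrite (eq_bigl (fun i => (0 < i < x.+1)%N && coprime i q)); last first.
  by move=> i; case: (ltnP 0 i).
apply: sum_le => u /andP[/andP[u0 ux] cu].
have := @sum_coprime_support (fun m => f m * f (u * m %% q)%N) => -> ; first exact: Rle_refl.
by move=> m Hm; apply: fsupp => E; apply: Hm; rewrite E; ring.
Qed.
End Support.
End Reduction.

(** * Cosine sums and the resonance inequality for sums of length near [q / N], with [q] prime *)

Module PrimeModulus.
Import all_boot Sums Characters Dirichlet PrimeSums Resonator Reduction.
Set Implicit Arguments. Unset Strict Implicit. Unset Printing Implicit Defensive.
Open Scope R_scope.

Section Cosines.
Variable q : nat.
Hypothesis q0 : (0 < q)%N.

Definition cosq (k : nat) : R := cos (2 * PI * INR k / INR q).

Lemma cosqE k : cosq k = Re (expC q k). Proof. by []. Qed.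

Lemma cosq_mod k : cosq (k %% q) = cosq k.
Proof. by rewrite !cosqE expC_mod. Qed.

Lemma sum_expC j : ~~ (q %| j)%N ->
  \big[Cplus/RtoC 0]_(0 <= u < q) expC q (u * j) = RtoC 0.
Proof.
move=> qj; apply: (@Cmult_fix (expC q j)); last first.
  rewrite -expC_mod // => /expC_eq1; rewrite ltn_pmod // => /(_ isT) E.
  by move: qj; rewrite /dvdn E.
rewrite big_distrl /=.
transitivity (\big[Cplus/RtoC 0]_(1 <= u < q.+1) expC q (u * j)).
  rewrite big_add1 /=; apply: eq_bigr => u _; by rewrite -expCD mulSn addnC.
rewrite [RHS]big_ltn // mul0n expC0 big_nat_recr //= [(q * j)%N]mulnC expC_period //.
exact: Cplus_comm.
Qed.

Lemma sum_expC_conj m m' : (m < q)%N -> (m' < q)%N ->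
  \big[Cplus/RtoC 0]_(0 <= u < q) Cmult (expC q (u * m)) (Cconj (expC q (u * m')))
  = if m == m' then RtoC (INR q) else RtoC 0.
Proof.
move=> mq mq'.
have cj u : Cconj (expC q (u * m')) = expC q (u * (q - m')).
  have E : Cmult (expC q (u * m')) (expC q (u * (q - m'))) = RtoC 1.
    by rewrite -expCD -mulnDr subnKC ?(ltnW mq') // expC_period.
  by rewrite -[LHS]Cmult_1_r -E Cmult_assoc (Cmult_comm (Cconj _)) expC_conj Cmult_1_l.
rewrite (eq_bigr (fun u => expC q (u * (m + (q - m'))))) => [|u _]; last first.
  by rewrite cj -expCD mulnDr.
case: eqP => [->|/eqP mm].
  rewrite subnKC ?(ltnW mq') // (eq_bigr (fun=> RtoC 1)) => [|u _]; last by rewrite expC_period.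
  by rewrite -RtoC_sum sum_const count_predT size_iota subn0 Rmult_1_r.
apply: sum_expC; apply: contra mm => /dvdnP[k E].
have k1 : k = 1%N by nia.
by apply/eqP; lia.
Qed.

(** The cosine sum is the real part of an exponential sum, to which discrete orthogonality modulo
    [q] applies; [K <= q] keeps the frequencies distinct. *)
Lemma sum_cosq_sqr (Q : nat -> R) K : (K <= q)%N ->
  \sum_(0 <= u < q) (\sum_(0 <= m < K) Q m * cosq (u * m)) ^ 2 <= INR q * \sum_(0 <= m < K) Q m ^ 2.
Proof.
move=> Kq.
pose Z u := \big[Cplus/RtoC 0]_(0 <= m < K) Cmult (RtoC (Q m)) (expC q (u * m)).
have ReZ u : \sum_(0 <= m < K) Q m * cosq (u * m) = Re (Z u).
  by rewrite Re_sum; apply: eq_bigr => m _; rewrite /cosq /Cmult /=; ring.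
apply: (Rle_trans _ (\sum_(0 <= u < q) Cmod (Z u) ^ 2)).
  apply: sum_le => u _; rewrite ReZ; have := re_le_Cmod (Z u); have := Cmod_ge_0 (Z u).
  rewrite -(pow2_abs (Re (Z u))) => ? ?; apply: pow_incr; split=> //; exact: Rabs_pos.
apply: Req_le; apply: RtoC_inj; rewrite RtoC_sum RtoC_mult RtoC_sum.
transitivity (\big[Cplus/RtoC 0]_(0 <= u < q) \big[Cplus/RtoC 0]_(0 <= m < K) \big[Cplus/RtoC 0]_(0 <= m' < K)
   Cmult (RtoC (Q m * Q m')) (Cmult (expC q (u * m)) (Cconj (expC q (u * m'))))).
  apply: eq_bigr => u _; rewrite Cmod2_conj /Z Cconj_sum big_distrl /=; apply: eq_bigr => m _.
  rewrite big_distrr /=; apply: eq_bigr => m' _; rewrite Cmult_conj RtoC_mult.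
  by rewrite (_ : Cconj (RtoC (Q m')) = RtoC (Q m')) ?/Cconj /= ?Ropp_0 //; ring.
rewrite exchange_big /= big_distrr /= big_nat_cond [RHS]big_nat_cond.
apply: eq_bigr => m /andP[/andP[_ mK] _].
rewrite exchange_big /= big_nat_cond.
transitivity (\big[Cplus/RtoC 0]_(0 <= m' < K) (if m == m' then Cmult (RtoC (INR q)) (RtoC (Q m ^ 2)) else RtoC 0)).
  rewrite [RHS]big_nat_cond; apply: eq_bigr => m' /andP[/andP[_ mK'] _].
  rewrite -big_distrr /= sum_expC_conj ?(leq_trans _ Kq) //.
  case: eqP => [<-|_]; last by rewrite Cmult_0_r.
  by rewrite Cmult_comm; congr Cmult; congr RtoC; ring.
rewrite big_mkord (bigD1 (Ordinal mK)) //= eqxx big1 ?Cplus_0_r // => i im.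
case: eqP => // E; case/eqP: im; exact: val_inj.
Qed.

Lemma cosq_ge (c : R) k : 0 <= c <= PI / 2 -> 2 * PI * INR k <= c * INR q -> cos c <= cosq k.
Proof.
move=> [c0 c1] H; have qR := INR_gt0 q0; have kR := pos_INR k; have pi := PI_RGT_0.
have H2 : 2 * PI * INR k / INR q <= c.
  by apply: (Rmult_le_reg_r (INR q)) => //; rewrite /Rdiv Rmult_assoc Rinv_l; lra.
have H3 : 0 <= 2 * PI * INR k / INR q by apply: Rdiv_le_0_compat => //; nra.
by apply: cos_decr_1; lra.
Qed.

Lemma cosq_ge0 k : (4 * k <= q)%N -> 0 <= cosq k.
Proof.
move=> H; rewrite -cos_PI2; apply: cosq_ge; first by have := PI_RGT_0; lra.
by have := INR_leq H; rewrite mult_INR /=; have := PI_RGT_0; nra.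
Qed.

Lemma cosq_ge_half k : (8 * k <= q)%N -> / 2 <= cosq k.
Proof.
move=> H; have pi := PI_RGT_0; apply: (Rle_trans _ (cos (PI / 4))); last first.
  apply: cosq_ge; first lra.
  by have := INR_leq H; rewrite mult_INR /=; nra.
rewrite (_ : / 2 = cos (PI / 3)); last by rewrite cos_PI3; lra.
by apply: cos_decr_1; lra.
Qed.

(** On [[0, 2]] the Taylor polynomial of degree 7, a lower bound for the sine, is at least
    [y / 3]. *)
Lemma sin_ge_quarter y : 0 <= y <= PI / 2 -> y / 4 <= sin y.
Proof.
move=> [y0 y1]; have p4 := PI_4; have pi := PI_RGT_0.
have [|H _] := SIN y y0 _; first lra.
apply: Rle_trans H; have y2 : y <= 2 by lra.
rewrite /sin_lb /sin_approx /sin_term /= .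
have ysq : 0 <= y * y <= 4 by nra.
have y3 : y * (y * y) <= 4 * y by nra.
have y5 : 0 <= y * (y * y) * (y * y) by apply: Rmult_le_pos; nra.
have y7 : y * (y * y) * (y * y) * (y * y) <= 4 * (y * (y * y) * (y * y)) by nra.
by field_simplify; nra.
Qed.

(** The Dirichlet kernel with its denominator cleared, which spares the case distinction at
    multiples of [2 * PI]. *)
Lemma cos_sum_kernel x t :
  2 * sin (t / 2) * (\sum_(1 <= n < x.+1) cos (INR n * t)) = sin ((INR x + / 2) * t) - sin (t / 2).
Proof.
elim: x => [|x IH]; first by rewrite big_geq //= (_ : (0 + / 2) * t = t / 2); [ring|field].
rewrite big_nat_recr // -[in LHS]/(Rplus _ _) Rmult_plus_distr_l IH.
have -> : sin ((INR x.+1 + / 2) * t) = sin (INR x.+1 * t + t / 2) by congr sin; field.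
have -> : sin ((INR x + / 2) * t) = sin (INR x.+1 * t - t / 2) by rewrite S_INR; congr sin; field.
by rewrite sin_plus sin_minus; ring.
Qed.

Lemma cosq_sum_bound x k : (0 < k < q)%N ->
  Rabs (\sum_(1 <= n < x.+1) cosq (n * k)) <= 2 * INR q / INR (minn k (q - k)).
Proof.
move=> /andP[k0 kq]; have qR := INR_gt0 q0; have pi := PI_RGT_0.
set k' := minn k (q - k).
have k'0 : (0 < k')%N by rewrite leq_min k0 subn_gt0.
have k'R := INR_gt0 k'0.
set t := 2 * PI * INR k / INR q.
have -> : \sum_(1 <= n < x.+1) cosq (n * k) = \sum_(1 <= n < x.+1) cos (INR n * t).
  by apply: eq_bigr => n _; rewrite /cosq mult_INR /t; congr cos; field; lra.
set E := \sum_(1 <= n < x.+1) _.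
have K : 2 * sin (t / 2) * E = sin ((INR x + / 2) * t) - sin (t / 2) := cos_sum_kernel x t.
have F1 : PI * INR k' / INR q * INR q = PI * INR k' by field; lra.
have S1 : PI * INR k' / INR q / 4 <= sin (t / 2).
  have -> : sin (t / 2) = sin (PI * INR k' / INR q).
    rewrite /k' /minn; case: ltnP => _.
      by congr sin; rewrite /t; field; lra.
    rewrite minus_INR; last by apply/leP; exact: ltnW.
    rewrite -[RHS]sin_PI_x; congr sin; rewrite /t; field; lra.
  apply: sin_ge_quarter; split.
    by apply: Rdiv_le_0_compat => //; nra.
  have h : INR k' * 2 <= INR q.
    by rewrite -[2]/(INR 2) -mult_INR; apply: INR_leq; rewrite /k' /minn; case: ltnP; lia.
  nra.
have p3 : 3 <= PI by have := PI2_3_2; rewrite /PI2; lra.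
have [a1 a2] := SIN_bound ((INR x + / 2) * t); have [b1 b2] := SIN_bound (t / 2).
have s0 : 0 < sin (t / 2).
  apply: Rlt_le_trans S1; apply: Rdiv_lt_0_compat; last lra.
  by apply: Rdiv_lt_0_compat => //; nra.
have H : Rabs E * sin (t / 2) <= 1.
  rewrite -{1}(Rabs_right (sin (t / 2))); last lra.
  by rewrite -Rabs_mult; apply: Rabs_le; split; nra.
have H2 : Rabs E * (PI * INR k' / INR q / 4) <= 1.
  by apply: Rle_trans H; apply: Rmult_le_compat_l => //; exact: Rabs_pos.
have H3 : Rabs E * (PI * INR k') <= 4 * INR q.
  have -> : Rabs E * (PI * INR k') = Rabs E * (PI * INR k' / INR q / 4) * (4 * INR q) by field; lra.
  nra.
apply: (Rmult_le_reg_r (INR k')) => //; rewrite /Rdiv Rmult_assoc Rinv_l ?Rmult_1_r; last lra.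
have := Rabs_pos E; nra.
Qed.

End Cosines.

Section PrimeResonance.
Variables (q M x k0 J : nat) (l : seq nat) (r : nat -> R).
Hypotheses (r_ge0 : forall p, 0 <= r p) (lp : all prime l) (lu : uniq l).
Hypothesis lq : all (fun p => coprime p q) l.
Hypotheses (qp : prime q) (k00 : (0 < k0)%N) (Mq : (2 * M <= q)%N) (xq : (8 * (x * k0) <= q)%N)
  (MJ : (M < 2 ^ J)%N).
Notation rho := (rho r l).

Let q1 : (1 < q)%N := prime_gt1 qp.
Let q0 : (0 < q)%N := prime_gt0 qp.

Lemma M_lt_q : (M < q)%N.
Proof. by move: q1 Mq; lia. Qed.

Definition small_quotient m m2 := (m %| m2)%N && (m2 %/ m <= k0)%N.

(* Writing [k] for [m2 / m] modulo [q]: either [m * k = m2] over the integers and every cosine is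
   nonnegative, or [k] is at distance at least [q / (2 * M)] from the multiples of [q]. *)
Lemma kernel_lower m m2 : (0 < m <= M)%N -> (0 < m2 <= M)%N -> (m2 < 2 * k0 * m)%N ->
  (if small_quotient m m2 then INR x / 2 else 0) - 4 * INR M
  <= \sum_(1 <= n < x.+1) cosq q (n * (zinv q m * m2 %% q)).
Proof.
move=> /andP[m0 mM] /andP[m20 m2M] m2k.
have mq := leq_ltn_trans mM M_lt_q; have m2q := leq_ltn_trans m2M M_lt_q.
have cm : coprime m q by rewrite coprime_sym prime_coprime // gtnNdvd.
move: (mul_zinv q1 cm); move: (zinv q m) => z zm.
set k := (z * m2 %% q)%N.
have kq : (k < q)%N by rewrite ltn_mod.
have mk : (m * k %% q = m2)%N by rewrite /k modnMmr mulnA -modnMml zm mul1n modn_small.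
have kpos : (0 < k)%N by rewrite lt0n; apply/eqP => k_0; move: mk; rewrite k_0 muln0 mod0n => E; rewrite -E in m20.
have MR := pos_INR M; have xR := pos_INR x.
case: (eqVneq (m * k)%N m2) => [E|NE].
  have -> : small_quotient m m2 = (k <= k0)%N.
    by rewrite /small_quotient -E dvdn_mulr // mulKn.
  case: leqP => kk0.
    apply: (Rle_trans _ (\sum_(1 <= n < x.+1) / 2)).
      by rewrite sum_const count_predT size_iota subSS subn0; lra.
    rewrite big_nat_cond [X in _ <= X]big_nat_cond; apply: sum_le => n /andP[/andP[_ nx] _].
    apply: cosq_ge_half => //; apply: leq_trans xq; apply: leq_mul => //; exact: leq_mul.
  apply: (Rle_trans _ 0); first lra.
  rewrite big_nat_cond; apply: sum_ge0 => n /andP[/andP[_ nx] _].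
  apply: cosq_ge0 => //; apply: leq_trans xq.
  (* The range condition on [m2] enters here: with [8 * (x * k0) <= q] it keeps every angle in the
     first quadrant. *)
  have k2 : (k <= 2 * k0)%N by rewrite -(leq_pmul2l m0) E mulnC; exact: ltnW.
  have := leq_mul (nx : (n <= x)%N) k2; lia.
have -> : small_quotient m m2 = false.
  apply/negbTE; apply: contra NE; rewrite /small_quotient => /andP[/dvdnP[u E] _].
  have uq : (u < q)%N by apply: leq_ltn_trans m2q; rewrite E leq_pmulr.
  by rewrite /k E mulnCA [(z * m)%N]mulnC -modnMmr zm muln1 modn_small // mulnC eqxx.
have kq' : (0 < k < q)%N by rewrite kpos kq.
have := cosq_sum_bound q0 x kq'; set E := \sum_(1 <= n < x.+1) _.
set k' := minn k (q - k).
have k'0 : (0 < k')%N by rewrite leq_min kpos subn_gt0.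
have HkM : (q <= k' * (2 * M))%N.
  (* [m * k] is congruent to [m2] but different from it, hence at least [q]. Likewise
     [m * (q - k) + m2] is a positive multiple of [q], and [m2 <= M <= q / 2] leaves at least
     [q / 2] for its first term. *)
  have H1 : (q <= m * k)%N.
    rewrite leqNgt; apply: contra NE => H; by rewrite -mk modn_small.
  have H2 : (q <= m * (q - k) + m2)%N.
    apply: dvdn_leq; first by rewrite addn_gt0 m20 orbT.
    by rewrite -mk /dvdn modnDmr -mulnDr subnK ?(ltnW kq) // modnMl.
  have H3 : (m * k <= M * k)%N by rewrite leq_mul2r mM orbT.
  have H4 : (m * (q - k) <= M * (q - k))%N by rewrite leq_mul2r mM orbT.
  rewrite /k' /minn; case: ltnP => _; rewrite mulnCA [(_ * M)%N]mulnC.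
    by move: H1 H3; move: (m * k)%N (M * k)%N => X Y; lia.
  by move: H2 H4; move: (m * (q - k))%N (M * (q - k))%N => X Y; move: Mq m2M; lia.
have k'R := INR_gt0 k'0.
have HR : 2 * INR q / INR k' <= 4 * INR M.
  apply: (Rmult_le_reg_r (INR k')) => //; rewrite /Rdiv Rmult_assoc Rinv_l ?Rmult_1_r; last lra.
  by have := INR_leq HkM; rewrite !mult_INR /=; lra.
move=> HE; have := Rle_abs (- E); rewrite Rabs_Ropp; lra.
Qed.

Let f m := if (m <= M)%N then rho m else 0.

Lemma f_ge0 m : 0 <= f m.
Proof. by rewrite /f; case: ifP => _; [exact: rho_ge0|exact: Rle_refl]. Qed.

Lemma f_supp m : f m <> 0 -> (m <= M)%N /\ rho m <> 0.
Proof. by rewrite /f; case: ifP. Qed.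

Lemma f0 : f 0 = 0. Proof. by rewrite /f /= rho0. Qed.

Lemma sum_f_sqr (P : pred nat) :
  \sum_(0 <= m < M.+1) (if P m then f m else 0) ^ 2 <= \prod_(p <- l) (1 + r p ^ 2).
Proof.
apply: Rle_trans (sum_rho_sqr r M.+1 lp); rewrite big_nat_cond [X in _ <= X]big_nat_cond.
apply: sum_le => m /andP[/andP[_ mM] _]; rewrite /f -ltnS mM.
by case: (P m); [exact: Rle_refl|have := pow2_ge_0 (rho m); lra].
Qed.

(** The transform [b] may have square sum larger by a factor [q] than the weights, so
    [inverse_bilinear] is balanced with [t = sqrt q]; this produces [B * sqrt q]. The error [4 * M]
    of [kernel_lower], summed over all pairs, costs another factor [M.+1]. *)
Lemma dyadic_bound B i : 0 <= B -> charsum_bounded q x B ->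
  INR x / 2 * (\sum_(0 <= m < M.+1) (if (2 ^ i <= m < 2 ^ i.+1)%N then f m else 0) *
     \sum_(0 <= m2 < M.+1 | small_quotient m m2) f m2)
  <= (B * sqrt (INR q) + 4 * INR M * INR M.+1) * \prod_(p <- l) (1 + r p ^ 2).
Proof.
move=> B0 HB.
(* For [m] in [D] and [m2] in [E] one has [m2 < 2 * k0 * m], as [kernel_lower] requires, while every
   [m2] with an integral quotient at most [k0] does lie in [E]. *)
pose D m := (2 ^ i <= m < 2 ^ i.+1)%N; pose E m := (m < k0 * 2 ^ i.+1)%N.
pose f1 m := if D m then f m else 0; pose Q m := if E m then f m else 0.
pose b u := \sum_(0 <= m < M.+1) Q m * cosq q (u * m).
have f1_ge0 m : 0 <= f1 m by rewrite /f1; case: ifP => _; [exact: f_ge0|exact: Rle_refl].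
have Q_ge0 m : 0 <= Q m by rewrite /Q; case: ifP => _; [exact: f_ge0|exact: Rle_refl].
have f1_supp m : f1 m <> 0 -> (m <= M)%N /\ rho m <> 0 by rewrite /f1; case: ifP => // _; exact: f_supp.
have Q0 : Q 0%N = 0 by rewrite /Q f0; case: ifP.
have sq0 : 0 < sqrt (INR q) by apply: sqrt_lt_R0; exact: INR_gt0.
have sqq : sqrt (INR q) * sqrt (INR q) = INR q by apply: sqrt_sqrt; exact: pos_INR.
have H := inverse_bilinear q1 f1 b B0 sq0 HB.
set P := \prod_(p <- l) (1 + r p ^ 2).
have S1 : \sum_(0 <= m < q | coprime m q) f1 m ^ 2 <= P.
  rewrite (sum_coprime_support (M := M) (l := l) (r := r)) ?M_lt_q //; first exact: sum_f_sqr.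
  by move=> m Hm; apply: f1_supp => Z; apply: Hm; rewrite Z; ring.
have S2 : \sum_(0 <= m < q | coprime m q) b m ^ 2 <= INR q * P.
  apply: (Rle_trans _ (\sum_(0 <= m < q) b m ^ 2)).
    rewrite big_mkcond; apply: sum_le => m _; case: ifP => _; first exact: Rle_refl.
    exact: pow2_ge_0.
  apply: Rle_trans (sum_cosq_sqr q0 Q M_lt_q) _; apply: Rmult_le_compat_l; first exact: pos_INR.
  exact: sum_f_sqr.
(* The full sum of each cosine vanishes, so the trivial character contributes with a good sign. *)
have bsum : \sum_(0 <= m < q | coprime m q) b m <= 0.
  have -> : \sum_(0 <= m < q | coprime m q) b m = (\sum_(0 <= m < q) b m) - b 0%N.
    rewrite big_mkcond !(big_ltn q0) /= /coprime gcd0n (gtn_eqF q1).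
    rewrite (eq_big_nat _ _ (F2 := b)) => [|m /andP[m0 mq]]; first by ring.
    by rewrite -/(coprime m q) coprime_sym prime_coprime // gtnNdvd.
  have -> : \sum_(0 <= m < q) b m = 0.
    rewrite /b exchange_big /= big_nat_cond big1 // => m /andP[/andP[_ mM] _].
    rewrite -big_distrr /=; case: (posnP m) => [->|m0]; first by rewrite Q0; ring.
    have -> : \sum_(0 <= u < q) cosq q (u * m) = 0; last by ring.
    transitivity (Re (\big[Cplus/RtoC 0]_(0 <= u < q) expC q (u * m))); first by rewrite Re_sum.
    by rewrite sum_expC // gtnNdvd //; exact: leq_trans mM M_lt_q.
  have : 0 <= b 0%N.
    by apply: sum_ge0 => m _; rewrite mul0n /cosq Rmult_0_r /Rdiv Rmult_0_l cos_0; have := Q_ge0 m; lra.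
  by lra.
set A := \sum_(0 <= m < q | coprime m q) f1 m in H.
have A0 : 0 <= A by apply: sum_ge0.
set bs := \sum_(0 <= m < q | coprime m q) b m in H bsum.
set cnt := INR (count _ _) in H.
have cnt0 : 0 <= cnt by exact: pos_INR.
set T := \sum_(1 <= n < x.+1 | coprime n q) _ in H.
have P0 : 0 <= P.
  by apply: Rle_trans S1; apply: sum_ge0 => m _; exact: pow2_ge_0.
have HT : T <= B * sqrt (INR q) * P.
  have phi0 : 0 < INR (totient q) by apply: INR_gt0; rewrite totient_gt0.
  have h1 : cnt * A * bs / INR (totient q) <= 0.
    have : 0 <= cnt * A * (- bs) / INR (totient q).
      by apply: Rdiv_le_0_compat => //; apply: Rmult_le_pos; [exact: Rmult_le_pos|lra].
    by rewrite /Rdiv; lra.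
  have h2 := Rle_trans _ _ _ (Rle_abs _) H.
  have h3 : (\sum_(0 <= m < q | coprime m q) b m ^ 2) / sqrt (INR q) <= sqrt (INR q) * P.
    apply: (Rmult_le_reg_r (sqrt (INR q))) => //; rewrite /Rdiv Rmult_assoc Rinv_l; last lra.
    by rewrite Rmult_1_r; apply: Rle_trans S2 _; rewrite -{1}sqq; apply: Req_le; ring.
  have h4 : sqrt (INR q) * (\sum_(0 <= m < q | coprime m q) f1 m ^ 2) <= sqrt (INR q) * P.
    by apply: Rmult_le_compat_l S1; lra.
  have h5 : B / 2 * (sqrt (INR q) * (\sum_(0 <= m < q | coprime m q) f1 m ^ 2) +
     (\sum_(0 <= m < q | coprime m q) b m ^ 2) / sqrt (INR q)) <= B / 2 * (2 * (sqrt (INR q) * P)).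
    by apply: Rmult_le_compat_l; lra.
  lra.
have f1E m : f1 m <> 0 -> (0 < m <= M)%N /\ D m.
  rewrite /f1; case: ifP => // Dm /f_supp[mM _]; split=> //; rewrite mM andbT.
  by move: Dm => /andP[+ _]; apply: leq_trans; rewrite expn_gt0.
have TE : T = \sum_(0 <= m < M.+1) f1 m * \sum_(0 <= m2 < M.+1) Q m2 *
     \sum_(1 <= n < x.+1) cosq q (n * (zinv q m * m2 %% q)).
  have -> : T = \sum_(1 <= n < x.+1) \sum_(0 <= m < M.+1) f1 m * b (n * zinv q m %% q)%N.
    rewrite /T big_mkcond /=; apply: eq_big_nat => n /andP[n0 nx].
    have nq : (n < q)%N by move: xq k00 nx q1; nia.
    have -> : coprime n q by rewrite coprime_sym prime_coprime // gtnNdvd.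
    rewrite (sum_coprime_support (M := M) (l := l) (r := r)) ?M_lt_q // => m Hm.
    by apply: f1_supp => Z; apply: Hm; rewrite Z; ring.
  rewrite exchange_big /=; apply: eq_bigr => m _; rewrite -big_distrr /=; congr (_ * _).
  rewrite /b exchange_big /=; apply: eq_bigr => m2 _; rewrite -big_distrr /=; congr (_ * _).
  apply: eq_bigr => n _; rewrite -(cosq_mod q0) modnMml -mulnA.
  by rewrite -[RHS](cosq_mod q0) modnMmr.
have TL : INR x / 2 * (\sum_(0 <= m < M.+1) f1 m * \sum_(0 <= m2 < M.+1 | small_quotient m m2) f m2)
    - 4 * INR M * ((\sum_(0 <= m < M.+1) f1 m) * (\sum_(0 <= m2 < M.+1) Q m2)) <= T.
  have -> : INR x / 2 * (\sum_(0 <= m < M.+1) f1 m * \sum_(0 <= m2 < M.+1 | small_quotient m m2) f m2)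
    - 4 * INR M * ((\sum_(0 <= m < M.+1) f1 m) * (\sum_(0 <= m2 < M.+1) Q m2)) =
    \sum_(0 <= m < M.+1) (INR x / 2 * (f1 m * \sum_(0 <= m2 < M.+1 | small_quotient m m2) f m2)
       + - (4 * INR M * (f1 m * \sum_(0 <= m2 < M.+1) Q m2))).
    by rewrite big_split /= -big_distrr sum_opp -big_distrr -big_distrl /Rminus.
  rewrite TE; apply: sum_le => m _.
  case: (Req_dec (f1 m) 0) => [->|Hm]; first by lra.
  have [m0M Dm] := f1E m Hm.
  have -> : INR x / 2 * (f1 m * \sum_(0 <= m2 < M.+1 | small_quotient m m2) f m2)
       + - (4 * INR M * (f1 m * \sum_(0 <= m2 < M.+1) Q m2)) =
     f1 m * (INR x / 2 * (\sum_(0 <= m2 < M.+1 | small_quotient m m2) f m2)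
       + - (4 * INR M * \sum_(0 <= m2 < M.+1) Q m2)) by ring.
  apply: Rmult_le_compat_l => //.
  have -> : INR x / 2 * (\sum_(0 <= m2 < M.+1 | small_quotient m m2) f m2)
       + - (4 * INR M * \sum_(0 <= m2 < M.+1) Q m2) =
     \sum_(0 <= m2 < M.+1) (INR x / 2 * (if small_quotient m m2 then f m2 else 0) + - (4 * INR M * Q m2)).
    by rewrite [X in INR x / 2 * X]big_mkcond big_split /= sum_opp -!big_distrr.
  rewrite big_nat_cond [X in _ <= X]big_nat_cond; apply: sum_le => m2 /andP[/andP[_ m2M] _].
  have EQ : small_quotient m m2 -> E m2.
    move=> /andP[/dvdnP[u ->] h]; rewrite mulnK in h; last by case/andP: m0M.
    rewrite /E; move: Dm => /andP[_ Dm]; apply: leq_ltn_trans (_ : (k0 * m < _)%N).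
      by rewrite leq_mul2r h orbT.
    by rewrite ltn_mul2l k00.
  have -> : (if small_quotient m m2 then f m2 else 0) = Q m2 * (if small_quotient m m2 then 1 else 0).
    rewrite /Q; case: ifP => [/EQ ->|_]; ring.
  case: (Req_dec (Q m2) 0) => [->|HQ]; first by lra.
  have m20 : (0 < m2 <= M)%N.
    by apply/andP; split=> //; rewrite lt0n; apply/eqP => Z; apply: HQ; rewrite Z.
  have Em2 : (m2 < 2 * k0 * m)%N.
    have : E m2 by move: HQ; rewrite /Q; case: ifP.
    rewrite /E => h; apply: leq_trans h _; rewrite expnS mulnCA -mulnA.
    by apply: leq_mul => //; apply: leq_mul => //; case/andP: Dm.
  have := kernel_lower m0M m20 Em2; have := Q_ge0 m2.
  by case: ifP => _ ? ?; nra.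
have AM : (\sum_(0 <= m < M.+1) f1 m) * (\sum_(0 <= m2 < M.+1) Q m2) <= INR M.+1 * P.
  apply: Rle_trans (sum_mul_le _ f1 Q) _; rewrite size_iota subn0.
  have h1 : \sum_(0 <= m < M.+1) f1 m ^ 2 <= P := sum_f_sqr D.
  have h2 : \sum_(0 <= m < M.+1) Q m ^ 2 <= P := sum_f_sqr E.
  have h3 : INR M.+1 * ((\sum_(0 <= m < M.+1) f1 m ^ 2) + (\sum_(0 <= m2 < M.+1) Q m2 ^ 2)) <= INR M.+1 * (P + P).
    by apply: Rmult_le_compat_l; [exact: pos_INR|lra].
  lra.
have M0 := pos_INR M.
have : 4 * INR M * ((\sum_(0 <= m < M.+1) f1 m) * (\sum_(0 <= m2 < M.+1) Q m2)) <= 4 * INR M * (INR M.+1 * P).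
  by apply: Rmult_le_compat_l; lra.
move=> h; apply: (Rle_trans _ (INR x / 2 *
    (\sum_(0 <= m < M.+1) f1 m * \sum_(0 <= m2 < M.+1 | small_quotient m m2) f m2))); last lra.
exact: Rle_refl.
Qed.

(* Restricting the two copies of the resonator to matching ranges [2 ^ i, 2 ^ i.+1) and
   below [k0 * 2 ^ i.+1] bounds all integer quotients that occur; summing over [i] loses only [J]. *)
Lemma resonance_prime a b B : 0 <= B -> charsum_bounded q x B ->
  (forall u, (0 < u)%N -> ln (INR u) <= a -> (u <= k0)%N) ->
  (forall m, (0 < m)%N -> ln (INR m) <= b -> (m <= M)%N) ->
  INR x / 2 * conf r l (window a b) <=
  INR J * ((B * sqrt (INR q) + 4 * INR M * INR M.+1) * \prod_(p <- l) (1 + r p ^ 2)).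
Proof.
move=> B0 HB Ha Hb.
set P := \prod_(p <- l) _; set c := _ * P.
apply: (Rle_trans _ (\sum_(0 <= i < J) c)); last first.
  by rewrite sum_const count_predT size_iota subn0; exact: Rle_refl.
pose X m := \sum_(0 <= m2 < M.+1 | small_quotient m m2) f m2.
apply: (Rle_trans _ (\sum_(0 <= i < J) INR x / 2 *
   (\sum_(0 <= m < M.+1) (if (2 ^ i <= m < 2 ^ i.+1)%N then f m else 0) * X m))); last first.
  by apply: sum_le => i _; exact: dyadic_bound.
rewrite -big_distrr /=; apply: Rmult_le_compat_l.
  by apply: Rdiv_le_0_compat; [exact: pos_INR|lra].
have X0 m : 0 <= X m by apply: sum_ge0 => m2 _; exact: f_ge0.
apply: Rle_trans (conf_window_le r_ge0 lp lu lq Ha Hb) _.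
rewrite exchange_big /= big_nat_cond [X in _ <= X]big_nat_cond.
apply: sum_le => m /andP[/andP[_ mM] _]; rewrite ltnS in mM.
have Y0 j : 0 <= (if (2 ^ j <= m < 2 ^ j.+1)%N then f m else 0) * X m.
  by apply: Rmult_le_pos => //; case: ifP => _; [exact: f_ge0|exact: Rle_refl].
case: (posnP m) => [m0|m0].
  apply: (Rle_trans _ 0).
    by apply: Req_le; apply: big1 => u _; rewrite m0 rho0; ring.
  by apply: sum_ge0 => i _; exact: Y0.
pose i := trunc_log 2 m.
have iJ : (i < J)%N.
  by rewrite -(ltn_exp2l _ _ (ltnSn 1)); apply: leq_ltn_trans MJ; apply: leq_trans mM; exact: trunc_logP.
have Di : (2 ^ i <= m < 2 ^ i.+1)%N by rewrite trunc_logP // trunc_log_ltn.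
apply: (Rle_trans _ (rho m * X m)); last first.
  rewrite big_mkord (bigD1 (Ordinal iJ)) //= Di.
  have -> : f m = rho m by rewrite /f mM.
  rewrite -[X in X <= _]Rplus_0_r; apply: Rplus_le_compat_l; apply: sum_ge0 => j _.
  by have := Y0 j; rewrite /f mM.
rewrite -big_distrr /=; apply: Rmult_le_compat_l; first exact: rho_ge0.
apply: (Rle_trans _ (\sum_(0 <= u < k0.+1) f (m * u)%N)).
  rewrite big_mkcond; apply: sum_le => u _; case: ifP => [/and3P[_ _ h]|_]; last exact: f_ge0.
  by rewrite /f h; exact: Rle_refl.
rewrite -(sum_multiples _ _ m0) /X.
apply: (Rle_trans _ (\sum_(0 <= m2 < m * k0.+1) if small_quotient m m2 then f m2 else 0)).
  rewrite big_mkcond big_nat_cond [X in _ <= X]big_nat_cond; apply: sum_le => m2 /andP[/andP[_ h] _].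
  rewrite /small_quotient; case: ifP => md /=; last exact: Rle_refl.
  by rewrite -ltnS ltn_divLR // mulnC h; exact: Rle_refl.
apply: Rle_trans (sum_support (K := M.+1) (P := small_quotient m) _ _ _) _ => [m2|m2|].
- by case: ifP => _; [exact: f_ge0|exact: Rle_refl].
- by case: ifP => // _ /f_supp[+ _]; rewrite ltnS => ->.
by apply: sum_le => m2 ->; exact: Rle_refl.
Qed.

End PrimeResonance.
End PrimeModulus.

(** * Partial summation over the primes coprime to [q] *)

Module Analytic.
Import all_boot Sums PrimeSums.
Set Implicit Arguments. Unset Strict Implicit. Unset Printing Implicit Defensive.
Open Scope R_scope.

Lemma ln_INR_succ n : (0 < n)%N -> 0 <= ln (INR n.+1) - ln (INR n) <= 1.
Proof.
move=> n0; have nR := INR_gt0 n0; have n1 : 1 <= INR n by apply: (INR_leq (m := 1)).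
split; first by have := ln_mono nR (INR_leq (leqnSn n)); lra.
have -> : INR n.+1 = INR n * (1 + / INR n) by rewrite S_INR; field; lra.
have i0 : 0 < / INR n by apply: Rinv_0_lt_compat.
have i1 : / INR n <= 1 by rewrite -Rinv_1; apply: Rinv_le_contravar; lra.
by rewrite ln_mult //; [have := @ln_le_sub1 (1 + / INR n) |]; lra.
Qed.

(* [phi n] and [Phi n] stand for the values at [ln n] of a decreasing function and its primitive. *)
Lemma partial_summation (w phi Phi : nat -> R) (c : R) (Y Z : nat) : (0 < Y <= Z)%N -> 0 <= c ->
  (forall n, (Y <= n)%N -> Rabs (\sum_(Y.+1 <= p < n.+1) w p - (ln (INR n) - ln (INR Y))) <= c) ->
  (forall n, (Y <= n)%N -> 0 <= phi n.+1 <= phi n) ->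
  (forall n, (Y <= n)%N -> phi n.+1 * (ln (INR n.+1) - ln (INR n)) <= Phi n.+1 - Phi n
                         <= phi n * (ln (INR n.+1) - ln (INR n))) ->
  - (c + 1) * phi Y <= \sum_(Y.+1 <= p < Z.+1) w p * phi p - (Phi Z - Phi Y) <= c * phi Y.
Proof.
move=> /andP[Y0 YZ] c0 Hw Hphi HPhi.
pose D n := \sum_(Y.+1 <= p < n.+1) w p - (ln (INR n) - ln (INR Y)).
have DY : D Y = 0 by rewrite /D big_geq //; lra.
(* Abel summation as an invariant: a boundary term [D n * phi n] and a multiple of the total
   variation of [phi]. The extra 1 in the lower bound pays for comparing [phi n.+1] with the
   increment of [Phi], as steps of the logarithm are at most 1. *)
have key n : (Y <= n)%N -> 0 <= phi n /\
  D n * phi n - (c + 1) * (phi Y - phi n) <= \sum_(Y.+1 <= p < n.+1) w p * phi p - (Phi n - Phi Y)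
    <= D n * phi n + c * (phi Y - phi n).
  elim: n => [|n IH].
    by rewrite leqn0 => /eqP YE; rewrite YE in Y0.
  rewrite leq_eqVlt => /orP[/eqP <-|Yn].
    by rewrite DY big_geq //; have := Hphi Y (leqnn Y); lra.
  rewrite ltnS in Yn.
  have [pn [IH1 IH2]] := IH Yn; have [p1 p2] := Hphi n Yn; have [h1 h2] := HPhi n Yn.
  have [d0 d1] := ln_INR_succ (leq_trans Y0 Yn).
  split=> //.
  have S F : \sum_(Y.+1 <= p < n.+2) F p = \sum_(Y.+1 <= p < n.+1) F p + F n.+1.
    by rewrite big_nat_recr.
  have DS : w n.+1 = D n.+1 - D n + (ln (INR n.+1) - ln (INR n)).
    by rewrite /D S; ring.
  rewrite S DS; set d := ln (INR n.+1) - ln (INR n) in h1 h2 d0 d1 *.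
  have B := Hw n Yn; have /Rabs_le_between [B1 B2] := B; rewrite -/(D n) in B1 B2.
  by split; nra.
have [p0 [k1 k2]] := key Z YZ.
have /Rabs_le_between [B1 B2] := Hw Z YZ; rewrite -/(D Z) in B1 B2.
have mono n : (Y <= n)%N -> phi n <= phi Y.
  elim: n => [|n IH]; first by rewrite leqn0 => /eqP YE; rewrite YE in Y0.
  rewrite leq_eqVlt => /orP[/eqP <-|Yn]; first exact: Rle_refl.
  rewrite ltnS in Yn.
  by have := IH Yn; have := Hphi n Yn; lra.
have := mono Z YZ; split; nra.
Qed.

Lemma increment_bounds (F f : R -> R) (u v : R) : u <= v ->
  (forall x, u <= x <= v -> is_derive F x (f x)) ->
  (forall x, u <= x <= v -> f v <= f x <= f u) ->
  f v * (v - u) <= F v - F u <= f u * (v - u).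
Proof.
move=> uv HF Hf.
have [||c [Hc ->]] := MVT_gen F u v f.
- by move=> x; rewrite Rmin_left // Rmax_right // => Hx; apply: HF; lra.
- move=> x; rewrite Rmin_left // Rmax_right // => Hx; apply/continuity_pt_filterlim.
  by apply: ex_derive_continuous; exists (f x); apply: HF.
rewrite Rmin_left // Rmax_right // in Hc.
by have [h1 h2] := Hf c Hc; split; apply: Rmult_le_compat_r; lra.
Qed.

Definition plist (q Y Z : nat) := [seq p <- index_iota Y.+1 Z.+1 | prime p && coprime p q].

Lemma plist_prime q Y Z : all prime (plist q Y Z).
Proof. by apply/allP => p; rewrite mem_filter => /andP[/andP[]]. Qed.

Lemma plist_coprime q Y Z : all (fun p => coprime p q) (plist q Y Z).
Proof. by apply/allP => p; rewrite mem_filter => /andP[/andP[]]. Qed.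

Lemma plist_uniq q Y Z : uniq (plist q Y Z).
Proof. by rewrite filter_uniq // iota_uniq. Qed.

Lemma plist_range q Y Z p : p \in plist q Y Z -> (Y < p <= Z)%N.
Proof. by rewrite mem_filter mem_index_iota ltnS => /andP[_]. Qed.

Definition pweight (q p : nat) : R := if prime p && coprime p q then ln (INR p) / INR p else 0.

Lemma sum_plist q Y Z (F : nat -> R) :
  \sum_(p <- plist q Y Z) ln (INR p) / INR p * F p = \sum_(Y.+1 <= p < Z.+1) pweight q p * F p.
Proof.
rewrite big_filter big_mkcond; apply: eq_bigr => p _; rewrite /pweight.
by case: ifP => _ //; ring.
Qed.

(** Here 7 is 3 + 3 + 1: Mertens at both ends, and at most [ln q / Y <= 1] from the primes above [Y]
    that divide [q]. *)
Lemma mertens_coprime q Y n : (0 < q)%N -> (0 < Y <= n)%N -> ln (INR q) <= INR Y ->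
  Rabs (\sum_(Y.+1 <= p < n.+1) pweight q p - (ln (INR n) - ln (INR Y))) <= 7.
Proof.
move=> q0 /andP[Y0 Yn] qY; have YR := INR_gt0 Y0.
have n0 := leq_trans Y0 Yn.
have mn := mertens n0; have mY := mertens Y0.
have E : \sum_(0 <= p < n.+1 | prime p) ln (INR p) / INR p =
  \sum_(0 <= p < Y.+1 | prime p) ln (INR p) / INR p
  + (\sum_(Y.+1 <= p < n.+1) pweight q p
     + \sum_(Y.+1 <= p < n.+1 | prime p && ~~ coprime p q) ln (INR p) / INR p).
  rewrite [LHS](big_cat_nat _ (n := Y.+1)) //=; congr (_ + _).
  rewrite (bigID (fun p => coprime p q)) /=; congr (_ + _).
  by rewrite big_mkcond; apply: eq_bigr => p _.
set b := \sum_(Y.+1 <= p < n.+1 | prime p && ~~ coprime p q) _ in E.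
have pos p : 0 <= ln (INR p) / INR p.
  case: p => [|p]; first by rewrite /Rdiv /= Rinv_0 Rmult_0_r; lra.
  by apply: Rdiv_le_0_compat; [exact: ln_INR_ge0|exact: INR_gt0].
have b0 : 0 <= b by apply: sum_ge0.
have b1 : b <= 1.
  apply: (Rle_trans _ (/ INR Y * ln (INR q))); last first.
    apply: (Rmult_le_reg_l (INR Y)) => //; rewrite -Rmult_assoc Rinv_r; lra.
  apply: Rle_trans (Rmult_le_compat_l _ _ _ _ (sum_ln_prime_divisors n.+1 q0)); last first.
    by apply: Rlt_le; apply: Rinv_0_lt_compat.
  rewrite big_distrr /=.
  apply: (Rle_trans _ (\sum_(Y.+1 <= p < n.+1 | prime p && (p %| q)%N) / INR Y * ln (INR p))).
    rewrite /b (eq_bigl (fun p => prime p && (p %| q)%N)) => [|p]; last first.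
      by case pp: (prime p) => //=; rewrite prime_coprime // negbK.
    rewrite big_nat_cond [X in _ <= X]big_nat_cond; apply: sum_le => p /andP[/andP[Yp _] _].
    rewrite Rmult_comm /Rdiv; apply: Rmult_le_compat_l; first exact: ln_INR_ge0.
    by apply: Rinv_le_contravar => //; apply: INR_leq; exact: ltnW.
  rewrite [X in _ <= X](big_cat_nat _ (n := Y.+1)) //=.
  rewrite -[X in X <= _]Rplus_0_l; apply: Rplus_le_compat_r; apply: sum_ge0 => p _.
  by apply: Rmult_le_pos; [apply: Rlt_le; exact: Rinv_0_lt_compat|exact: ln_INR_ge0].
by move: mn mY; rewrite E => /Rabs_le_between ? /Rabs_le_between ?; apply: Rabs_le; lra.
Qed.

Section PrimePowerSums.
Variables (q Y Z : nat).
Hypotheses (q0 : (0 < q)%N) (Y2 : (2 <= Y)%N) (YZ : (Y <= Z)%N) (qY : ln (INR q) <= INR Y).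

(** In the variable [ln p] the weights [ln p / p] have density 1 up to a bounded discrepancy, so
    sums become integrals up to a multiple of the first value of [f]. *)
Lemma sum_plist_bounds (F f : R -> R) :
  (forall x, ln (INR Y) <= x -> is_derive F x (f x)) ->
  (forall x y, ln (INR Y) <= x <= y -> 0 <= f y <= f x) ->
  - 8 * f (ln (INR Y)) <= \sum_(p <- plist q Y Z) ln (INR p) / INR p * f (ln (INR p))
       - (F (ln (INR Z)) - F (ln (INR Y))) <= 7 * f (ln (INR Y)).
Proof.
move=> HF Hf; rewrite sum_plist.
have Y0 : (0 < Y)%N by exact: leq_trans Y2.
have lnY n : (Y <= n)%N -> ln (INR Y) <= ln (INR n) <= ln (INR n.+1).
  move=> Yn; split; first by apply: ln_mono (INR_leq Yn); exact: INR_gt0.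
  by apply: ln_mono (INR_leq (leqnSn n)); exact: INR_gt0 (leq_trans Y0 Yn).
have -> : - 8 = - (7 + 1) by ring.
apply: (@partial_summation (pweight q) (fun n => f (ln (INR n))) (fun n => F (ln (INR n))) 7 Y Z).
- by rewrite Y0.
- lra.
- by move=> n Yn; apply: mertens_coprime => //; rewrite Y0.
- by move=> n /lnY H; apply: Hf.
move=> n /lnY [h1 h2]; apply: increment_bounds => // x Hx; first by apply: HF; lra.
have H1 : ln (INR Y) <= ln (INR n) <= x by lra.
have H2 : ln (INR Y) <= x <= ln (INR n.+1) by lra.
by have := Hf _ _ H1; have := Hf _ _ H2; lra.
Qed.

Lemma lnY_gt0 : 0 < ln (INR Y).
Proof.
rewrite -ln_1; apply: ln_increasing; first lra.
by apply: (lt_INR 1); apply/ltP; exact: Y2.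
Qed.

Lemma sum_inv_sqr :
  / ln (INR Y) - / ln (INR Z) - 8 / ln (INR Y) ^ 2
  <= \sum_(p <- plist q Y Z) ln (INR p) / INR p * (/ ln (INR p) ^ 2)
  <= / ln (INR Y) + 7 / ln (INR Y) ^ 2.
Proof.
have l0 := lnY_gt0.
have lZ : ln (INR Y) <= ln (INR Z) by apply: ln_mono (INR_leq YZ); exact: INR_gt0 (leq_trans _ Y2).
have [||H1 H2] := @sum_plist_bounds (fun x => - / x) (fun x => / x ^ 2).
- move=> x Hx; auto_derive; first lra.
  by field; lra.
- move=> x y Hxy; split; first by apply: Rlt_le; apply: Rinv_0_lt_compat; nra.
  by apply: Rinv_le_contravar; nra.
have : 0 < / ln (INR Z) by apply: Rinv_0_lt_compat; lra.
by move: H1 H2; rewrite /Rdiv; lra.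
Qed.

(** The factor [1 + alpha * x] makes the integrand exact: [- exp (- alpha * x) / x] is a primitive.
    This is the origin of the clean [exp (- A)] in the gain. *)
Lemma sum_tilted_gain alpha : 0 <= alpha ->
  exp (- alpha * ln (INR Y)) * (/ ln (INR Y) - / ln (INR Z)
     - 8 * (1 + alpha * ln (INR Y)) / ln (INR Y) ^ 2)
  <= \sum_(p <- plist q Y Z) ln (INR p) / INR p *
       (exp (- alpha * ln (INR p)) * (1 + alpha * ln (INR p)) / ln (INR p) ^ 2).
Proof.
move=> a0; have l0 := lnY_gt0.
have lZ : ln (INR Y) <= ln (INR Z) by apply: ln_mono (INR_leq YZ); exact: INR_gt0 (leq_trans _ Y2).
have [||H1 _] := @sum_plist_bounds (fun x => - (exp (- alpha * x) / x))
   (fun x => exp (- alpha * x) * (1 + alpha * x) / x ^ 2).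
- move=> x Hx; auto_derive; first lra.
  by field; lra.
- move=> x y [Hx Hxy]; have ey := exp_pos (- alpha * y).
  have ax : 0 <= alpha * x by nra.
  have ay : 0 <= alpha * y by nra.
  split; first by apply: Rdiv_le_0_compat; nra.
  apply: Rmult_le_compat; first by nra.
  + by apply: Rlt_le; apply: Rinv_0_lt_compat; nra.
  + have -> : exp (- alpha * x) = exp (- alpha * y) * exp (alpha * (y - x)).
      by rewrite -exp_plus; congr exp; ring.
    (* Monotonicity of the numerator: [1 + alpha * y] is at most
       [(1 + alpha * (y - x)) * (1 + alpha * x)]. *)
    have e1 := exp_ineq1_le (alpha * (y - x)).
    rewrite Rmult_assoc; apply: Rmult_le_compat_l; first lra.
    have e2 : (1 + alpha * (y - x)) * (1 + alpha * x) <= exp (alpha * (y - x)) * (1 + alpha * x).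
      by apply: Rmult_le_compat_r; lra.
    have e3 : 0 <= (alpha * x) * (alpha * (y - x)) by apply: Rmult_le_pos; nra.
    by apply: Rle_trans e2; apply: Rminus_le; move: e3; lra.
  by apply: Rinv_le_contravar; nra.
have E : exp (- alpha * ln (INR Z)) / ln (INR Z) <= exp (- alpha * ln (INR Y)) / ln (INR Z).
  apply: Rmult_le_compat_r; first by apply: Rlt_le; apply: Rinv_0_lt_compat; lra.
  by apply: exp_mono; nra.
by move: H1 E; rewrite /Rdiv; lra.
Qed.

(** The substitution [x |-> alpha * x] removes [alpha] from the integrand. The improper integral
    enters only through a primitive [E] and a bound [s] for its increment. *)
Lemma sum_tilted_mean alpha (E : R -> R) (s : R) : 0 < alpha ->
  (forall x, alpha * ln (INR Y) <= x -> is_derive E x (exp (- x) / x)) ->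
  E (alpha * ln (INR Z)) - E (alpha * ln (INR Y)) <= s ->
  \sum_(p <- plist q Y Z) ln (INR p) / INR p * (exp (- alpha * ln (INR p)) / ln (INR p))
  <= s + 7 * exp (- alpha * ln (INR Y)) / ln (INR Y).
Proof.
move=> a0 HE Hs; have l0 := lnY_gt0.
have [||_ H2] := @sum_plist_bounds (fun x => E (alpha * x)) (fun x => exp (- alpha * x) / x).
- move=> x Hx.
  have D : is_derive (fun y => alpha * y) x alpha by auto_derive; [|ring].
  have := is_derive_comp E (fun y => alpha * y) x _ _ (HE (alpha * x) _) D.
  rewrite /scal /= /mult /= => H.
  have -> : exp (- alpha * x) / x = alpha * (exp (- (alpha * x)) / (alpha * x)).
    have -> : - alpha * x = - (alpha * x) by ring.
    by field; lra.
  by apply: H; nra.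
- move=> x y [Hx Hxy]; split.
    by apply: Rdiv_le_0_compat; [exact: Rlt_le (exp_pos _)|lra].
  apply: Rmult_le_compat; first exact: Rlt_le (exp_pos _).
  + by apply: Rlt_le; apply: Rinv_0_lt_compat; lra.
  + by apply: exp_mono; nra.
  by apply: Rinv_le_contravar; lra.
by move: H2; rewrite /Rdiv; lra.
Qed.

End PrimePowerSums.
End Analytic.

(** * The resonator inequality with explicit error terms *)

Module Core.
Import all_boot Sums PrimeSums Resonator Analytic.
Set Implicit Arguments. Unset Strict Implicit. Unset Printing Implicit Defensive.
Open Scope R_scope.

(* This is [lam / (sqrt p * ln p)]; it vanishes at [p = 0] and [p = 1], where [/ 0 = 0] is used. *)
Definition rweight (lam : R) (p : nat) : R := lam * exp (- (ln (INR p) / 2)) / ln (INR p).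

Lemma inv_ge0 x : 0 <= x -> 0 <= / x.
Proof.
by case/Rle_lt_or_eq_dec => [H|<-]; [exact: Rlt_le (Rinv_0_lt_compat _ H)|rewrite Rinv_0; exact: Rle_refl].
Qed.

Lemma rweight_ge0 lam p : 0 <= lam -> 0 <= rweight lam p.
Proof.
move=> l0; apply: Rmult_le_pos; last by apply: inv_ge0; exact: ln_INR_ge0.
by apply: Rmult_le_pos => //; exact: Rlt_le (exp_pos _).
Qed.

Lemma sum_le_in (s : seq nat) (F G : nat -> R) : (forall p, p \in s -> F p <= G p) ->
  \sum_(p <- s) F p <= \sum_(p <- s) G p.
Proof. by move=> H; rewrite big_seq [X in _ <= X]big_seq; exact: sum_le. Qed.

Section CoreInequality.
Variables (q Y b : nat) (lam : R).
Hypotheses (q0 : (0 < q)%N) (b0 : (0 < b)%N) (lam0 : 0 < lam) (lamY : lam ^ 2 <= INR Y).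
Hypotheses (lnY1 : 1 <= ln (INR Y)) (qY : ln (INR q) <= INR Y).

Let Z := (Y ^ (2 * b))%N.
Let l := plist q Y Z.
Let r := rweight lam.
(** An upper bound for every local factor [den], hence the price for exchanging [tilt] and [prob];
    it tends to 1. *)
Let dd := 1 + 2 / ln (INR Y).
Notation u p := (ln (INR p)).

Lemma Y_ge2 : (2 <= Y)%N.
Proof.
case: Y lnY1 => [|[|n]] //= H; last by rewrite ln_1 in H; lra.
by move: H; rewrite /ln; case: Rlt_dec => [h|_]; [case: (Rlt_irrefl 0)|lra].
Qed.

Lemma Y_gt0 : (0 < Y)%N. Proof. exact: ltnW Y_ge2. Qed.

Lemma lnYX k : ln (INR (Y ^ k)%N) = INR k * u Y.
Proof. by rewrite ln_expn // Y_gt0. Qed.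

Lemma YZ_leq : (Y <= Z)%N.
Proof. by rewrite /Z -{1}(expn1 Y) leq_pexp2l ?Y_gt0 // muln_gt0 b0. Qed.

Lemma lnZ : u Z = 2 * INR b * u Y.
Proof. by rewrite /Z lnYX mult_INR. Qed.

Lemma l_range p : p \in l -> [/\ (0 < p)%N, u Y <= u p & u p <= u Z].
Proof.
move=> /plist_range /andP[Yp pZ]; have p0 := leq_ltn_trans (leq0n _) Yp.
split=> //; apply: ln_mono; try exact: INR_gt0; last exact: INR_leq.
  exact: INR_gt0 Y_gt0.
by apply: INR_leq; exact: ltnW.
Qed.

Lemma exp_ln_inv p : (0 < p)%N -> exp (- u p) = / INR p.
Proof. by move=> p0; rewrite exp_Ropp exp_ln //; exact: INR_gt0. Qed.

(** This is where the primes have to start beyond [lam ^ 2]: there [lam / sqrt p <= 1]. *)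
Lemma r_small p : p \in l -> r p <= / u p.
Proof.
move=> pl; have [p0 h1 h2] := l_range pl.
have pR := INR_gt0 p0.
have Yp : INR Y <= INR p by apply: INR_leq; case/andP: (plist_range pl) => /ltnW.
suff H : lam * exp (- (u p / 2)) <= 1.
  rewrite /r /rweight /Rdiv -[X in _ <= X]Rmult_1_l; apply: Rmult_le_compat_r => //.
  by apply: inv_ge0; lra.
have e0 := exp_pos (- (u p / 2)).
have E : exp (- (u p / 2)) * exp (- (u p / 2)) = / INR p.
  by rewrite -exp_plus -exp_ln_inv //; congr exp; field.
have F : INR p * / INR p = 1 by field; lra.
case: (Rle_lt_dec (lam * exp (- (u p / 2))) 1) => // H.
have i0 : 0 < / INR p by apply: Rinv_0_lt_compat.
have : lam ^ 2 * / INR p <= 1 by nra.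
rewrite -E; nra.
Qed.

Lemma tiltE alpha p : p \in l ->
  tilt r (/ 2 + alpha) p = lam / INR p * exp (- alpha * u p) / u p.
Proof.
move=> pl; have [p0 h1 h2] := l_range pl.
have -> : lam / INR p = lam * exp (- u p) by rewrite exp_ln_inv.
rewrite /tilt /r /rweight.
have -> : exp (- (/ 2 + alpha) * u p) = exp (- (u p / 2)) * exp (- alpha * u p).
  by rewrite -exp_plus; congr exp; field.
have -> : exp (- u p) = exp (- (u p / 2)) * exp (- (u p / 2)).
  by rewrite -exp_plus; congr exp; field.
by field; lra.
Qed.

Lemma r_sqrE p : p \in l -> r p ^ 2 * u p = lam ^ 2 * (u p / INR p * (/ u p ^ 2)).
Proof.
move=> pl; have [p0 h1 h2] := l_range pl; have pR := INR_gt0 p0.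
have -> : u p / INR p * / u p ^ 2 = exp (- u p) * (u p * / u p ^ 2) by rewrite exp_ln_inv //; field; lra.
have -> : exp (- u p) = exp (- (u p / 2)) * exp (- (u p / 2)).
  by rewrite -exp_plus; congr exp; field.
by rewrite /r /rweight; field; lra.
Qed.

Lemma dd_ge1 : 1 <= dd.
Proof.
rewrite /dd; have : 0 <= 2 / u Y by apply: Rdiv_le_0_compat; lra.
lra.
Qed.

Section Tilted.
Variable alpha : R.
Hypothesis alpha_ge : - / 2 <= alpha.
Notation sg := (/ 2 + alpha).
Notation tl := (tilt r sg).
Notation pr := (prob r sg).

Lemma r_ge0 p : 0 <= r p. Proof. by apply: rweight_ge0; lra. Qed.

Lemma den_le p : p \in l -> den r sg p <= dd.
Proof.
move=> pl; have [p0 h1 h2] := l_range pl; have H := r_small pl; have R0 := r_ge0 p.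
have iY : / u p <= / u Y by apply: Rinv_le_contravar; lra.
have iY1 : / u Y <= 1 by rewrite -Rinv_1; apply: Rinv_le_contravar; lra.
have T : tl p <= r p.
  rewrite /tilt -[X in _ <= X]Rmult_1_r; apply: Rmult_le_compat_l => //.
  by rewrite -exp_0; apply: exp_mono; nra.
rewrite /den /dd /Rdiv; nra.
Qed.

Lemma prob_le_tilt p : pr p <= tl p.
Proof.
have t0 := tilt_ge0 r_ge0 sg p; have d1 := den_ge1 r_ge0 sg p.
apply: (Rmult_le_reg_r (den r sg p)); first lra.
by rewrite /prob /Rdiv Rmult_assoc Rinv_l; [nra|lra].
Qed.

Lemma tilt_le_prob p : p \in l -> tl p <= dd * pr p.
Proof.
move=> pl; have d1 := den_ge1 r_ge0 sg p; have D := den_le pl; have P := prob_ge0 r_ge0 sg p.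
have -> : tl p = den r sg p * pr p by rewrite /prob; field; lra.
exact: Rmult_le_compat_r.
Qed.

Lemma prob_le1 p : pr p <= 1.
Proof.
have d1 := den_ge1 r_ge0 sg p; apply: (Rmult_le_reg_r (den r sg p)); first lra.
rewrite /prob /Rdiv Rmult_assoc Rinv_l; last lra.
by rewrite /den Rmult_1_r; have := pow2_ge_0 (r p); lra.
Qed.

Lemma tilted_sumE : \sum_(p <- l) tl p * u p =
  lam * \sum_(p <- l) u p / INR p * (exp (- alpha * u p) / u p).
Proof.
rewrite big_distrr /= big_seq [RHS]big_seq; apply: eq_bigr => p pl; rewrite tiltE //.
have [p0 h1 h2] := l_range pl; have := INR_gt0 p0 => pR; field; lra.
Qed.

Lemma mean_le_tilted : mean r sg l <= \sum_(p <- l) tl p * u p.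
Proof.
apply: sum_le => p _; apply: Rmult_le_compat_r; [exact: ln_INR_ge0|exact: prob_le_tilt].
Qed.

Lemma tilted_le_mean : \sum_(p <- l) tl p * u p <= dd * mean r sg l.
Proof.
rewrite /mean big_distrr; apply: sum_le_in => p pl /=.
rewrite -Rmult_assoc; apply: Rmult_le_compat_r; [exact: ln_INR_ge0|exact: tilt_le_prob].
Qed.

Lemma var_le : var r sg l <= u Z * mean r sg l.
Proof.
rewrite /var /mean big_distrr; apply: sum_le_in => p pl /=.
have [p0 h1 h2] := l_range pl; have P0 := prob_ge0 r_ge0 sg p; have P1 := prob_le1 p.
have : pr p * (1 - pr p) * (u p * (u p * 1)) <= pr p * 1 * (u p * u p).
  rewrite Rmult_1_r; apply: Rmult_le_compat_r; first by nra.
  by apply: Rmult_le_compat_l; lra.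
have : pr p * (u p * u p) <= pr p * (u Z * u p).
  by apply: Rmult_le_compat_l => //; apply: Rmult_le_compat_r; lra.
lra.
Qed.

Lemma mean_size_le :
  mean_size r sg l <= lam ^ 2 * (/ u Y + 7 / u Y ^ 2) + dd * mean r sg l.
Proof.
apply: (Rle_trans _ (\sum_(p <- l) r p ^ 2 * u p + \sum_(p <- l) tl p * u p)).
  rewrite -big_split /=; apply: sum_le => p _.
  have t0 := tilt_ge0 r_ge0 sg p; have d1 := den_ge1 r_ge0 sg p; have u0 := ln_INR_ge0 p.
  have r2 := pow2_ge_0 (r p).
  rewrite -Rmult_plus_distr_r; apply: Rmult_le_compat_r => //.
  apply: (Rmult_le_reg_r (den r sg p)); first lra.
  rewrite /Rdiv Rmult_assoc Rinv_l; last lra.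
  by rewrite Rmult_1_r; move: r2; rewrite /= => r2; nra.
apply: Rplus_le_compat; last exact: tilted_le_mean.
have [_ H] := sum_inv_sqr q0 Y_ge2 YZ_leq qY.
rewrite (_ : \sum_(p <- l) r p ^ 2 * u p = lam ^ 2 * \sum_(p <- l) u p / INR p * (/ u p ^ 2)).
  by apply: Rmult_le_compat_l H; exact: pow2_ge_0.
rewrite big_distrr big_seq [RHS]big_seq; apply: eq_bigr => p pl; exact: r_sqrE.
Qed.

End Tilted.

(** With [alpha = A / ln Y] the substituted integral starts exactly at [A]. *)
Lemma mean_upper A s (E : R -> R) : 0 < A ->
  (forall x, A <= x -> is_derive E x (exp (- x) / x)) ->
  (forall x, A <= x -> E x - E A <= s) ->
  mean r (/ 2 + A / u Y) l <= lam * (s + 7 * exp (- A) / u Y).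
Proof.
move=> A0 HE Hs.
have a0 : 0 < A / u Y by apply: Rdiv_lt_0_compat; lra.
have aY : A / u Y * u Y = A by field; lra.
apply: Rle_trans (mean_le_tilted _) _.
rewrite tilted_sumE; apply: Rmult_le_compat_l; first lra.
have := @sum_tilted_mean q Y Z q0 Y_ge2 YZ_leq qY (A / u Y) E s a0.
rewrite aY -Ropp_mult_distr_l aY; apply=> //.
apply: Hs; rewrite lnZ; have b1 : 1 <= INR b by apply: (INR_leq (m := 1)).
have -> : A / u Y * (2 * INR b * u Y) = 2 * INR b * A by field; lra.
nra.
Qed.

(** Only the upper half of the logarithmic range is counted, where [p ^ kap] is at least
    [exp (kap * (b * ln Y))]. Its Mertens mass is at least [b * ln Y - 14], hence at least half of
    [b * ln Y]; dividing by [ln p <= 2 * b * ln Y] gives the 4. *)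
Lemma mean_lower kap : 0 <= kap <= / 2 -> 28 <= INR b * u Y ->
  lam * exp (kap * (INR b * u Y)) / 4 <= dd * mean r (/ 2 + - kap) l.
Proof.
move=> [k0 k1] bY; apply: Rle_trans (tilted_le_mean _); last lra.
rewrite tilted_sumE /Rdiv Rmult_assoc; apply: Rmult_le_compat_l; first lra.
pose W := (Y ^ b)%N.
have YW : (Y <= W)%N by rewrite /W -{1}(expn1 Y) leq_pexp2l ?Y_gt0.
have WZ : (W <= Z)%N by rewrite /W /Z leq_pexp2l ?Y_gt0 // leq_pmull.
have lW : u W = INR b * u Y := lnYX b.
have m1 := @mertens_coprime q Y Z q0 _ qY; have m2 := @mertens_coprime q Y W q0 _ qY.
rewrite Y_gt0 YZ_leq YW /= in m1 m2; have {}m1 := m1 isT; have {}m2 := m2 isT.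
have split : \sum_(Y.+1 <= p < Z.+1) pweight q p =
   \sum_(Y.+1 <= p < W.+1) pweight q p + \sum_(W.+1 <= p < Z.+1) pweight q p.
  by rewrite (big_cat_nat _ (n := W.+1)).
have S : INR b * u Y / 2 <= \sum_(W.+1 <= p < Z.+1) pweight q p.
  by move: m1 m2; rewrite split lnZ lW => /Rabs_le_between ? /Rabs_le_between ?; lra.
have w0 p : 0 <= pweight q p.
  rewrite /pweight; case: ifP => [_|_]; last exact: Rle_refl.
  by apply: Rmult_le_pos; [exact: ln_INR_ge0|apply: inv_ge0; exact: pos_INR].
rewrite (_ : \sum_(p <- l) _ = \sum_(Y.+1 <= p < Z.+1) pweight q p * (exp (- - kap * u p) / u p)); last first.
  by rewrite -sum_plist.
rewrite (big_cat_nat _ (n := W.+1)) //=.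
have T1 : 0 <= \sum_(Y.+1 <= p < W.+1) pweight q p * (exp (- - kap * u p) / u p).
  apply: sum_ge0 => p _; apply: Rmult_le_pos => //; apply: Rmult_le_pos; first exact: Rlt_le (exp_pos _).
  by apply: inv_ge0; exact: ln_INR_ge0.
have T2 : exp (kap * (INR b * u Y)) / (2 * INR b * u Y) * \sum_(W.+1 <= p < Z.+1) pweight q p
  <= \sum_(W.+1 <= p < Z.+1) pweight q p * (exp (- - kap * u p) / u p).
  rewrite big_distrr big_nat_cond [X in _ <= X]big_nat_cond; apply: sum_le => p /andP[/andP[Wp pZ] _] /=.
  rewrite Rmult_comm; apply: Rmult_le_compat_l => //.
  have p0 : (0 < p)%N by exact: leq_ltn_trans Wp.
  have h1 : u W <= u p by apply: ln_mono; [exact/INR_gt0/(leq_trans Y_gt0 YW)|exact: INR_leq (ltnW Wp)].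
  have h2 : u p <= u Z by apply: ln_mono; [exact: INR_gt0|apply: INR_leq; rewrite -ltnS].
  apply: Rmult_le_compat; first exact: Rlt_le (exp_pos _).
  - by apply: inv_ge0; nra.
  - by apply: exp_mono; rewrite Ropp_involutive -lW; apply: Rmult_le_compat_l.
  by apply: Rinv_le_contravar; [lra|rewrite -lnZ].
have T3 : exp (kap * (INR b * u Y)) / (2 * INR b * u Y) * (INR b * u Y / 2)
   <= exp (kap * (INR b * u Y)) / (2 * INR b * u Y) * \sum_(W.+1 <= p < Z.+1) pweight q p.
  apply: Rmult_le_compat_l => //; apply: Rmult_le_pos; first exact: Rlt_le (exp_pos _).
  by apply: inv_ge0; nra.
have T4 : exp (kap * (INR b * u Y)) / (2 * INR b * u Y) * (INR b * u Y / 2) = exp (kap * (INR b * u Y)) * / 4.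
  have b1 : 0 < INR b by exact: INR_gt0.
  by field; lra.
by rewrite -T4; lra.
Qed.

Lemma mean_continuous : continuity (fun alpha => mean r (/ 2 + alpha) l).
Proof.
rewrite /mean; elim: l => [|p s IH].
  move=> x; apply: (continuity_pt_ext (fun=> 0)) => [y|]; first by rewrite big_nil.
  exact: continuity_pt_const.
move=> x; apply: (continuity_pt_ext (fun alpha => prob r (/ 2 + alpha) p * u p
    + \sum_(j <- s) prob r (/ 2 + alpha) j * u j)) => [y|]; first by rewrite sum_cons.
apply: continuity_pt_plus; last exact: IH.
apply/continuity_pt_filterlim; apply: ex_derive_continuous.
rewrite /prob /den /tilt; auto_derive.
have := den_ge1 r_ge0 (/ 2 + x) p; rewrite /den /tilt /=.
lra.
Qed.

(** Intermediate values: the mean is at most [L] at [A / ln Y] and at least [L] at [- kap]. The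
    negative end is provided because the finite list of primes may not reach [L] with a non-negative
    tilt. *)
Lemma exists_tilt A s (E : R -> R) kap L : 0 < A ->
  (forall x, A <= x -> is_derive E x (exp (- x) / x)) ->
  (forall x, A <= x -> E x - E A <= s) ->
  lam * (s + 7 * exp (- A) / u Y) <= L ->
  0 <= kap <= / 2 -> 28 <= INR b * u Y ->
  L * dd * 4 <= lam * exp (kap * (INR b * u Y)) ->
  exists alpha, - kap <= alpha <= A / u Y /\ mean r (/ 2 + alpha) l = L.
Proof.
move=> A0 HE Hs H1 Hk bY H2.
have a0 : 0 < A / u Y by apply: Rdiv_lt_0_compat; lra.
have M1 := mean_upper A0 HE Hs; have M2 := mean_lower Hk bY.
have d1 := dd_ge1.
have M3 : L <= mean r (/ 2 + - kap) l.
  by apply: (Rmult_le_reg_l dd); lra.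
have cont : continuity (fun alpha => mean r (/ 2 + alpha) l - L).
  move=> x; apply: continuity_pt_minus; first exact: mean_continuous.
  exact: continuity_pt_const.
have [|| z [Hz Ez]] := IVT_cor _ (- kap) (A / u Y) cont; [lra|nra|].
by exists z; split=> //; lra.
Qed.

(** The two terms merge into the sum of [prob p * (1 + alpha * ln p)], the one evaluated by
    [sum_tilted_gain]; then [alpha * ln Y <= A]. *)
Lemma gain_nonneg A alpha : 0 <= alpha <= A / u Y ->
  0 <= 1 - / (2 * INR b) - 8 * (1 + A) / u Y ->
  lam / u Y * exp (- A) * (1 - / (2 * INR b) - 8 * (1 + A) / u Y)
  <= dd * (alpha * mean r (/ 2 + alpha) l + \sum_(p <- l) prob r (/ 2 + alpha) p).
Proof.
move=> [a0 aA] HX.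
have aY : alpha * u Y <= A.
  have -> : A = A / u Y * u Y by field; lra.
  by apply: Rmult_le_compat_r; lra.
have A0 : 0 <= A by nra.
have b1 : 0 < INR b by exact: INR_gt0.
have -> : alpha * mean r (/ 2 + alpha) l + \sum_(p <- l) prob r (/ 2 + alpha) p =
   \sum_(p <- l) prob r (/ 2 + alpha) p * (1 + alpha * u p).
  rewrite /mean big_distrr -big_split; apply: eq_bigr => p _ /=; ring.
apply: (Rle_trans _ (\sum_(p <- l) tilt r (/ 2 + alpha) p * (1 + alpha * u p))); last first.
  rewrite big_distrr; apply: sum_le_in => p pl /=; rewrite -Rmult_assoc.
  apply: Rmult_le_compat_r; last by apply: tilt_le_prob => //; lra.
  by have := ln_INR_ge0 p; nra.
have -> : \sum_(p <- l) tilt r (/ 2 + alpha) p * (1 + alpha * u p) =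
   lam * \sum_(p <- l) u p / INR p * (exp (- alpha * u p) * (1 + alpha * u p) / u p ^ 2).
  rewrite big_distrr big_seq [RHS]big_seq; apply: eq_bigr => p pl /=; rewrite tiltE //.
  have [p0 h1 h2] := l_range pl; have := INR_gt0 p0 => pR; field; lra.
have H := sum_tilted_gain q0 Y_ge2 YZ_leq qY a0; rewrite lnZ -/l in H.
apply: Rle_trans (Rmult_le_compat_l _ _ _ (Rlt_le _ _ lam0) H).
have -> : lam * (exp (- alpha * u Y) * (/ u Y - / (2 * INR b * u Y) - 8 * (1 + alpha * u Y) / u Y ^ 2))
  = lam / u Y * (exp (- alpha * u Y) * (1 - / (2 * INR b) - 8 * (1 + alpha * u Y) / u Y)).
  by field; lra.
rewrite Rmult_assoc; apply: Rmult_le_compat_l.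
  by apply: Rlt_le; apply: Rdiv_lt_0_compat; lra.
apply: Rmult_le_compat => //; first exact: Rlt_le (exp_pos _).
  by apply: exp_mono; lra.
apply: Rplus_le_compat_l; apply: Ropp_le_contravar.
by apply: Rmult_le_compat_r; [apply: inv_ge0; lra|lra].
Qed.

(** A negative [alpha] only increases the tilted weights, whose sum at [alpha = 0] is already about
    [lam / ln Y]; the term [alpha * L] costs at most [kap * L]. *)
Lemma gain_neg alpha kap L : - kap <= alpha <= 0 -> kap <= / 2 -> 0 <= L ->
  mean r (/ 2 + alpha) l = L ->
  lam / u Y * (1 - / (2 * INR b) - 8 / u Y) - dd * kap * L
  <= dd * (alpha * mean r (/ 2 + alpha) l + \sum_(p <- l) prob r (/ 2 + alpha) p).
Proof.
move=> [a0 a1] k2 L0 ->; have d1 := dd_ge1; have b1 : 0 < INR b by exact: INR_gt0.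
suff : lam / u Y * (1 - / (2 * INR b) - 8 / u Y) <= dd * \sum_(p <- l) prob r (/ 2 + alpha) p.
  have : - kap * L <= alpha * L by apply: Rmult_le_compat_r; lra.
  nra.
apply: (Rle_trans _ (\sum_(p <- l) tilt r (/ 2 + alpha) p)); last first.
  by rewrite big_distrr; apply: sum_le_in => p pl; apply: tilt_le_prob => //; lra.
have [H _] := sum_inv_sqr q0 Y_ge2 YZ_leq qY; rewrite lnZ -/l in H.
apply: (Rle_trans _ (lam * \sum_(p <- l) u p / INR p * (/ u p ^ 2))).
  apply: Rle_trans (Rmult_le_compat_l _ _ _ (Rlt_le _ _ lam0) H).
  by apply: Req_le; field; lra.
rewrite big_distrr; apply: sum_le_in => p pl /=; rewrite tiltE //.
have [p0 h1 h2] := l_range pl; have := INR_gt0 p0 => pR.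
have -> : lam * (u p / INR p * / (u p * (u p * 1))) = lam / INR p * / u p by field; lra.
rewrite /Rdiv; apply: Rmult_le_compat_r; first by apply: inv_ge0; lra.
rewrite -[X in X <= _]Rmult_1_r; apply: Rmult_le_compat_l.
  by apply: Rmult_le_pos; [lra|apply: inv_ge0; lra].
by rewrite -exp_0; apply: exp_mono; nra.
Qed.

(** [G] is a common lower bound for the gain in both signs of the tilt, and [k0] is the probability
    left in the window by Chebyshev and Markov. *)
Theorem resonator_inequality A s (E : R -> R) kap L h bM k0 G : 0 < A ->
  (forall x, A <= x -> is_derive E x (exp (- x) / x)) ->
  (forall x, A <= x -> E x - E A <= s) ->
  0 <= L -> lam * (s + 7 * exp (- A) / u Y) <= L ->
  A / u Y <= / 2 -> 0 <= kap <= / 2 -> 28 <= INR b * u Y ->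
  L * dd * 4 <= lam * exp (kap * (INR b * u Y)) ->
  0 < h -> 0 < bM -> 0 <= k0 ->
  2 * INR b * u Y * L / h ^ 2 + (lam ^ 2 * (/ u Y + 7 / u Y ^ 2) + dd * L) / bM <= 1 - k0 ->
  0 <= 1 - / (2 * INR b) - 8 * (1 + A) / u Y ->
  dd * G <= lam / u Y * exp (- A) * (1 - / (2 * INR b) - 8 * (1 + A) / u Y) ->
  dd * G <= lam / u Y * (1 - / (2 * INR b) - 8 / u Y) - dd * kap * L ->
  (\prod_(p <- l) (1 + r p ^ 2)) * (k0 * exp (L / 2 + G - h)) <= conf r l (window (L + h) bM).
Proof.
move=> A0 HE Hs L0 H1 A2 Hk bY H2 h0 bM0 k00 HV HX HG1 HG2.
have [alpha [[a1 a2] mL]] := exists_tilt A0 HE Hs H1 Hk bY H2.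
have sg0 : 0 <= / 2 + alpha by lra.
have ag : - / 2 <= alpha by lra.
have d1 := dd_ge1.
have W := conf_window r_ge0 (plist_prime q Y Z) sg0 h0 bM0; rewrite -/l mL in W.
apply: Rle_trans W.
have Gl : G <= alpha * L + \sum_(p <- l) prob r (/ 2 + alpha) p.
  apply: (Rmult_le_reg_l dd); first lra.
  case: (Rle_lt_dec 0 alpha) => a0.
    by apply: Rle_trans HG1 _; rewrite -{1}mL; apply: gain_nonneg.
  apply: Rle_trans HG2 _; rewrite -{2}mL; apply: gain_neg => //; lra.
have V := var_le alpha; have MS := mean_size_le ag; rewrite mL lnZ in V MS.
have K : k0 <= 1 - var r (/ 2 + alpha) l / h ^ 2 - mean_size r (/ 2 + alpha) l / bM.
  have v1 : var r (/ 2 + alpha) l / h ^ 2 <= 2 * INR b * u Y * L / h ^ 2.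
    by apply: Rmult_le_compat_r V; apply: inv_ge0; exact: pow2_ge_0.
  have v2 : mean_size r (/ 2 + alpha) l / bM <= (lam ^ 2 * (/ u Y + 7 / u Y ^ 2) + dd * L) / bM.
    by apply: Rmult_le_compat_r MS; apply: inv_ge0; lra.
  lra.
have zl := ztot_lower r_ge0 (/ 2 + alpha) l.
set P := \prod_(p <- l) (1 + r p ^ 2) in zl *.
set S := \sum_(p <- l) prob r (/ 2 + alpha) p in zl Gl.
have P0 : 0 <= P.
  by rewrite /P; elim/big_ind: _ => [|x y|p _]; [lra|exact: Rmult_le_pos|have := pow2_ge_0 (r p); lra].
have e1 := exp_pos ((/ 2 + alpha) * (L - h)).
have z0 := ztot_gt0 r_ge0 (/ 2 + alpha) l.
apply: (Rle_trans _ (exp ((/ 2 + alpha) * (L - h)) * ztot r (/ 2 + alpha) l * k0)); last first.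
  by apply: Rmult_le_compat_l K; nra.
apply: (Rle_trans _ (exp ((/ 2 + alpha) * (L - h)) * (P * exp S) * k0)); last first.
  by apply: Rmult_le_compat_r => //; apply: Rmult_le_compat_l => //; lra.
have -> : exp ((/ 2 + alpha) * (L - h)) * (P * exp S) * k0 = P * (k0 * exp ((/ 2 + alpha) * (L - h) + S)).
  by rewrite exp_plus; ring.
(* In the exponent, [(/ 2 + alpha) * h] is at most [h] because [alpha <= A / ln Y <= / 2]. *)
apply: Rmult_le_compat_l => //; apply: Rmult_le_compat_l => //; apply: exp_mono.
nra.
Qed.

End CoreInequality.
End Core.

(** * The incomplete exponential integral and its companion *)

Module ExpIntegral.
Import all_boot PrimeSums.
Open Scope R_scope.

Lemma is_RInt_gen_infty (f : R -> R) (A l eps : R) : 0 < eps ->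
  is_RInt_gen f (at_point A) (Rbar_locally p_infty) l ->
  exists M, forall v, M < v -> Rabs (RInt f A v - l) < eps.
Proof.
move=> e0 H.
have [P Q HP [M HM] PQ] := H (fun y => Rabs (y - l) < eps) (locally_ball l (mkposreal eps e0)).
exists M => v Mv; have [y [Hy1 Hy2]] := PQ A v HP (HM v Mv).
by rewrite (is_RInt_unique _ _ _ _ Hy1).
Qed.

Section PositiveHalfLine.
Variables (f : R -> R) (A : R).
Hypothesis A0 : 0 < A.
Hypothesis f_cont : forall x, 0 < x -> continuous f x.

Lemma half_line_ex_RInt u v : 0 < u -> 0 < v -> ex_RInt f u v.
Proof.
move=> u0 v0; apply: ex_RInt_continuous => z [Hz _]; apply: f_cont.
by apply: Rlt_le_trans Hz; apply: Rmin_glb_lt.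
Qed.

Lemma half_line_RInt u v : 0 < u -> 0 < v -> is_RInt f u v (RInt f u v).
Proof. by move=> u0 v0; apply: RInt_correct; exact: half_line_ex_RInt. Qed.

Lemma half_line_derive x : 0 < x -> is_derive (fun v => RInt f A v) x (f x).
Proof.
move=> x0; apply: (is_derive_RInt f _ A x); last exact: f_cont.
exists (mkposreal x x0) => y Hy; apply: half_line_RInt => //.
by move: Hy; rewrite /ball /= /AbsRing_ball /abs /minus /plus /opp /= => /Rabs_def2; lra.
Qed.

Lemma RInt_le_limit l x : (forall y, A <= y -> 0 <= f y) ->
  is_RInt_gen f (at_point A) (Rbar_locally p_infty) l -> A <= x -> RInt f A x <= l.
Proof.
move=> f0 Hl Ax; apply: Rnot_lt_le => lx.
have e0 : 0 < RInt f A x - l by lra.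
have [M HM] := is_RInt_gen_infty _ _ _ _ e0 Hl.
pose v := Rmax x M + 1.
have xv : x <= v by have := Rmax_l x M; rewrite /v; lra.
have Mv : M < v by have := Rmax_r x M; rewrite /v; lra.
have C : RInt f A x + RInt f x v = RInt f A v.
  by apply: RInt_Chasles; apply: half_line_ex_RInt; lra.
have : 0 <= RInt f x v.
  apply: RInt_ge_0 => //; first by apply: half_line_ex_RInt; lra.
  by move=> y Hy; apply: f0; lra.
by have /Rabs_def2 := HM v Mv; lra.
Qed.

End PositiveHalfLine.

Lemma exp_div_continuous x : 0 < x -> continuous (fun y => exp (- y) / y) x.
Proof. by move=> x0; apply: ex_derive_continuous; auto_derive; lra. Qed.

Lemma exp_div_sqr_continuous x : 0 < x -> continuous (fun y => exp (- y) / y ^ 2) x.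
Proof. by move=> x0; apply: ex_derive_continuous; auto_derive; nra. Qed.

Section Facts.
Variables A t t' : R.
Hypothesis A0 : 0 < A.
Hypothesis Ht : is_RInt_gen (fun x => exp (- x) / x) (at_point A) (Rbar_locally p_infty) t.
Hypothesis Ht' : is_RInt_gen (fun x => exp (- x) / x ^ 2) (at_point A) (Rbar_locally p_infty) t'.
Let f (x : R) := exp (- x) / x.
Let g (x : R) := exp (- x) / x ^ 2.

Lemma f_pos y : 0 < y -> 0 < f y.
Proof. by move=> y0; apply: Rdiv_lt_0_compat => //; exact: exp_pos. Qed.

Lemma g_pos y : 0 < y -> 0 < g y.
Proof. by move=> y0; apply: Rdiv_lt_0_compat; [exact: exp_pos|nra]. Qed.

Lemma exp_integral_primitive : exists E : R -> R,
  (forall x, A <= x -> is_derive E x (exp (- x) / x)) /\ (forall x, A <= x -> E x - E A <= t).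
Proof.
exists (fun v => RInt f A v); split=> x Ax.
  by apply: half_line_derive; [exact: A0|exact: exp_div_continuous|lra].
rewrite RInt_point /zero /= Rminus_0_r; apply: RInt_le_limit => //; first exact: exp_div_continuous.
by move=> y Ay; apply: Rlt_le; apply: f_pos; lra.
Qed.

(* Integration by parts: [exp (- x) * (/ x + / x ^ 2)] is the derivative of [- exp (- x) / x]. *)
Lemma exp_integral_sum : A * (t + t') = exp (- A).
Proof.
suff -> : t + t' = exp (- A) / A by field; lra.
apply: Req_lt_aux => -[e e0] /=.
have e3 : 0 < e / 3 by lra.
have [M1 H1] := is_RInt_gen_infty _ _ _ _ e3 Ht.
have [M2 H2] := is_RInt_gen_infty _ _ _ _ e3 Ht'.
pose v := Rmax (Rmax M1 M2) (Rmax A (3 / e)) + 1.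
have h1 := Rmax_l (Rmax M1 M2) (Rmax A (3 / e)); have h2 := Rmax_r (Rmax M1 M2) (Rmax A (3 / e)).
have h3 := Rmax_l M1 M2; have h4 := Rmax_r M1 M2; have h5 := Rmax_l A (3 / e); have h6 := Rmax_r A (3 / e).
have {}H1 := H1 v; have {}H2 := H2 v.
have v0 : 0 < v by rewrite /v; lra.
have v3 : 3 / e < v by rewrite /v; lra.
have S : RInt f A v + RInt g A v = exp (- A) / A - exp (- v) / v.
  have If := half_line_RInt f exp_div_continuous A v A0 v0.
  have Ig := half_line_RInt g exp_div_sqr_continuous A v A0 v0.
  have P := is_RInt_plus _ _ _ _ _ _ If Ig.
  have D : is_RInt (fun x => plus (f x) (g x)) A v (minus (- (exp (- v) / v)) (- (exp (- A) / A))).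
    apply: (is_RInt_derive (fun x => - (exp (- x) / x))) => x [Hx _].
      have x0 : 0 < x by apply: Rlt_le_trans Hx; apply: Rmin_glb_lt.
      auto_derive; first lra.
      by rewrite /plus /= /f /g; field; lra.
    have x0 : 0 < x by apply: Rlt_le_trans Hx; apply: Rmin_glb_lt.
    by apply: continuous_plus; [exact: exp_div_continuous|exact: exp_div_sqr_continuous].
  have := is_RInt_unique _ _ _ _ P; rewrite (is_RInt_unique _ _ _ _ D).
  by rewrite /minus /plus /opp /=; lra.
have ev : 0 < exp (- v) / v < e / 3.
  split; first by apply: Rdiv_lt_0_compat => //; exact: exp_pos.
  have ee : exp (- v) <= 1 by rewrite -exp_0; apply: exp_mono; lra.
  apply: (Rmult_lt_reg_r v) => //; rewrite {1}/Rdiv Rmult_assoc Rinv_l; last lra.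
  have : e / 3 * (3 / e) < e / 3 * v by apply: Rmult_lt_compat_l.
  have -> : e / 3 * (3 / e) = 1 by field; lra.
  lra.
have /Rabs_def2 K1 : Rabs (RInt f A v - t) < e / 3 by apply: H1; rewrite /v; lra.
have /Rabs_def2 K2 : Rabs (RInt g A v - t') < e / 3 by apply: H2; rewrite /v; lra.
apply: Rabs_def1; lra.
Qed.

(** Since [/ x ^ 2 <= / (A * x)] beyond [A], [A * t'] is at most [t]; insert this into
    [exp_integral_sum]. These bounds translate the size of [t] into that of [A]. *)
Lemma exp_integral_bounds : A * t <= exp (- A) <= (1 + A) * t.
Proof.
have S := exp_integral_sum.
have t'0 : 0 <= t'.
  have := @RInt_le_limit g A A0 exp_div_sqr_continuous t' A.
  rewrite RInt_point /zero /=; apply; last lra; last exact: Ht'.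
  by move=> y Ay; apply: Rlt_le; apply: g_pos; lra.
have At' : A * t' <= t.
  apply: Rnot_lt_le => h.
  have e0 : 0 < (A * t' - t) / A by apply: Rdiv_lt_0_compat; lra.
  have [M HM] := is_RInt_gen_infty _ _ _ _ e0 Ht'.
  pose v := Rmax A M + 1.
  have Av := Rmax_l A M; have Mv := Rmax_r A M.
  have v0 : 0 < v by rewrite /v; lra.
  have Vv : A <= v by rewrite /v; lra.
  have B : RInt f A v <= t.
    apply: RInt_le_limit => //; first exact: exp_div_continuous.
    by move=> y Ay; apply: Rlt_le; apply: f_pos; lra.
  have C : A * RInt g A v <= RInt f A v.
    have -> : A * RInt g A v = RInt (fun y => scal A (g y)) A v.
      by rewrite RInt_scal //; exact: (half_line_ex_RInt g exp_div_sqr_continuous A v).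
    apply: RInt_le => //.
    - by apply: ex_RInt_scal; exact: (half_line_ex_RInt g exp_div_sqr_continuous A v).
    - exact: (half_line_ex_RInt f exp_div_continuous A v).
    move=> x [Hx _]; rewrite /scal /= /mult /= /f /g.
    have ex := exp_pos (- x).
    have -> : A * (exp (- x) / (x * (x * 1))) = (A / x) * (exp (- x) / x) by field; lra.
    rewrite -[X in _ <= X]Rmult_1_l; apply: Rmult_le_compat_r.
      by apply: Rlt_le; apply: Rdiv_lt_0_compat; lra.
    by apply: (Rmult_le_reg_r x); [lra|rewrite /Rdiv Rmult_assoc Rinv_l; lra].
  have /Rabs_def2 [_ K] : Rabs (RInt g A v - t') < (A * t' - t) / A by apply: HM; rewrite /v; lra.
  have : (t' - (A * t' - t) / A) * A < RInt g A v * A by apply: Rmult_lt_compat_r => //; lra.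
  have -> : (t' - (A * t' - t) / A) * A = t by field; lra.
  lra.
by rewrite -S; split; nra.
Qed.

End Facts.
End ExpIntegral.

(** * Choice of the parameters for large [q] *)

Module Asymptotics.
Import all_boot Sums PrimeSums Resonator Analytic Core.
Set Implicit Arguments. Unset Strict Implicit. Unset Printing Implicit Defensive.
Open Scope R_scope.

Definition eventually_R (P : R -> Prop) := exists X, forall x, X <= x -> P x.

Lemma ev_and P Q : eventually_R P -> eventually_R Q -> eventually_R (fun x => P x /\ Q x).
Proof.
move=> [X HX] [X' HX']; exists (Rmax X X') => x Hx.
by split; [apply: HX|apply: HX']; apply: Rle_trans Hx; [exact: Rmax_l|exact: Rmax_r].
Qed.

Lemma ev_imp (P Q : R -> Prop) : (forall x, P x -> Q x) -> eventually_R P -> eventually_R Q.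
Proof. by move=> H [X HX]; exists X => x /HX /H. Qed.

Lemma ev_ge c : eventually_R (fun x => c <= x).
Proof. by exists c. Qed.

Lemma ev_ln_ge c : eventually_R (fun x => c <= ln x).
Proof. by exists (exp c) => x Hx; rewrite -(ln_exp c); apply: ln_mono Hx; exact: exp_pos. Qed.

Lemma ev_ln_le a c m : 0 < a -> eventually_R (fun x => c + m * ln x <= a * x).
Proof.
move=> a0; pose M := Rabs m + 1.
have M0 : 0 < M by have := Rabs_pos m; rewrite /M; lra.
(* With this slope the tangent bound [ln x <= d * x - ln d] uses only half of [a * x]; the other
   half pays for constants. *)
pose d := a / (2 * M); have d0 : 0 < d by apply: Rdiv_lt_0_compat; lra.
exists (Rmax 1 ((c - M * ln d) * (2 / a))) => x Hx.
have x1 : 1 <= x by apply: Rle_trans Hx; exact: Rmax_l.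
have x2 : (c - M * ln d) * (2 / a) <= x by apply: Rle_trans Hx; exact: Rmax_r.
have lx : 0 <= ln x by rewrite -ln_1; apply: ln_mono; lra.
have h1 : ln x <= d * x - ln d.
  have dx : 0 < d * x by nra.
  by have := ln_le_sub1 dx; rewrite ln_mult //; lra.
have h2 : m * ln x <= M * ln x by apply: Rmult_le_compat_r => //; have := Rle_abs m; rewrite /M; lra.
have h3 : M * ln x <= M * (d * x - ln d) by apply: Rmult_le_compat_l; lra.
have h4 : M * (d * x - ln d) = a / 2 * x - M * ln d by rewrite /d; field; lra.
have h5 : (c - M * ln d) <= a / 2 * x.
  have -> : c - M * ln d = a / 2 * ((c - M * ln d) * (2 / a)) by field; lra.
  by apply: Rmult_le_compat_l; lra.
lra.
Qed.

Lemma nat_ceil y : 0 <= y -> exists n : nat, y <= INR n <= y + 1.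
Proof.
move=> y0; have [h1 h2] := archimed y.
have z0 : (0 <= up y)%Z by apply: le_IZR; lra.
by exists (Z.to_nat (up y)); rewrite INR_IZR_INZ Znat.Z2Nat.id //; lra.
Qed.

Lemma mulr_le1 a b c d : 0 <= a <= b -> 0 <= c <= d -> a * c <= b * d.
Proof. by move=> [a0 ab] [c0 cd]; apply: Rmult_le_compat. Qed.

(** [c0] is the share of [ln q] given to [ln M]: 1 in general, one half for prime [q]. Apart from
    [t], the exponentials are the square roots of [c0 * ln q * ln (ln q)] and
    [c0 * ln q / ln (ln q)]. The margin [ln 16] is used for prime [q], where [8 * (x * k0) <= q] is
    required. *)
Lemma resonator_exists c0 K eps : 0 < c0 <= 1 -> 0 < K -> 0 < eps <= / 8 ->
  eventually_R (fun x => forall (q : nat) (t A : R) (E : R -> R),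
    (0 < q)%N -> ln (INR q) = exp x ->
    exp (- (K * ln x)) <= t <= exp (K * ln x) -> 0 < A ->
    A * t <= exp (- A) <= (1 + A) * t ->
    (forall y, A <= y -> is_derive E y (exp (- y) / y)) ->
    (forall y, A <= y -> E y - E A <= t) ->
    exists (l : seq nat) (r : nat -> R),
    [/\ forall p, 0 <= r p, all prime l, uniq l & all (fun p => coprime p q) l] /\
      (\prod_(p <- l) (1 + r p ^ 2)) *
        exp (t * exp ((ln c0 + x + ln x) / 2) / 2
             + (1 - 8 * eps) * exp (- A) * exp ((ln c0 + x - ln x) / 2))
      <= conf r l (window (t * exp ((ln c0 + x + ln x) / 2) - ln 16) ((1 - eps) * c0 * exp x))).
Proof.
move=> [c00 c01] K0 [e0 e1].
(* With [x = ln (ln q)]: [lam ^ 2 = (1 - 2 * eps) * c0 * x * exp x], so that the factor [1 - 2 * eps]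
   leaves room both for [n * m <= M] and for [ln N] to exceed [lam * t] by all the error terms. *)
pose lc := ln (1 - 2 * eps) + ln c0.
have lc1 : ln (1 - 2 * eps) <= - (2 * eps) by have := @ln_le_sub1 (1 - 2 * eps); lra.
have lc2 : - (2 * ln 2) <= ln (1 - 2 * eps).
  have -> : - (2 * ln 2) = ln (/ 4).
    by rewrite ln_Rinv; [rewrite (_ : 4 = 2 * 2) ?ln_mult|]; lra.
  by apply: ln_mono; lra.
have lc0 : ln c0 <= 0 by rewrite -ln_1; apply: ln_mono.
have ln2 : ln 2 <= 1 by have := @ln_le_sub1 2; lra.
have ln16 : 0 <= ln 16 <= 4.
  have -> : 16 = 2 * 2 * (2 * 2) by ring.
  by rewrite !ln_mult; try lra; have := ln_lt_2; lra.
have p6 : 0 < / 6 by lra.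
have p2 : 0 < / 2 by lra.
have p3 : 0 < / 3 by lra.
have p8 : 0 < eps / 8 by lra.
have ev := ev_and (ev_ge 28) (ev_and (ev_ln_ge (- lc)) (ev_and (@ev_ln_le eps 2 1 e0)
  (ev_and (@ev_ln_le eps 224 (112 * K) e0) (ev_and (@ev_ln_le (/ 6) (ln 2 - ln (eps / 4) - lc / 2) K p6)
  (ev_and (@ev_ln_le (eps / 8) (ln 16) K p8) (ev_and (@ev_ln_le (/ 6) (ln 16 + lc / 2 - ln (eps / 8)) (3 * K + 3) p6)
  (ev_and (@ev_ln_le (/ 2) (ln 4 + lc / 2 - ln (eps * c0 / 8)) (K + 1) p2)
  (ev_and (@ev_ln_le (/ 6) (ln 3 + 1 - ln eps - ln c0 / 2) (K + 1) p6)
  (@ev_ln_le (/ 3) (4 - ln (eps / 2)) 0 p3))))))))).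
apply: (ev_imp _ ev) => {ev} x [x28 [Hc [Hu [HK [H5 [H6 [H7 [H8 [H9 H10]]]]]]]]] q t A E q0 qx [t1 t2] A0 [At1 At2] HE Ht.

set u := ln x in Hc Hu HK H5 H6 H7 H8 H9 H10 t1 t2 *.
have lcn : lc <= 0 by rewrite /lc; lra.
have u0 : 0 <= u by rewrite /u -ln_1; apply: ln_mono; lra.
have xE : exp u = x by rewrite /u exp_ln; lra.
have Ku0 : 0 <= K * u by apply: Rmult_le_pos; lra.
pose lam := exp ((lc + x + u) / 2).
have lamE : lam ^ 2 = exp (lc + x + u) by rewrite /lam /= Rmult_1_r -exp_plus; congr exp; field.
have lam0 : 0 < lam := exp_pos _.
have lam2_ge : exp x <= lam ^ 2 by rewrite lamE; apply: exp_mono; lra.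
have ex28 := exp_ineq1_le x.
have [Y [Y1 Y2]] : exists n : nat, lam ^ 2 <= INR n <= lam ^ 2 + 1 by apply: nat_ceil; lra.
set v := ln (INR Y).
have vx : x <= v by rewrite /v -{1}(ln_exp x); apply: ln_mono; [exact: exp_pos|lra].
have vx2 : v <= (1 + eps) * x.
  have : v <= 1 + x + u.
    rewrite /v -(ln_exp (1 + x + u)); apply: ln_mono; first lra.
    have e2 := exp_ineq1_le 1.
    have : exp 1 * exp (x + u) = exp (1 + x + u) by rewrite -exp_plus; congr exp; ring.
    have : 2 * exp (x + u) <= exp 1 * exp (x + u).
      by apply: Rmult_le_compat_r; [exact: Rlt_le (exp_pos _)|lra].
    have : exp (lc + x + u) <= exp (x + u) by apply: exp_mono; lra.
    by rewrite -lamE; lra.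
  lra.
have v0 : 0 < v by lra.
have vinv : 0 < / v by apply: Rinv_0_lt_compat.
have xinv : 0 < / x by apply: Rinv_0_lt_compat; lra.
have vxinv : / v <= / x by apply: Rinv_le_contravar; lra.
have xx : / x * x = 1 by field; lra.
have vv : / v * v = 1 by field; lra.
have qY : ln (INR q) <= INR Y by rewrite qx; lra.
pose T := exp (K * u).
have T1 : 1 <= T by rewrite /T -exp_0; apply: exp_mono.
have TT : exp (2 * (K * u)) = T * T by rewrite /T -exp_plus; congr exp; ring.
(* [b] is a power of [x], up to constants: large enough for [kap * (b * v) >= eps / 8 * x], which
   dominates [ln 16 + K * u], yet harmless in the variance. *)
have [b [b1 b2]] : exists n : nat, T * T * x <= INR n <= T * T * x + 1 by apply: nat_ceil; nra.
have TTx : x <= T * T * x by nra.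
have b0 : (0 < b)%N by case: b b1 b2 => // h; move: h; rewrite /=; lra.
have bpos : 0 < INR b by lra.
(* The tilt may be slightly negative, down to [- kap], when [t] is large. *)
pose kap := eps / 8 / (T * v).
have Tv : 1 <= T * v by nra.
have kapE : kap * (T * v) = eps / 8 by rewrite /kap; field; split; lra.
have kap0 : 0 <= kap by apply: Rdiv_le_0_compat; lra.
have kap2 : kap <= / 2 by nra.
(* The standard deviation of [ln n] has order [exp (x / 4)], while [ln N] and the gain have order
   [exp (x / 2)], up to powers of [x]; the exponent one third lies in between. *)
pose h := exp (x / 3).
have h0 : 0 < h := exp_pos _.
have h10 : 1 + x / 3 <= h := exp_ineq1_le _.
set th := exp ((ln c0 + x + u) / 2).
have thE : th = lam * exp (- ln (1 - 2 * eps) / 2).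
  by rewrite /th /lam -exp_plus; congr exp; rewrite /lc; field.
have rho1 := exp_ineq1_le (- ln (1 - 2 * eps) / 2).
have rho2 : exp (- ln (1 - 2 * eps) / 2) <= 2.
  by rewrite -[X in _ <= X]exp_ln; [apply: exp_mono|]; lra.
set rho := exp (- ln (1 - 2 * eps) / 2) in thE rho1 rho2.
have t0 : 0 < t by have := exp_pos (- (K * u)); lra.
have lt0 : 0 < lam * t by apply: Rmult_lt_0_compat.
(* The mean sits [h] below the edge of the window. It still exceeds [lam * t] because
   [th / lam = rho >= 1 + eps]. *)
pose L := t * th - ln 16 - h.
have hsmall : 2 * h <= eps / 4 * (lam * t).
  have : exp (ln 2 + x / 3) <= exp (ln (eps / 4) + (lc + x + u) / 2 + - (K * u)) by apply: exp_mono; lra.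
  rewrite !exp_plus !exp_ln; try lra; rewrite -/h -/lam => H.
  apply: Rle_trans H _; rewrite -Rmult_assoc; apply: Rmult_le_compat_l => //.
  by apply: Rmult_le_pos; lra.
have Lge : lam * t * (1 + 3 / 4 * eps) <= L.
  have : lam * t * (1 + eps) <= lam * t * rho by apply: Rmult_le_compat_l; lra.
  have : t * th = lam * t * rho by rewrite thE; ring.
  by rewrite /L; lra.
have L0 : 0 <= L.
  apply: Rle_trans Lge; apply: Rmult_le_pos; lra.
have LT : L <= 2 * lam * T.
  have : t * th <= T * (lam * 2).
    rewrite thE; apply: mulr_le1; split; try exact: t2; try lra; first by apply: Rmult_le_pos; lra.
    by apply: Rmult_le_compat_l; lra.
  by rewrite /L; lra.
(* If [A > 1], then [A * t <= exp (- A)] forces [exp (- A)] above [t >= exp (- (K * u))]. So [A]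
   grows at most like [ln x], and [A / v] is negligible. *)
have A1 : 1 + A <= 2 + K * u.
  case: (Rle_lt_dec A 1) => hA; first lra.
  suff : A <= K * u by lra.
  apply: Rnot_lt_le => hK.
  have : exp (- A) < exp (- (K * u)) by apply: exp_increasing; lra.
  have : 1 * t <= A * t by apply: Rmult_le_compat_r; lra.
  lra.
have eA0 := exp_pos (- A).
have eA1 : exp (- A) <= 1 by rewrite -exp_0; apply: exp_mono; lra.
have eAl : exp (- (K * u) - 1) <= exp (- A).
  case: (Rle_lt_dec A 1) => hA; first by apply: exp_mono; lra.
  have : exp (- (K * u) - 1) <= exp (- (K * u)) by apply: exp_mono; lra.
  have : 1 * t <= A * t by apply: Rmult_le_compat_r; lra.
  lra.
have Av : 112 * (1 + A) <= eps * v.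
  have : eps * x <= eps * v by apply: Rmult_le_compat_l; lra.
  lra.
have Aiv : (1 + A) * / v <= eps / 112.
  by apply: (Rmult_le_reg_r v) => //; rewrite Rmult_assoc vv; lra.
have iv : / v <= eps / 112.
  apply: Rle_trans Aiv; rewrite -[X in X <= _]Rmult_1_l; apply: Rmult_le_compat_r; lra.
pose dd := 1 + 2 / v.
have dd1 : 1 <= dd <= 1 + eps by rewrite /dd /Rdiv; lra.
pose bM := (1 - eps) * c0 * exp x.
have bM0 : 0 < bM by apply: Rmult_lt_0_compat; [apply: Rmult_lt_0_compat; lra|exact: exp_pos].
set M0 := exp ((ln c0 + x - u) / 2).
have M00 : 0 < M0 := exp_pos _.
have thM : th = M0 * x.
  by rewrite -xE /th /M0 -exp_plus; congr exp; field.
pose G := lam / v * exp (- A) * (1 - 2 * eps) / dd.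
have ddG : dd * G = lam / v * exp (- A) * (1 - 2 * eps) by rewrite /G; field; split; lra.
have ib : / (2 * INR b) <= eps / 4.
  have : / (2 * INR b) <= / x by apply: Rinv_le_contravar; lra.
  have : / x <= eps / 4.
    by apply: (Rmult_le_reg_r x); [lra|rewrite xx; lra].
  lra.
have lv0 : 0 < lam / v by apply: Rdiv_lt_0_compat.
have R1 : lam * (t + 7 * exp (- A) / v) <= L.
  have : exp (- A) * / v <= t * (eps / 112).
    apply: (Rle_trans _ ((1 + A) * t * / v)); first by apply: Rmult_le_compat_r; lra.
    by rewrite (Rmult_comm (1 + A)) Rmult_assoc; apply: Rmult_le_compat_l; lra.
  move=> H; apply: Rle_trans Lge; rewrite Rmult_assoc; apply: Rmult_le_compat_l; first lra.
  have te : 0 <= t * eps by apply: Rmult_le_pos; lra.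
  by rewrite /Rdiv in H *; lra.
have R2 : A / v <= / 2 by rewrite /Rdiv; lra.
have R3 : 28 <= INR b * v.
  have : x * 1 <= INR b * v by apply: mulr_le1; split; lra.
  lra.
have R4 : L * dd * 4 <= lam * exp (kap * (INR b * v)).
  have K1 : eps / 8 * x <= kap * (INR b * v).
    have -> : kap * (INR b * v) = eps / 8 * (INR b / T).
      by rewrite /kap; field; split; lra.
    apply: Rmult_le_compat_l; first lra.
    apply: (Rmult_le_reg_r T); first lra.
    rewrite /Rdiv Rmult_assoc Rinv_l ?Rmult_1_r; last lra.
    have : x * T * 1 <= x * T * T by apply: Rmult_le_compat_l; [apply: Rmult_le_pos|]; lra.
    lra.
  have K2 : 16 * T <= exp (kap * (INR b * v)).
    have : exp (ln 16 + K * u) <= exp (kap * (INR b * v)) by apply: exp_mono; lra.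
    by rewrite exp_plus exp_ln //; lra.
  have : L * dd <= 2 * lam * T * 2 by apply: mulr_le1; lra.
  have : lam * (16 * T) <= lam * exp (kap * (INR b * v)) by apply: Rmult_le_compat_l; lra.
  lra.
have V1 : 2 * INR b * v * L / h ^ 2 <= eps / 8.
  have hh : h ^ 2 = exp (2 * x / 3) by rewrite /h /= Rmult_1_r -exp_plus; congr exp; field.
  have hh0 : 0 < h ^ 2 by rewrite hh; exact: exp_pos.
  have bb : 2 * INR b <= 4 * (T * T * x) by lra.
  have bv : 2 * INR b * v <= 4 * (T * T * x) * (2 * x).
    have : (1 + eps) * x <= 2 * x by apply: Rmult_le_compat_r; lra.
    by move=> v2x; apply: mulr_le1; split=> //; lra.
  have : 2 * INR b * v * L <= 4 * (T * T * x) * (2 * x) * (2 * lam * T).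
    by apply: mulr_le1; split=> //; apply: Rmult_le_pos; lra.
  have E1 : 4 * (T * T * x) * (2 * x) * (2 * lam * T)
      = exp (ln 16 + 3 * (K * u) + 2 * u + (lc + x + u) / 2).
    have e3 : exp (3 * (K * u)) = T * T * T.
      by rewrite /T -!exp_plus; congr exp; ring.
    have e2 : exp (2 * u) = x * x by rewrite -{1 2}xE -exp_plus; congr exp; ring.
    by rewrite !exp_plus e3 e2 exp_ln -/lam; lra.
  have E2 : exp (ln 16 + 3 * (K * u) + 2 * u + (lc + x + u) / 2) <= exp (ln (eps / 8) + 2 * x / 3).
    by apply: exp_mono; lra.
  rewrite E1 => F; apply: (Rmult_le_reg_r (h ^ 2)) => //.
  rewrite /Rdiv Rmult_assoc Rinv_l ?Rmult_1_r; last lra.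
  apply: Rle_trans F _; apply: Rle_trans E2 _.
  by rewrite exp_plus exp_ln -?hh; lra.
(* Markov retains only a proportion of order [eps]: the mean size is near [(1 - 2 * eps) * Q] and
   the threshold is [(1 - eps) * Q]. This costs just [ln (eps / 2)] in the exponent. *)
have V2 : (lam ^ 2 * (/ v + 7 / v ^ 2) + dd * L) / bM <= 1 - 3 / 4 * eps.
  set Q := c0 * exp x.
  have Q0 : 0 < Q by apply: Rmult_lt_0_compat; [|exact: exp_pos].
  have l2 : lam ^ 2 = (1 - 2 * eps) * Q * x.
    by rewrite lamE /lc !exp_plus !exp_ln ?xE /Q; lra.
  have l3 : lam ^ 2 * / v <= (1 - 2 * eps) * Q.
    apply: (Rmult_le_reg_r v) => //; rewrite Rmult_assoc vv Rmult_1_r l2.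
    by apply: Rmult_le_compat_l => //; apply: Rmult_le_pos; lra.
  have l4 : lam ^ 2 * (/ v + 7 / v ^ 2) <= (1 - 2 * eps) * Q * (1 + eps / 8).
    have -> : lam ^ 2 * (/ v + 7 / v ^ 2) = lam ^ 2 * / v * (1 + 7 * / v) by field; lra.
    apply: mulr_le1; split; try lra.
    by apply: Rmult_le_pos; [exact: pow2_ge_0|lra].
  have l5 : dd * L <= eps / 8 * Q.
    have : dd * L <= 2 * (2 * lam * T) by apply: mulr_le1; lra.
    have : exp (ln 4 + (lc + x + u) / 2 + K * u) <= exp (ln (eps * c0 / 8) + x) by apply: exp_mono; lra.
    have ec : 0 < eps * c0 by apply: Rmult_lt_0_compat.
    by rewrite !exp_plus !exp_ln -/lam -/T /Q; lra.
  apply: (Rmult_le_reg_r bM) => //; rewrite /Rdiv Rmult_assoc Rinv_l ?Rmult_1_r; last lra.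
  have -> : bM = (1 - eps) * Q by rewrite /bM /Q; ring.
  have eQ : 0 <= eps * eps * Q by apply: Rmult_le_pos; [exact: Rle_0_sqr|lra].
  lra.
have R5 : 0 <= 1 - / (2 * INR b) - 8 * (1 + A) / v by rewrite /Rdiv; lra.
have X1 : 1 - 2 * eps <= 1 - / (2 * INR b) - 8 * (1 + A) / v by rewrite /Rdiv; lra.
have R6 : dd * G <= lam / v * exp (- A) * (1 - / (2 * INR b) - 8 * (1 + A) / v).
  by rewrite ddG; apply: Rmult_le_compat_l => //; apply: Rmult_le_pos; lra.
have R7 : dd * G <= lam / v * (1 - / (2 * INR b) - 8 / v) - dd * kap * L.
  have kL : dd * kap * L <= lam / v * (eps / 2).
    have -> : lam / v * (eps / 2) = 2 * kap * (2 * lam * T).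
      by rewrite /kap; field; split; lra.
    apply: mulr_le1; split=> //; first by apply: Rmult_le_pos; lra.
    by apply: Rmult_le_compat_r; lra.
  have : lam / v * exp (- A) * (1 - 2 * eps) <= lam / v * 1 * (1 - 2 * eps).
    by apply: Rmult_le_compat_r; [lra|apply: Rmult_le_compat_l; lra].
  have : lam / v * (1 - 3 / 2 * eps) <= lam / v * (1 - / (2 * INR b) - 8 / v).
    by apply: Rmult_le_compat_l; [lra|rewrite /Rdiv; lra].
  by rewrite ddG; have : 0 <= lam / v * eps by [apply: Rmult_le_pos; lra]; lra.
have v1 : 1 <= v by lra.
have k00 : 0 <= eps / 2 by lra.
have VV : 2 * INR b * v * L / h ^ 2 + (lam ^ 2 * (/ v + 7 / v ^ 2) + dd * L) / bM <= 1 - eps / 2 by lra.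
have RI := resonator_inequality q0 b0 lam0 Y1 v1 qY A0 HE Ht L0 R1 R2 (conj kap0 kap2) R3 R4 h0 bM0 k00 VV R5 R6 R7.
exists (plist q Y (Y ^ (2 * b))), (rweight lam); split.
  split; [by move=> p; apply: rweight_ge0; lra|exact: plist_prime|exact: plist_uniq|exact: plist_coprime].
have -> : t * th - ln 16 = L + h by rewrite /L; ring.
apply: Rle_trans RI.
apply: Rmult_le_compat_l.
  elim/big_ind: _ => [|y z|p _]; [lra|exact: Rmult_le_pos|].
  by have := pow2_ge_0 (rweight lam p); lra.
rewrite -{1}(exp_ln (eps / 2)); last lra.
rewrite -exp_plus; apply: exp_mono.
have ee : 0 <= eps * eps := Rle_0_sqr eps.
(* The losses are [2 * eps] from [lam] against [th], [eps] from [v] against [x], [eps] from [dd],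
   and [2 * eps] already present in [G]. *)
have G1 : (1 - 7 * eps) * (exp (- A) * M0) <= G.
  have l1 : (1 - 2 * eps) * (M0 * x) <= lam.
    have : exp (ln (1 - 2 * eps)) <= exp (ln (1 - 2 * eps) / 2) by apply: exp_mono; lra.
    rewrite exp_ln; last lra.
    have : lam = th * exp (ln (1 - 2 * eps) / 2).
      by rewrite thE Rmult_assoc /rho -exp_plus (_ : _ + _ = 0) ?exp_0; [ring|field].
    rewrite -thM => -> ?; rewrite Rmult_comm; apply: Rmult_le_compat_l => //.
    exact: Rlt_le (exp_pos _).
  have l2 : (1 - 3 * eps) * M0 <= lam / v.
    apply: (Rmult_le_reg_r v) => //; rewrite /Rdiv (Rmult_assoc lam) vv Rmult_1_r.
    apply: Rle_trans l1; apply: (Rle_trans _ ((1 - 3 * eps) * M0 * ((1 + eps) * x))).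
      by apply: Rmult_le_compat_l => //; apply: Rmult_le_pos; lra.
    have : (1 - 3 * eps) * (1 + eps) * (M0 * x) <= (1 - 2 * eps) * (M0 * x).
      by apply: Rmult_le_compat_r; [apply: Rmult_le_pos|]; lra.
    lra.
  have l3 : 1 - eps <= / dd.
    apply: (Rmult_le_reg_r dd); first lra.
    rewrite Rinv_l; last lra.
    have : (1 - eps) * dd <= (1 - eps) * (1 + eps) by apply: Rmult_le_compat_l; lra.
    lra.
  have l4 : (1 - 3 * eps) * M0 * (1 - eps) <= lam / v * / dd.
    by apply: mulr_le1; split=> //; [apply: Rmult_le_pos|]; lra.
  have l5 : (1 - 3 * eps) * M0 * (1 - eps) * (exp (- A) * (1 - 2 * eps)) <=
       lam / v * / dd * (exp (- A) * (1 - 2 * eps)).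
    by apply: Rmult_le_compat_r => //; apply: Rmult_le_pos; lra.
  have l6 : (1 - 7 * eps) * (exp (- A) * M0) <= (1 - 3 * eps) * (1 - eps) * (1 - 2 * eps) * (exp (- A) * M0).
    apply: Rmult_le_compat_r; first by apply: Rmult_le_pos; lra.
    have : eps * eps * eps <= eps * eps * 1 by apply: Rmult_le_compat_l; lra.
    lra.
  by rewrite /G /Rdiv; rewrite /Rdiv in l5; lra.
(* This covers the [3 / 2 * h] lost in [L / 2 - h] and the constants [ln 16] and [ln (eps / 2)],
   which are at most of order [x / 3 <= h]. *)
have G2 : 3 * h <= eps * (exp (- A) * M0).
  have : exp (ln 3 + x / 3) <= exp (ln eps + (- (K * u) - 1) + (ln c0 + x - u) / 2).
    by apply: exp_mono; lra.
  rewrite exp_plus [X in _ <= X]exp_plus [X in _ <= X * _]exp_plus !exp_ln; try lra.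
  rewrite -/h -/M0 => H; apply: Rle_trans H _.
  rewrite Rmult_assoc; apply: Rmult_le_compat_l; first lra.
  by apply: Rmult_le_compat_r; lra.
by rewrite /L; lra.
Qed.
End Asymptotics.

(** * From the resonance inequalities to the two bounds for [Delta_chi] *)

Module Assembly.
Import all_boot Sums Dirichlet PrimeSums Resonator Reduction PrimeModulus ExpIntegral Asymptotics.
Set Implicit Arguments. Unset Strict Implicit. Unset Printing Implicit Defensive.
Open Scope R_scope.

Definition floor_nat (y : R) : nat := Z.to_nat (Int_part y).

Lemma floor_natP y : 0 <= y -> INR (floor_nat y) <= y < INR (floor_nat y) + 1.
Proof.
move=> y0; have [h1 h2] := base_Int_part y.
have z0 : (0 <= Int_part y)%Z.
  have h : ~ (Int_part y <= -1)%Z by move/IZR_le; lra.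
  lia.
by rewrite /floor_nat INR_IZR_INZ Znat.Z2Nat.id //; lra.
Qed.

Lemma leq_floor_nat y n : INR n <= y -> (n <= floor_nat y)%N.
Proof.
move=> ny; have y0 : 0 <= y by have := pos_INR n; lra.
have [_ h] := floor_natP y0.
have : INR n < INR (floor_nat y).+1 by rewrite S_INR; lra.
by move/INR_lt/ltP; rewrite ltnS.
Qed.

Lemma leq_floor_ln b u : (0 < u)%N -> ln (INR u) <= b -> (u <= floor_nat (exp b))%N.
Proof.
move=> u0 h; apply: leq_floor_nat; rewrite -(exp_ln (INR u)); first exact: exp_mono.
exact: INR_gt0.
Qed.

(** The supremum lives in [Rbar]. An infinite one is trivial; a negative one or that of an empty
    family would make [B = 0] admissible, contradicting [0 < V]. *)
Lemma Delta_chi_lower (y : R) (q : nat) (V : R) : 0 < V ->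
  (forall B, 0 <= B -> charsum_bounded q (floor_nat y) B -> V <= B) ->
  Rbar_le (Rbar.Finite V) (Delta_chi y q).
Proof.
move=> V0 H; rewrite /Delta_chi; set E := (X in Lub_Rbar X).
have [ub _] := Lub_Rbar_correct E.
have bounded c : Lub_Rbar E = Rbar.Finite c -> charsum_bounded q (floor_nat y) c.
  move=> Ec chi dc nc; have := ub (Cmod (char_sum chi y)); rewrite Ec; apply.
  by exists chi.
case L : (Lub_Rbar E) (bounded) => [c||] //= bnd.
  have bc := bnd c erefl; case: (Rle_lt_dec 0 c) => c0; first exact: H.
  have : V <= 0; last lra.
  apply: H; first lra.
  by move=> chi dc nc; have := bc chi dc nc; lra.
have : V <= 0; last by move=> ?; lra.
apply: H; first lra.
move=> chi dc nc; exfalso; have := ub (Cmod (char_sum chi y)); rewrite L; apply.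
by exists chi.
Qed.

Lemma prime_of_Zprime q : Znumtheory.prime (Z.of_nat q) -> prime q.
Proof.
move=> pq; have q1 : (1 < q)%N by case: pq; lia.
apply/primeP; split=> // d /dvdnP[k E].
have dq : (Z.of_nat d | Z.of_nat q)%Z by exists (Z.of_nat k); rewrite E; lia.
have := prime_divisors _ pq _ dq => H; apply/orP.
by case: H => [|[|[|]]] H; [lia|left|right|lia]; apply/eqP; lia.
Qed.

(** A small proportion of the gain exceeds [ln (ln q)], so constants and powers of [ln q] in front
    of the character sum are absorbed. *)
Lemma ev_gain c0 K eps c : 0 < c0 <= 1 -> 0 < K -> 0 < eps -> 0 <= c -> eventually_R (fun x => forall t A : R,
  exp (- (K * ln x)) <= t -> 0 < A -> A * t <= exp (- A) ->
  c + x <= eps * (exp (- A) * exp ((ln c0 + x - ln x) / 2))).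
Proof.
move=> [c00 c01] K0 e0 cpos.
have p6 : 0 < / 6 by lra.
have ev := ev_and (ev_ge 1) (@ev_ln_le (/ 6) (ln (3 + c) + 1 - ln eps - ln c0 / 2) (K + 1) p6).
apply: (ev_imp _ ev) => {ev} x [x1 H] t A t1 A0 At.
set u := ln x in H t1 *.
have u0 : 0 <= u by rewrite /u -ln_1; apply: ln_mono; lra.
have Ku0 : 0 <= K * u by apply: Rmult_le_pos; lra.
have eAl : exp (- (K * u) - 1) <= exp (- A).
  case: (Rle_lt_dec A 1) => hA; first by apply: exp_mono; lra.
  have : exp (- (K * u) - 1) <= exp (- (K * u)) by apply: exp_mono; lra.
  have : 1 * t <= A * t by apply: Rmult_le_compat_r; [have := exp_pos (- (K * u))|]; lra.
  lra.
have M0 := exp_pos ((ln c0 + x - u) / 2).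
have E : exp (ln (3 + c) + x / 3) <= exp (ln eps + (- (K * u) - 1) + (ln c0 + x - u) / 2) by apply: exp_mono; lra.
rewrite exp_plus [X in _ <= X]exp_plus [X in _ <= X * _]exp_plus !exp_ln in E; try lra.
have h := exp_ineq1_le (x / 3).
have : (3 + c) * (1 + x / 3) <= (3 + c) * exp (x / 3) by apply: Rmult_le_compat_l; lra.
have : eps * exp (- (K * u) - 1) * exp ((ln c0 + x - u) / 2) <=
       eps * exp (- A) * exp ((ln c0 + x - u) / 2).
  by apply: Rmult_le_compat_r; [lra|apply: Rmult_le_compat_l; lra].
have : 0 <= c * x by apply: Rmult_le_pos; lra.
lra.
Qed.

(** [N] is a power of [q] with exponent tending to 0, even after multiplication by [ln q]. *)
Lemma ev_size c0 K eps c : 0 < c0 <= 1 -> 0 < K -> 0 < eps -> eventually_R (fun x => forall t : R,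
  t <= exp (K * ln x) -> t * exp ((ln c0 + x + ln x) / 2) + x + c <= eps * exp x).
Proof.
move=> [c00 c01] K0 e0.
have p2 : 0 < / 2 by lra.
have p1 : 0 < 1 by lra.
have ev := ev_and (ev_ge (2 * Rabs c / eps)) (ev_and (ev_ge 1) (ev_and (@ev_ln_le (/ 2) (- ln (eps / 4)) (K + 1) p2)
  (@ev_ln_le 1 (- ln (eps / 4)) 1 p1))).
apply: (ev_imp _ ev) => {ev} x [x0 [x1 [H1 H2]]] t t2.
have lc0 : ln c0 <= 0 by rewrite -ln_1; apply: ln_mono.
set u := ln x in H1 H2 t2 *.
have u0 : 0 <= u by rewrite /u -ln_1; apply: ln_mono; lra.
have xE : exp u = x by rewrite /u exp_ln; lra.
have e1 : t * exp ((ln c0 + x + u) / 2) <= eps / 4 * exp x.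
  apply: (Rle_trans _ (exp (K * u) * exp ((ln c0 + x + u) / 2))).
    by apply: Rmult_le_compat_r t2; exact: Rlt_le (exp_pos _).
  rewrite -exp_plus -{1}(exp_ln (eps / 4)); last lra.
  by rewrite -exp_plus; apply: exp_mono; lra.
have e2 : x <= eps / 4 * exp x.
  rewrite -{1}xE -{1}(exp_ln (eps / 4)); last lra.
  by rewrite -exp_plus; apply: exp_mono; lra.
have e3 : c <= eps / 2 * exp x.
  have h := exp_ineq1_le x.
  have : 2 * Rabs c / eps * (eps / 2) <= exp x * (eps / 2) by apply: Rmult_le_compat_r; lra.
  have -> : 2 * Rabs c / eps * (eps / 2) = Rabs c by field; lra.
  by have := Rle_abs c; lra.
lra.
Qed.

Lemma sqrt_exp y : R_sqrt.sqrt (exp y) = exp (y / 2).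
Proof.
have -> : exp y = exp (y / 2) * exp (y / 2) by rewrite -exp_plus; congr exp; field.
by apply: sqrt_square; exact: Rlt_le (exp_pos _).
Qed.

Lemma totient_lower_ln q x : (0 < q)%N -> 0 <= x -> ln (INR q) = exp x -> INR q <= INR (totient q) * (3 * exp x).
Proof.
move=> q0 x0 qx; have h1 := INR_leq (totient_lower q0); have h2 := size_primes q0.
rewrite mult_INR S_INR in h1; apply: Rle_trans h1 _; apply: Rmult_le_compat_l; first exact: pos_INR.
have l2 := ln_lt_2; have s0 := pos_INR (size (primes q)); have ex := exp_ineq1_le x.
rewrite qx in h2; nra.
Qed.

Lemma general_modulus K eps : 0 < K -> 0 < eps -> eventually_R (fun x => forall (q : nat) (tau A tau' : R),
  (0 < q)%N -> ln (INR q) = exp x -> exp (- (K * ln x)) <= tau <= exp (K * ln x) -> 0 < A ->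
  is_RInt_gen (fun y => exp (- y) / y) (at_point A) (Rbar_locally p_infty) tau ->
  is_RInt_gen (fun y => exp (- y) / y ^ 2) (at_point A) (Rbar_locally p_infty) tau' ->
  Rbar_le (Rbar.Finite (exp (tau * exp ((x + ln x) / 2) / 2
       + (1 - eps) * (A * (tau + tau')) * exp ((x - ln x) / 2))))
    (Delta_chi (exp (tau * exp ((x + ln x) / 2))) q)).
Proof.
(* Eight parts of [eps] are spent in [resonator_exists]; the ninth absorbs the remaining factors. *)
move=> K0 e0; pose e := Rmin (eps / 9) (/ 9).
have ep : 0 < e by apply: Rmin_glb_lt; lra.
have e1 : e <= / 9 by exact: Rmin_r.
have e8 : 0 < e <= / 8 by lra.
have e9 : 9 * e <= eps by have := Rmin_l (eps / 9) (/ 9); rewrite -/e; lra.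
have c1 : 0 < 1 <= 1 by lra.
have ev := ev_and (ev_ge 1) (ev_and (resonator_exists c1 K0 e8)
   (ev_and (ev_gain c1 K0 ep Rle_0_1) (@ev_size 1 K e 5 c1 K0 ep))).
apply: (ev_imp _ ev) => {ev} x [x1 [HR [HG HS]]] q t A t' q0 qx [t1 t2] A0 It It'.
have [B1 B2] := exp_integral_bounds _ _ _ A0 It It'.
have [E [HE Ht]] := exp_integral_primitive _ _ A0 It.
rewrite (exp_integral_sum _ _ _ A0 It It').
have [l [r [[r0 lp lu lq] HC]]] := HR q t A E q0 qx (conj t1 t2) A0 (conj B1 B2) HE Ht.
have {}HG := HG t A t1 A0 B1; have {}HS := HS t t2.
rewrite ln_1 !Rplus_0_l Rmult_1_r in HC HG HS.
set th := exp ((x + ln x) / 2) in HC HS *; set M0 := exp ((x - ln x) / 2) in HC HG *.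
have th0 : 0 < th := exp_pos _.
have t0 : 0 < t by have := exp_pos (- (K * ln x)); lra.
have tth : 0 <= t * th by apply: Rmult_le_pos; lra.
have qR : 0 < INR q := INR_gt0 q0.
have qE : INR q = exp (exp x) by rewrite -qx exp_ln.
apply: Delta_chi_lower; first exact: exp_pos.
move=> B Bpos HB.
set b := (1 - e) * exp x in HC.
have ex := exp_ineq1_le x.
have b0 : 0 <= b by apply: Rmult_le_pos; lra.
set M := floor_nat (exp b).
have [M1 M2] := floor_natP (Rlt_le _ _ (exp_pos b)); rewrite -/M in M1 M2.
have Mq : (M < q)%N.
  apply/ltP/INR_lt; apply: Rle_lt_trans M1 _; rewrite qE; apply: exp_increasing.
  have : 0 < e * exp x by apply: Rmult_lt_0_compat; lra.
  by rewrite /b; lra.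
have q1 : (1 < q)%N.
  apply/ltP/INR_lt; rewrite qE -[INR 1]/1 -exp_0; apply: exp_increasing; exact: exp_pos.
have eb1 : 1 <= exp b by rewrite -exp_0; apply: exp_mono.
have [x2 x3] := floor_natP (Rlt_le _ _ (exp_pos (t * th))).
have Ha u : (0 < u)%N -> ln (INR u) <= t * th - ln 16 -> (u <= floor_nat (exp (t * th)))%N.
  move=> u0 h; apply: leq_floor_ln => //.
  have : 0 <= ln 16 by rewrite -ln_1; apply: ln_mono; lra.
  lra.
have HM := resonance_general r0 Mq lp lu lq q1 Bpos HB Ha (fun m => @leq_floor_ln b m).
have P1 : 1 <= \prod_(p <- l) (1 + r p ^ 2).
  elim/big_ind: _ => [|y z y1 z1|p _]; [lra|nra|by have := pow2_ge_0 (r p); lra].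
set P := \prod_(p <- l) _ in HC HM P1.
have phi0 : 0 < INR (totient q) by apply: INR_gt0; rewrite totient_gt0.
(* The trivial character adds at most 1: [M] is about [q ^ (1 - e)], and [q ^ e] exceeds [N] times
   the loss [3 * exp x] in the totient bound. *)
have small : INR (floor_nat (exp (t * th))) * INR M.+1 / INR (totient q) <= 1.
  apply: (Rmult_le_reg_r (INR (totient q))) => //; rewrite /Rdiv Rmult_assoc Rinv_l ?Rmult_1_r ?Rmult_1_l; last lra.
  apply: (Rmult_le_reg_r (3 * exp x)); first lra.
  have x0 : 0 <= x by lra.
  apply: Rle_trans (totient_lower_ln q0 x0 qx).
  apply: (Rle_trans _ (exp (t * th) * (2 * exp b) * (3 * exp x))).
    apply: Rmult_le_compat_r; first lra.
    by apply: mulr_le1; split; try exact: pos_INR; rewrite ?S_INR; lra.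
  have -> : exp (t * th) * (2 * exp b) * (3 * exp x) = 6 * exp (t * th + b + x).
    by rewrite !exp_plus; ring.
  have e6 := exp_ineq1_le 5.
  apply: (Rle_trans _ (exp 5 * exp (t * th + b + x))).
    by apply: Rmult_le_compat_r; [exact: Rlt_le (exp_pos _)|lra].
  by rewrite -exp_plus qE; apply: exp_mono; rewrite /b; lra.
have HB1 : exp (t * th / 2 + (1 - 8 * e) * exp (- A) * M0) <= B + 1.
  apply: (Rmult_le_reg_l P); first lra.
  apply: Rle_trans HC _; apply: Rle_trans HM _; rewrite Rmult_comm.
  by apply: Rmult_le_compat_l; lra.
have gE : 0 < exp (- A) * M0 by apply: Rmult_lt_0_compat; exact: exp_pos.
have X : exp (t * th / 2 + (1 - 9 * e) * (exp (- A) * M0)) + 1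
     <= exp (t * th / 2 + (1 - 8 * e) * exp (- A) * M0).
  have -> : t * th / 2 + (1 - 8 * e) * exp (- A) * M0 =
     (t * th / 2 + (1 - 9 * e) * (exp (- A) * M0)) + e * (exp (- A) * M0) by ring.
  rewrite [X in _ <= X]exp_plus.
  have a1 : 1 <= exp (t * th / 2 + (1 - 9 * e) * (exp (- A) * M0)).
    rewrite -[X in X <= _]exp_0; apply: exp_mono; apply: Rplus_le_le_0_compat; first lra.
    by apply: Rmult_le_pos; lra.
  have a2 := exp_ineq1_le (e * (exp (- A) * M0)).
  set a := exp (t * th / 2 + _) in a1 *.
  have : a * 2 <= a * exp (e * (exp (- A) * M0)) by apply: Rmult_le_compat_l; lra.
  lra.
have Y : exp (t * th / 2 + (1 - eps) * exp (- A) * M0) <= exp (t * th / 2 + (1 - 9 * e) * (exp (- A) * M0)).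
  apply: exp_mono; apply: Rplus_le_compat_l; rewrite Rmult_assoc; apply: Rmult_le_compat_r; lra.
lra.
Qed.

Lemma prime_modulus K eps : 0 < K -> 0 < eps -> eventually_R (fun x => forall (q : nat) (tau A tau' : R),
  prime q -> ln (INR q) = exp x -> exp (- (K * ln x)) <= tau <= exp (K * ln x) -> 0 < A ->
  is_RInt_gen (fun y => exp (- y) / y) (at_point A) (Rbar_locally p_infty) (R_sqrt.sqrt 2 * tau) ->
  is_RInt_gen (fun y => exp (- y) / y ^ 2) (at_point A) (Rbar_locally p_infty) tau' ->
  Rbar_le (Rbar.Finite (exp ((exp x - tau * exp ((x + ln x) / 2)) / 2
       + (1 - eps) * (A * (tau + tau' / R_sqrt.sqrt 2)) * exp ((x - ln x) / 2))))
    (Delta_chi (exp (exp x - tau * exp ((x + ln x) / 2))) q)).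
Proof.
move=> K0 e0; pose e := Rmin (eps / 9) (/ 9).
have ep : 0 < e by apply: Rmin_glb_lt; lra.
have e1 : e <= / 9 by exact: Rmin_r.
have e8 : 0 < e <= / 8 by lra.
have e9 : 9 * e <= eps by have := Rmin_l (eps / 9) (/ 9); rewrite -/e; lra.
have c1 : 0 < / 2 <= 1 by lra.
(* The integral now equals [sqrt 2 * tau], which may exceed the power [K] of [x]; one more power of
   [x] covers the square root of 2. *)
have K1 : 0 < K + 1 by lra.
have p2 : 0 < / 2 by lra.
have c23 : 0 <= 23 by lra.
have ev := ev_and (ev_ge 2) (ev_and (resonator_exists c1 K1 e8)
   (ev_and (ev_gain c1 K1 ep c23) (ev_and (@ev_size (/ 2) (K + 1) e 7 c1 K1 ep) (@ev_ln_le (/ 2) 3 K p2)))).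
apply: (ev_imp _ ev) => {ev} x [x2 [HR [HG [HS HN]]]] q tau A t' qp qx [t1 t2] A0 It It'.
have q0 := prime_gt0 qp.
set s2 := R_sqrt.sqrt 2 in It *.
have s2E : s2 = exp (ln 2 / 2) by rewrite /s2 -sqrt_exp exp_ln //; lra.
have ln2 : / 2 < ln 2 <= 1 by have := ln_lt_2; have := @ln_le_sub1 2; lra.
have s2pos : 0 < s2 by rewrite s2E; exact: exp_pos.
have s22 : s2 * s2 = 2 by apply: sqrt_sqrt; lra.
have s21 : 1 <= s2 <= 2 by split; apply: Rnot_lt_le => h; nra.
set t := s2 * tau in It.
have [B1 B2] := exp_integral_bounds _ _ _ A0 It It'.
have [E [HE Ht]] := exp_integral_primitive _ _ A0 It.
have SA := exp_integral_sum _ _ _ A0 It It'.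
set u := ln x in HR HG HS HN t1 t2 *.
have u0 : 0 <= u by rewrite /u -ln_1; apply: ln_mono; lra.
have xE : exp u = x by rewrite /u exp_ln; lra.
have Ku0 : 0 <= K * u by apply: Rmult_le_pos; lra.
have tau0 : 0 < tau by have := exp_pos (- (K * u)); lra.
have t1' : exp (- ((K + 1) * u)) <= t.
  apply: (Rle_trans _ (exp (- (K * u)))); first by apply: exp_mono; lra.
  apply: Rle_trans t1 _; rewrite -[X in X <= _]Rmult_1_l; apply: Rmult_le_compat_r; lra.
have t2' : t <= exp ((K + 1) * u).
  have -> : (K + 1) * u = u + K * u by ring.
  by rewrite exp_plus xE; apply: mulr_le1; lra.
have [l [r [[r0 lp lu lq] HC]]] := HR q t A E q0 qx (conj t1' t2') A0 (conj B1 B2) HE Ht.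
have {}HG := HG t A t1' A0 B1; have {}HS := HS t t2'.
have lh : ln (/ 2) = - ln 2 by apply: ln_Rinv; lra.
pose th := exp ((x + u) / 2); pose g := exp (- A) * exp ((- ln 2 + x - u) / 2).
(* The [sqrt 2] in the definition of [A] cancels the square root of [c0 = / 2], so the length is [N]
   itself; the same cancellation in [gE] produces [tau + tau' / sqrt 2]. *)
have thE : t * exp ((- ln 2 + x + u) / 2) = tau * th.
  have -> : (- ln 2 + x + u) / 2 = - (ln 2 / 2) + (x + u) / 2 by field.
  by rewrite exp_plus exp_Ropp -s2E /t -/th; field; lra.
have gE : A * (tau + t' / s2) * exp ((x - u) / 2) = g.
  rewrite /g -SA.
  have -> : (- ln 2 + x - u) / 2 = - (ln 2 / 2) + (x - u) / 2 by field.
  by rewrite exp_plus exp_Ropp -s2E /t; field; lra.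
rewrite Rmult_assoc gE -/th; rewrite lh thE in HC HS; rewrite lh -/g in HG.
rewrite Rmult_assoc -/g in HC.
set N := tau * th in HC HS *.
have N4 : 4 <= N.
  have h := exp_ineq1_le (- (K * u) + (x + u) / 2).
  have : exp (- (K * u) + (x + u) / 2) <= N.
    by rewrite exp_plus; apply: Rmult_le_compat_r => //; exact: Rlt_le (exp_pos _).
  lra.
have ln16 : ln 16 <= 4.
  have -> : 16 = 2 * 2 * (2 * 2) by ring.
  by rewrite !ln_mult; lra.
have g0 : 0 < g by apply: Rmult_lt_0_compat; exact: exp_pos.
have qE : INR q = exp (exp x) by rewrite -qx exp_ln //; exact: INR_gt0.
have ex := exp_ineq1_le x.
have eex : e * exp x <= / 9 * exp x by apply: Rmult_le_compat_r; lra.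
apply: Delta_chi_lower; first exact: exp_pos.
move=> B Bpos HB.
set xn := floor_nat _ in HB.
set b := (1 - e) * / 2 * exp x in HC.
have bE : b = exp x / 2 - e * exp x / 2 by rewrite /b; field.
have [M1 _] := floor_natP (Rlt_le _ _ (exp_pos b)); set M := floor_nat (exp b) in M1.
have eb1 : 1 <= exp b by rewrite -[X in X <= _]exp_0; apply: exp_mono; lra.
have [x3 x4] := floor_natP (Rlt_le _ _ (exp_pos (exp x - N))); rewrite -/xn in x3 x4.
(* Here the local [N] is the logarithm of the length. Quotients go up to a sixteenth of the length,
   so [8 * (xn * k0)] is at most half of [q]. *)
pose k0 := floor_nat (exp (N - ln 16)).
have [k1 _] := floor_natP (Rlt_le _ _ (exp_pos (N - ln 16))); rewrite -/k0 in k1.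
have k00 : (0 < k0)%N.
  by apply: leq_floor_nat; rewrite -[INR 1]/1 -exp_0; apply: exp_mono; lra.
have Mq : (2 * M <= q)%N.
  apply/leP/INR_le; rewrite mult_INR -[INR 2]/2 qE.
  apply: (Rle_trans _ (2 * exp b)); first by lra.
  rewrite -{1}(exp_ln 2); last lra.
  by rewrite -exp_plus; apply: exp_mono; lra.
have xq : (8 * (xn * k0) <= q)%N.
  apply/leP/INR_le; rewrite !mult_INR (_ : INR 8 = 8); last by rewrite /=; ring.
  apply: (Rle_trans _ (8 * (exp (exp x - N) * exp (N - ln 16)))).
    apply: Rmult_le_compat_l; first lra.
    by apply: mulr_le1; split=> //; exact: pos_INR.
  have -> : exp (exp x - N) * exp (N - ln 16) = exp (exp x) / 16.
    by rewrite -exp_plus (_ : exp x - N + _ = exp x + - ln 16) ?exp_plus ?exp_Ropp ?exp_ln; [|lra|ring].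
  by rewrite qE; have := exp_pos (exp x); lra.
(* The number of dyadic ranges has order [ln q], a loss that is absorbed by the gain. *)
have [J [J1 J2]] : exists n : nat, 2 * exp x <= INR n <= 2 * exp x + 1 by apply: nat_ceil; lra.
have MJ : (M < 2 ^ J)%N.
  apply/ltP/INR_lt; apply: Rle_lt_trans M1 _.
  have -> : INR (2 ^ J)%N = exp (INR J * ln 2).
    by rewrite -[LHS]exp_ln ?ln_expn //; apply: INR_gt0; rewrite expn_gt0.
  apply: exp_increasing.
  have : INR J * / 2 <= INR J * ln 2 by apply: Rmult_le_compat_l; lra.
  lra.
have HM := resonance_prime r0 lp lu lq qp k00 Mq xq MJ Bpos HB
  (fun v => @leq_floor_ln (N - ln 16) v) (fun m => @leq_floor_ln b m).
have P1 : 1 <= \prod_(p <- l) (1 + r p ^ 2).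
  elim/big_ind: _ => [|y z y1 z1|p _]; [lra|nra|by have := pow2_ge_0 (r p); lra].
set P := \prod_(p <- l) _ in HC HM P1.
set H := exp (N / 2 + (1 - 8 * e) * g) in HC.
have H0 : 0 < H := exp_pos _.
have sq : R_sqrt.sqrt (INR q) = exp (exp x / 2) by rewrite qE sqrt_exp.
have sq0 := exp_pos (exp x / 2).
rewrite sq in HM.
have step1 : INR xn / 2 * H <= INR J * (B * exp (exp x / 2) + 4 * INR M * INR M.+1).
  apply: (Rmult_le_reg_l P); first lra.
  apply: (Rle_trans _ (INR xn / 2 * conf r l (window (N - ln 16) b))).
    have := Rmult_le_compat_l (INR xn / 2) _ _ _ HC => h.
    have h2 := pos_INR xn; have h3 : 0 <= INR xn / 2 by lra.
    by have := h h3; lra.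
  by apply: Rle_trans HM _; lra.
pose W := exp (exp x - N).
have W2 : 2 <= W.
  by rewrite /W -[X in X <= _](exp_ln 2); [apply: exp_mono|]; lra.
have xnW : W / 2 <= INR xn by rewrite -/W in x4; lra.
have MM : 4 * INR M * INR M.+1 <= 8 * exp (2 * b).
  have -> : exp (2 * b) = exp b * exp b by rewrite -exp_plus; congr exp; ring.
  have : INR M * INR M.+1 <= exp b * (2 * exp b).
    by apply: mulr_le1; split; try exact: pos_INR; rewrite ?S_INR; lra.
  lra.
have BS : 0 <= B * exp (exp x / 2) by apply: Rmult_le_pos; lra.
have step2 : W / 4 * H <= 3 * exp x * (B * exp (exp x / 2) + 8 * exp (2 * b)).
  apply: (Rle_trans _ (INR xn / 2 * H)); first by apply: Rmult_le_compat_r; lra.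
  apply: Rle_trans step1 _; apply: mulr_le1; split; try lra.
  have : 0 <= 4 * INR M * INR M.+1 by apply: Rmult_le_pos; [have := pos_INR M; lra|exact: pos_INR].
  lra.
pose D := exp (exp x - N / 2 + (1 - 9 * e) * g).
have WH : W * H = D * exp (e * g).
  by rewrite /W /H /D -!exp_plus; congr exp; field.
have D0 : 0 < D := exp_pos _.
(* The factor 24 is 4 from [W / 4], times 3 from [J <= 3 * exp x], times 2 so that one copy of [D]
   survives the error term. *)
have eg : 24 * exp x <= exp (e * g).
  apply: (Rle_trans _ (exp (23 + x))); last by exact: exp_mono.
  rewrite exp_plus; apply: Rmult_le_compat_r; first lra.
  by have := exp_ineq1_le 23; lra.
have step3 : 2 * D <= B * exp (exp x / 2) + 8 * exp (2 * b).
  apply: (Rmult_le_reg_l (3 * exp x)); first lra.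
  apply: Rle_trans step2.
  have : D * (24 * exp x) <= D * exp (e * g) by apply: Rmult_le_compat_l; lra.
  lra.
(* The condition that fixes [c0 = / 2]: the error of order [M ^ 2] must stay below [q] divided by
   the square root of the length, and here [M ^ 2] is at most [q ^ (1 - e)]. *)
have bD : 8 * exp (2 * b) <= D.
  apply: (Rle_trans _ (exp 7 * exp (2 * b))).
    by apply: Rmult_le_compat_r; [exact: Rlt_le (exp_pos _)|have := exp_ineq1_le 7; lra].
  rewrite -exp_plus; apply: exp_mono.
  have : 0 <= (1 - 9 * e) * g by apply: Rmult_le_pos; lra.
  lra.
have DB : D <= B * exp (exp x / 2) by lra.
apply: (Rle_trans _ (exp ((exp x - N) / 2 + (1 - 9 * e) * g))).
  by apply: exp_mono; apply: Rplus_le_compat_l; apply: Rmult_le_compat_r; lra.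
apply: (Rmult_le_reg_r (exp (exp x / 2))) => //.
apply: Rle_trans DB; rewrite -exp_plus; apply: Req_le; congr exp; field.
Qed.

Lemma eventually_modulus (P : R -> Prop) : eventually_R P ->
  exists q0 : nat, forall q : nat, (q0 <= q)%coq_nat ->
  exists x, [/\ 1 <= x, (0 < q)%N, ln (INR q) = exp x & P x].
Proof.
move=> [X HX]; pose x0 := Rmax X 1.
have [n [n1 _]] : exists n : nat, exp (exp x0) <= INR n <= exp (exp x0) + 1.
  by apply: nat_ceil; exact: Rlt_le (exp_pos _).
exists n => q nq; have h : exp (exp x0) <= INR q by apply: Rle_trans n1 _; exact: le_INR.
have h0 := exp_pos (exp x0); have h1 := exp_pos x0.
have l1 : exp x0 <= ln (INR q) by rewrite -{1}(ln_exp (exp x0)); apply: ln_mono.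
have l2 : x0 <= ln (ln (INR q)) by rewrite -{1}(ln_exp x0); apply: ln_mono.
exists (ln (ln (INR q))); split.
- by apply: Rle_trans l2; exact: Rmax_r.
- by case: q h {nq l1 l2} => // h; move: h; rewrite /=; lra.
- by rewrite exp_ln; lra.
by apply: HX; apply: Rle_trans l2; exact: Rmax_l.
Qed.

Lemma sqrt_mul_exp x : 0 < x -> R_sqrt.sqrt (exp x * x) = exp ((x + ln x) / 2).
Proof. by move=> x0; rewrite -{2}(exp_ln x) // -exp_plus sqrt_exp. Qed.

Lemma sqrt_div_exp x : 0 < x -> R_sqrt.sqrt (exp x / x) = exp ((x - ln x) / 2).
Proof.
by move=> x0; rewrite -{2}(exp_ln x) // /Rdiv -exp_Ropp -exp_plus sqrt_exp.
Qed.

Lemma large_character_sum :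
  forall K eps : R, 0 < K -> 0 < eps ->
    exists q0 : nat, forall q : nat, (q0 <= q)%coq_nat ->
    forall tau A tau' : R,
      Rpower (ln (ln (INR q))) (- K) <= tau <= Rpower (ln (ln (INR q))) K ->
      0 < A ->
      is_RInt_gen (fun x => exp (- x) / x) (at_point A) (Rbar_locally p_infty) tau ->
      is_RInt_gen (fun x => exp (- x) / x ^ 2) (at_point A) (Rbar_locally p_infty) tau' ->
      let N := exp (tau * R_sqrt.sqrt (ln (INR q) * ln (ln (INR q)))) in
      Rbar_le
        (Rbar.Finite (R_sqrt.sqrt N * exp ((1 - eps) * A * (tau + tau')
                               * R_sqrt.sqrt (ln (INR q) / ln (ln (INR q))))))
        (Delta_chi N q).
Proof.
move=> K eps K0 e0; have [q0 H] := eventually_modulus (general_modulus K0 e0).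
exists q0 => q /H [x [x1 qpos qx HP]] tau A tau'.
rewrite qx ln_exp sqrt_mul_exp ?sqrt_div_exp; try lra.
rewrite /Rpower -Ropp_mult_distr_l => Ht A0 It It'.
have := HP q tau A tau' qpos qx Ht A0 It It'.
by rewrite exp_plus -sqrt_exp -Rmult_assoc.
Qed.

Lemma large_character_sum_prime :
  forall K eps : R, 0 < K -> 0 < eps ->
    exists q0 : nat, forall q : nat, (q0 <= q)%coq_nat -> Znumtheory.prime (Z.of_nat q) ->
    forall tau A tau' : R,
      Rpower (ln (ln (INR q))) (- K) <= tau <= Rpower (ln (ln (INR q))) K ->
      0 < A ->
      is_RInt_gen (fun x => exp (- x) / x) (at_point A) (Rbar_locally p_infty) (R_sqrt.sqrt 2 * tau) ->
      is_RInt_gen (fun x => exp (- x) / x ^ 2) (at_point A) (Rbar_locally p_infty) tau' ->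
      let N := exp (tau * R_sqrt.sqrt (ln (INR q) * ln (ln (INR q)))) in
      Rbar_le
        (Rbar.Finite (R_sqrt.sqrt (INR q / N) * exp ((1 - eps) * A * (tau + tau' / R_sqrt.sqrt 2)
                               * R_sqrt.sqrt (ln (INR q) / ln (ln (INR q))))))
        (Delta_chi (INR q / N) q).
Proof.
move=> K eps K0 e0; have [q0 H] := eventually_modulus (prime_modulus K0 e0).
exists q0 => q /H [x [x1 qpos qx HP]] /prime_of_Zprime qp tau A tau'.
have qE : INR q = exp (exp x) by rewrite -qx exp_ln //; exact: INR_gt0.
rewrite qx ln_exp sqrt_mul_exp ?sqrt_div_exp; try lra.
rewrite /Rpower -Ropp_mult_distr_l => Ht A0 It It'.
set N := exp (tau * exp ((x + ln x) / 2)).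
have := HP q tau A tau' qp qx Ht A0 It It'.
have -> : exp (exp x - tau * exp ((x + ln x) / 2)) = INR q / N.
  by rewrite qE /N /Rdiv -exp_Ropp -exp_plus.
rewrite exp_plus -sqrt_exp -Rmult_assoc.
have -> : exp (exp x - tau * exp ((x + ln x) / 2)) = INR q / N.
  by rewrite qE /N /Rdiv -exp_Ropp -exp_plus.
by [].
Qed.

End Assembly.

Theorem theorem3 :
  (* general modulus q *)
  (forall K eps : R, 0 < K -> 0 < eps ->
    exists q0 : nat, forall q : nat, (q0 <= q)%nat ->
    forall tau A tau' : R,
      Rpower (ln (ln (INR q))) (- K) <= tau <= Rpower (ln (ln (INR q))) K ->
      0 < A ->
      is_RInt_gen (fun x => exp (- x) / x) (at_point A) (Rbar_locally p_infty) tau ->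
      is_RInt_gen (fun x => exp (- x) / x ^ 2) (at_point A) (Rbar_locally p_infty) tau' ->
      let N := exp (tau * R_sqrt.sqrt (ln (INR q) * ln (ln (INR q)))) in
      Rbar_le
        (Finite (R_sqrt.sqrt N * exp ((1 - eps) * A * (tau + tau')
                               * R_sqrt.sqrt (ln (INR q) / ln (ln (INR q))))))
        (Delta_chi N q))
  /\
  (* prime modulus q *)
  (forall K eps : R, 0 < K -> 0 < eps ->
    exists q0 : nat, forall q : nat, (q0 <= q)%nat -> Znumtheory.prime (Z.of_nat q) ->
    forall tau A tau' : R,
      Rpower (ln (ln (INR q))) (- K) <= tau <= Rpower (ln (ln (INR q))) K ->
      0 < A ->
      is_RInt_gen (fun x => exp (- x) / x) (at_point A) (Rbar_locally p_infty) (R_sqrt.sqrt 2 * tau) ->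
      is_RInt_gen (fun x => exp (- x) / x ^ 2) (at_point A) (Rbar_locally p_infty) tau' ->
      let N := exp (tau * R_sqrt.sqrt (ln (INR q) * ln (ln (INR q)))) in
      Rbar_le
        (Finite (R_sqrt.sqrt (INR q / N) * exp ((1 - eps) * A * (tau + tau' / R_sqrt.sqrt 2)
                               * R_sqrt.sqrt (ln (INR q) / ln (ln (INR q))))))
        (Delta_chi (INR q / N) q)).
Proof. exact (conj Assembly.large_character_sum Assembly.large_character_sum_prime). Qed.
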